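(* The following two statements hold: (i) There exists a function $f\in\mathscr{H}^\infty$ such that the limit \[ \lim_{T \to \infty} \frac{1}{T} \int_0^T |f(it)|^2\, dt \] does not exist. (ii) Given $\varepsilon >0$, there exists a singular inner function $g$ in $\mathscr{H}^\infty$ such that $\| g\|_{2}\leq \varepsilon$.
   Context: $\mathscr{H}^\infty$ denotes the class of functions $f(s)$ that are bounded and analytic in the right half-plane $\{s\in\mathbb{C}:\Re s>0\}$ and that are represented in some half-plane $\Re s>\sigma_0$ by an ordinary Dirichlet series $f(s)=\sum_{n=1}^\infty a_n n^{-s}$. For such $f$ one sets $\|f\|_2^2=\sum_{n=1}^\infty |a_n|^2$. For $f\in\mathscr{H}^\infty$ and $t\in\mathbb{R}$, $f(it)$ denotes the nontangential limit of $f$ at the boundary point $it$, which exists for almost every $t$. A singular inner function in $\mathscr{H}^\infty$ is a function in $\mathscr{H}^\infty$ which is a singular inner function of the right half-plane: it has no zeros in $\Re s>0$, is bounded by $1$ there, and its nontangential boundary values satisfy $|g(it)|=1$ for almost every $t\in\mathbb{R}$. *)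

(* Defs.v *)
From mathcomp Require Import all_boot all_order all_algebra.
From mathcomp Require Import all_classical all_reals all_analysis.
From mathcomp Require Import complex.

Set Implicit Arguments.
Unset Strict Implicit.
Unset Printing Implicit Defensive.

Import Order.TTheory GRing.Theory Num.Theory.
Import numFieldNormedType.Exports.

Local Open Scope classical_set_scope.
Local Open Scope ring_scope.
Local Open Scope complex_scope.

(* R[i] itself carries no topology in the library; viewed as a numFieldType
   it inherits the topology of its modulus and is a normed module over itself,
   so that derivable on Cplx R is complex differentiability. *)
Definition Cplx (R : realType) : numFieldType := R[i].

Section HardyDirichlet.
Context {R : realType}.
Local Notation C := (Cplx R).
Implicit Types (f : C -> C) (a : nat -> C) (s z l : C) (t : R).

Definition re z : R := complex.Re z.
Definition im z : R := complex.Im z.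

(* `|z| is an element of C; cabs z is the same number as an element of R. *)
Definition cabs z : R := re `|z|.

Definition cexp z : C :=
  (expR (re z) * cos (im z)) +i* (expR (re z) * sin (im z)).

(* n^{-s} = exp(- s ln n), for n >= 1. *)
Definition nat_cpowN (n : nat) s : C := cexp (- (s * ((ln n%:R : R)%:C : C))).

Definition right_half_plane : set C := [set s | 0 < re s].

Definition analytic_in (D : set C) f : Prop :=
  forall s, D s -> derivable f s 1.

Definition bounded_in (D : set C) f : Prop :=
  exists M : R, forall s, D s -> cabs (f s) <= M.

(* Coefficients are indexed from 1; a 0 plays no role. *)
Definition represented_by f a : Prop :=
  exists sigma0 : R, forall s, sigma0 < re s ->
    (\sum_(1 <= n < N) a n * nat_cpowN n s) @[N --> \oo] --> f s.

(* Functions on the right half-plane are encoded as total functions; only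
   their values on the right half-plane matter. *)
Definition Hinfty f : Prop :=
  [/\ bounded_in right_half_plane f, analytic_in right_half_plane f &
      exists a, represented_by f a].

(* ||f||_2 for the function f represented by a; such an f determines a n for
   all n >= 1. *)
Definition norm2 a : \bar R :=
  sqrte (\sum_(1 <= n <oo) ((cabs (a n)) ^+ 2)%:E)%E.

Definition stolz_region t (c : R) : set C :=
  [set s | 0 < re s /\ `|im s - t| <= c * re s].

Definition nontangential_limit f t l : Prop :=
  forall c : R, 0 < c ->
    f z @[z --> within (stolz_region t c) (nbhs (0 +i* t : C))] --> l.

(* f(it), with value 0 where there is no nontangential limit. *)
Definition boundary_value f t : C :=
  xget 0 [set l | nontangential_limit f t l].

(* As the default boundary value is 0, the last clause includes the existence
   of the nontangential limit at almost every point. *)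
Definition singular_inner f : Prop :=
  [/\ analytic_in right_half_plane f,
      forall s, right_half_plane s -> f s != 0,
      forall s, right_half_plane s -> cabs (f s) <= 1 &
      {ae (@lebesgue_measure R), forall t, cabs (boundary_value f t) = 1}].

Definition boundary_mean f (T : R) : R :=
  T^-1 * \int[@lebesgue_measure R]_(t in `[0, T])
           (cabs (boundary_value f t)) ^+ 2.

End HardyDirichlet.

(* Main.v *)
Require Import Defs.
From mathcomp Require Import all_boot all_order all_algebra.
From mathcomp Require Import all_classical all_reals all_analysis.
From mathcomp Require Import complex ring lra measurable_realfun.

Set Implicit Arguments.
Unset Strict Implicit.
Unset Printing Implicit Defensive.

Import Order.TTheory GRing.Theory Num.Theory.
Import numFieldNormedType.Exports.

Local Open Scope classical_set_scope.
Local Open Scope ring_scope.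

(* Let phi_k >= 0 be trigonometric polynomials in t with frequencies ln (a / b) and
   with sum_k phi_k <= c.  Multiplying by q_k^{-s} for a large common denominator q_k
   turns phi_k(s) into a Dirichlet polynomial, and since Re (-2 w / (1 - w)) = 1 when
   |w| = 1, the Dirichlet series F_k = -2 phi_k w / (1 - w), w = q_k^{-s}, satisfies
   Re F_k(it) = phi_k(t) almost everywhere, although F_k vanishes at +oo.  Its real
   part in the half-plane lies below the Poisson extension of phi_k.  Hence
   g = exp (sum_k F_k - c) is zero-free and bounded by 1, with
   |g(it)| = exp (sum_k phi_k(t) - c), while ||g||_2^2 <= exp (-2 c) + sum_k mean phi_k / c.

   Take phi_k = c e_k prod_{j<k} (1 - e_j) with 0 <= e_j <= 1, so that
   sum_{k<n} phi_k = c (1 - prod_{j<n} (1 - e_j)).  For (ii), let e_j be close to 1 on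
   [-j, j] with tiny mean: then sum_k phi_k(t) = c everywhere and g is inner.  For (i),
   let e_k be negligible up to A_k, of average at least 1/8 on some [0, B_k], and of
   negligible average on [0, T] for all T >= A_{k+1}: the means of |g(it)|^2 over
   [0, B_k] and over [0, A_{k+1}] then stay apart. *)

(** * Complex numbers *)

Section ComplexNumbers.
Context {R : realType}.
Local Notation C := (Cplx R).
Implicit Types (z w : C) (x y : R).

(** A nonconstant real [phi k] has frequencies of both signs, so its continuation is unbounded in
    the half-plane and is no ordinary Dirichlet series. The factor $w/(1-w)$ cures this at the price
    of possible poles at the points of $(2\pi/\ln q_k)i\mathbb{Z}$, which become ever denser on the
    axis. Boundary values can therefore be controlled almost everywhere only: inside $[-k,k]$,
    intervals of length about $4^{-k}/\ln q_k$ around these points have total length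
    $O((k+1)4^{-k})$ whatever $q_k$ is, so by Borel-Cantelli almost every $t$ has $|1-q_k^{-it}|\ge
    4^{-k-1}$ for all large $k$. This is why $\phi_k\le A 8^{-k}$ is required on $[-k,k]$. The bound
    for $\|g\|_2$ comes from convexity, $e^{2(v-c)}\le e^{-2c}+v/c$ for $0\le v\le c$, and from
    replacing integrals by the constant term of an exponential sum. Positivity of Poisson extensions
    is obtained without a kernel: $e^{-\sigma|x|}$ is an iterated limit of polynomials with
    nonnegative coefficients in cosines, and multiplication by a cosine averages two translates. *)

Definition rc (x : R) : C := (x%:C)%C.
Definition mkC (x y : R) : C := Complex x y.

Lemma C_ext z w : re z = re w -> im z = im w -> z = w.
Proof. by case: z w => a b [c d]; rewrite /re /im /= => -> ->. Qed.

Lemma re_mkC x y : re (mkC x y) = x. Proof. by []. Qed.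
Lemma im_mkC x y : im (mkC x y) = y. Proof. by []. Qed.
Lemma mkCE z : mkC (re z) (im z) = z. Proof. exact: C_ext. Qed.
Lemma re_rc x : re (rc x) = x. Proof. by []. Qed.
Lemma im_rc x : im (rc x) = 0. Proof. by []. Qed.
Lemma reD z w : re (z + w) = re z + re w. Proof. by case: z w => a b [c d]. Qed.
Lemma imD z w : im (z + w) = im z + im w. Proof. by case: z w => a b [c d]. Qed.
Lemma reN z : re (- z) = - re z. Proof. by case: z => a b. Qed.
Lemma imN z : im (- z) = - im z. Proof. by case: z => a b. Qed.
Lemma reM z w : re (z * w) = re z * re w - im z * im w.
Proof. by case: z w => a b [c d]. Qed.
Lemma imM z w : im (z * w) = re z * im w + im z * re w.
Proof. by case: z w => a b [c d]. Qed.
Lemma re0 : re (0 : C) = 0. Proof. by []. Qed.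
Lemma im0 : im (0 : C) = 0. Proof. by []. Qed.
Lemma re1 : re (1 : C) = 1. Proof. by []. Qed.
Lemma im1 : im (1 : C) = 0. Proof. by []. Qed.

Definition reimE := (reD, imD, reN, imN, reM, imM, re0, im0, re1, im1,
  re_rc, im_rc).

Lemma re_sum (I : Type) (r : seq I) (P : pred I) (F : I -> C) :
  re (\sum_(i <- r | P i) F i) = \sum_(i <- r | P i) re (F i).
Proof. by apply: (big_morph re reD). Qed.
Lemma im_sum (I : Type) (r : seq I) (P : pred I) (F : I -> C) :
  im (\sum_(i <- r | P i) F i) = \sum_(i <- r | P i) im (F i).
Proof. by apply: (big_morph im imD). Qed.

Lemma rcD x y : rc (x + y) = rc x + rc y.
Proof. by apply: C_ext; rewrite !reimE ?addr0. Qed.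
Lemma rcN x : rc (- x) = - rc x.
Proof. by apply: C_ext; rewrite !reimE ?oppr0. Qed.
Lemma rcB x y : rc (x - y) = rc x - rc y. Proof. by rewrite rcD rcN. Qed.
Lemma rcM x y : rc (x * y) = rc x * rc y.
Proof. by apply: C_ext; rewrite !reimE; ring. Qed.
Lemma rc0 : rc 0 = 0. Proof. by []. Qed.
Lemma rc1 : rc 1 = 1. Proof. by []. Qed.
Lemma rc_sum (I : Type) (r : seq I) (P : pred I) (F : I -> R) :
  rc (\sum_(i <- r | P i) F i) = \sum_(i <- r | P i) rc (F i).
Proof. by apply: (big_morph rc rcD). Qed.
Lemma rcX x n : rc (x ^+ n) = rc x ^+ n.
Proof. by elim: n => [//|n IH]; rewrite !exprS rcM IH. Qed.
Lemma rc_nat n : rc n%:R = n%:R :> C.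
Proof. by elim: n => [//|n IH]; rewrite -!natr1 rcD IH. Qed.
Lemma rcI x y : rc x = rc y -> x = y. Proof. by case. Qed.

Lemma cabsE z : cabs z = Num.sqrt (re z ^+ 2 + im z ^+ 2).
Proof. by case: z. Qed.
Lemma normC_cabs z : `|z| = rc (cabs z).
Proof. by case: z. Qed.
Lemma cabs_ge0 z : 0 <= cabs z. Proof. by rewrite cabsE sqrtr_ge0. Qed.
Lemma cabs_sqr z : cabs z ^+ 2 = re z ^+ 2 + im z ^+ 2.
Proof. by rewrite cabsE sqr_sqrtr // addr_ge0 // sqr_ge0. Qed.
Lemma cabsM z w : cabs (z * w) = cabs z * cabs w.
Proof. by apply: rcI; rewrite rcM -!normC_cabs normrM. Qed.
Lemma cabs0 : cabs (0 : C) = 0. Proof. by apply: rcI; rewrite -normC_cabs normr0. Qed.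
Lemma cabs1 : cabs (1 : C) = 1. Proof. by apply: rcI; rewrite -normC_cabs normr1. Qed.
Lemma cabsN z : cabs (- z) = cabs z.
Proof. by apply: rcI; rewrite -!normC_cabs normrN. Qed.
Lemma lerc x y : (rc x <= rc y) = (x <= y). Proof. exact: lecR. Qed.
Lemma ltrc x y : (rc x < rc y) = (x < y). Proof. exact: ltcR. Qed.
Lemma gt0_rc z : 0 < z -> z = rc (re z) /\ 0 < re z.
Proof.
by case: z => a b; rewrite ltcE /= => /andP[/eqP -> h]; split=> //.
Qed.
Lemma cabsD z w : cabs (z + w) <= cabs z + cabs w.
Proof. by rewrite -lerc rcD -!normC_cabs ler_normD. Qed.
Lemma cabsB z w : cabs (z - w) <= cabs z + cabs w.
Proof. by rewrite -(cabsN w); exact: cabsD. Qed.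
Lemma cabs_distC z w : cabs (z - w) = cabs (w - z).
Proof. by rewrite -cabsN opprB. Qed.
Lemma cabs_sum (I : Type) (r : seq I) (P : pred I) (F : I -> C) :
  cabs (\sum_(i <- r | P i) F i) <= \sum_(i <- r | P i) cabs (F i).
Proof.
elim/big_rec2: _ => [|i y z _ IH]; first by rewrite cabs0.
by apply: le_trans (cabsD _ _) _; rewrite lerD2l.
Qed.
Lemma cabs_rc x : cabs (rc x) = `|x|.
Proof. by rewrite cabsE !reimE expr0n addr0 sqrtr_sqr. Qed.
Lemma cabs_eq0 z : (cabs z == 0) = (z == 0).
Proof. by rewrite -(normr_eq0 z) normC_cabs -rc0; apply/eqP/eqP => [->|/rcI]. Qed.
Lemma cabs_gt0 z : (0 < cabs z) = (z != 0).
Proof. by rewrite lt_def cabs_ge0 andbT cabs_eq0. Qed.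
Lemma cabsV z : cabs z^-1 = (cabs z)^-1.
Proof.
have [->|z0] := eqVneq z 0; first by rewrite invr0 cabs0 invr0.
have h : cabs z != 0 by rewrite cabs_eq0.
by apply: (mulfI h); rewrite -cabsM !divff // cabs1.
Qed.
Lemma cabsX z n : cabs (z ^+ n) = cabs z ^+ n.
Proof. by elim: n => [|n IH]; rewrite ?cabs1 // !exprS cabsM IH. Qed.
Lemma cabs_re z : `|re z| <= cabs z.
Proof. by rewrite cabsE -sqrtr_sqr ler_wsqrtr // lerDl sqr_ge0. Qed.
Lemma cabs_im z : `|im z| <= cabs z.
Proof. by rewrite cabsE -sqrtr_sqr ler_wsqrtr // lerDr sqr_ge0. Qed.
Lemma cabs_le_reim z : cabs z <= `|re z| + `|im z|.
Proof.
have h : 0 <= `|re z| + `|im z| by rewrite addr_ge0.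
rewrite -(ger0_norm h) -sqrtr_sqr cabsE ler_wsqrtr // sqrrD.
rewrite !real_normK ?num_real // lerD2r lerDl mulrn_wge0 //.

Qed.
Lemma cabs_triangle z w v : cabs (z - w) <= cabs (z - v) + cabs (v - w).
Proof. by rewrite -[z - w](subrKA v); exact: cabsD. Qed.

Lemma rcV x : rc x^-1 = (rc x)^-1.
Proof.
have [->|x0] := eqVneq x 0; first by rewrite invr0 rc0 invr0.
have x1 : rc x != 0 by rewrite -cabs_eq0 cabs_rc normr_eq0.
by apply: (mulfI x1); rewrite -rcM !divff.
Qed.

Lemma cexpD z w : cexp (z + w) = cexp z * cexp w.
Proof. by apply: C_ext; rewrite /cexp !reimE /= ?expRD ?cosD ?sinD; rewrite /re/im/=; ring. Qed.
Lemma cexp0 : cexp (0 : C) = 1.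
Proof. by apply: C_ext; rewrite /cexp /re /im /= expR0 ?cos0 ?sin0 ?mulr1 ?mulr0. Qed.
Lemma re_cexp z : re (cexp z) = expR (re z) * cos (im z). Proof. by []. Qed.
Lemma im_cexp z : im (cexp z) = expR (re z) * sin (im z). Proof. by []. Qed.
Lemma cabs_cexp z : cabs (cexp z) = expR (re z).
Proof.
rewrite cabsE re_cexp im_cexp !exprMn -mulrDr cos2Dsin2 mulr1 sqrtr_sqr.
by rewrite ger0_norm // expR_ge0.
Qed.
Lemma cexp_neq0 z : cexp z != 0.
Proof. by rewrite -cabs_eq0 cabs_cexp gt_eqF // expR_gt0. Qed.
Lemma cexpMn z n : cexp (z *+ n) = cexp z ^+ n.
Proof. by elim: n => [|n IH]; rewrite ?mulr0n ?cexp0 // mulrS cexpD IH exprS. Qed.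
Lemma cexp_rc x : cexp (rc x) = rc (expR x).
Proof. by apply: C_ext; rewrite ?re_cexp ?im_cexp !reimE ?cos0 ?sin0 ?mulr1 ?mulr0. Qed.

End ComplexNumbers.

(** * Limits of complex sequences and series *)

Section Limits.
Context {R : realType}.
Local Notation C := (Cplx R).
Implicit Types (z w : C) (x y : R).

Lemma nat_ge (x : R) : exists N : nat, forall n, (N <= n)%N -> x <= n%:R.
Proof.
exists (Num.trunc x).+1 => n hn.
by apply: le_trans (ltW (truncnS_gt x)) _; rewrite ler_nat.
Qed.

Lemma le_eps x y : (forall e : R, 0 < e -> x <= y + e) -> x <= y.
Proof. by move=> h; apply/ler_addgt0Pl => e e0; rewrite addrC; exact: h. Qed.

Lemma le_div_nat x y (K : R) :
  (exists N0, forall N : nat, (N0 <= N)%N -> x <= y + K / N%:R) -> x <= y.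
Proof.
move=> [N0 h]; apply: le_eps => e e0.
have [N1 h1] := nat_ge (`|K| / e).
set N := (maxn (maxn N0 N1) 1)%N.
have hN : (0 : R) < N%:R by rewrite ltr0n /N !leq_max orbT.
apply: le_trans (h N _) _; first by rewrite /N -maxnA leq_maxl.
rewrite lerD2l ler_pdivrMr //.
have := h1 N; rewrite ler_pdivrMr // => h2.
rewrite mulrC; apply: le_trans (ler_norm K) (h2 _).
by rewrite /N maxnAC leq_maxr.
Qed.

(** Convergence phrased with the real-valued modulus, so that all estimates stay in [R]; [clim_cvg]
    converts it to filter convergence. *)
Definition clim (u : nat -> C) l := forall e : R, 0 < e ->
  exists N, forall n, (N <= n)%N -> cabs (u n - l) <= e.

Lemma clim_dist (u : nat -> C) l a (r : R) N : clim u l ->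
  (forall n, (N <= n)%N -> cabs (u n - a) <= r) -> cabs (l - a) <= r.
Proof.
move=> hu h; apply: le_eps => e e0; have [M hM] := hu e e0.
apply: le_trans (cabs_triangle l a (u (maxn N M))) _.
rewrite addrC lerD ?h ?leq_maxl // cabs_distC hM ?leq_maxr //.
Qed.

Lemma clim_re_le (u : nat -> C) l (r : R) N : clim u l ->
  (forall n, (N <= n)%N -> re (u n) <= r) -> re l <= r.
Proof.
move=> hu h; apply: le_eps => e e0; have [M hM] := hu e e0.
have := hM (maxn N M) (leq_maxr _ _); have := h (maxn N M) (leq_maxl _ _).
have := cabs_re (u (maxn N M) - l); rewrite !reimE ler_norml => /andP[h1 h2] h3 h4.
lra.
Qed.

Lemma is_cvg_series_dominated (u b : nat -> R) (B : R) :
  (forall k, `|u k| <= b k) -> (forall K, \sum_(k < K) b k <= B) ->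
  cvgn (series u).
Proof.
move=> hu hB.
have b0 k : 0 <= b k by apply: le_trans (hu k).
have cb : cvgn (series b).
  apply: nondecreasing_is_cvgn.
    by apply/nondecreasing_seqP => n; rewrite /series /= big_nat_recr //= lerDl.
  by exists B => _ [n _ <-]; rewrite /series /= big_mkord.
by apply: normed_cvg; apply: (series_le_cvg _ b0 hu) => // n /=.
Qed.

Lemma mtest (u : nat -> C) (b : nat -> R) (B : R) :
  (forall k, cabs (u k) <= b k) -> (forall K, \sum_(k < K) b k <= B) ->
  exists l, clim (fun K => \sum_(k < K) u k) l.
Proof.
move=> hu hB.
have h1 : cvgn (series (fun k => re (u k))).
  by apply: (is_cvg_series_dominated _ hB) => k; apply: le_trans (cabs_re _) _.
have h2 : cvgn (series (fun k => im (u k))).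
  by apply: (is_cvg_series_dominated _ hB) => k; apply: le_trans (cabs_im _) _.
exists (mkC (limn (series (fun k => re (u k)))) (limn (series (fun k => im (u k))))).
move=> e e0.
have e20 : 0 < e / 2 by lra.
have /cvgrPdist_le/(_ _ e20)[N1 _ H1] := h1.
have /cvgrPdist_le/(_ _ e20)[N2 _ H2] := h2.
exists (maxn N1 N2) => n; rewrite geq_max => /andP[n1 n2].
apply: le_trans (cabs_le_reim _) _.
move: (H1 n n1) (H2 n n2); rewrite /= /series /= !big_mkord.
rewrite !reimE re_mkC im_mkC re_sum im_sum !(distrC (limn _)) => H3 H4.
by rewrite [leRHS]splitr; apply: lerD.
Qed.

Lemma pow2_small (A e : R) : 0 < e ->
  exists N, forall n, (N <= n)%N -> A * 2^-1 ^+ n <= e.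
Proof.
move=> e0; have [N hN] := nat_ge (`|A| / e); exists N => n hn.
have h2 : (0 : R) < 2 ^+ n by rewrite exprn_gt0.
rewrite exprVn ler_pdivrMr //; apply: le_trans (ler_norm _) _.
have := hN n hn; rewrite ler_pdivrMr // => /le_trans; apply.
rewrite mulrC ler_wpM2l //; first exact: ltW.
by rewrite -natrX ler_nat ltnW // ltn_expl.
Qed.

Lemma sum_pow2 n k : \sum_(i < n) (2^-1 : R) ^+ (k + i) <= 2 * 2^-1 ^+ k.
Proof.
suff -> : \sum_(i < n) (2^-1 : R) ^+ (k + i) = 2 * 2^-1 ^+ k - 2 * 2^-1 ^+ (k + n).
  by rewrite lerBlDr lerDl mulr_ge0 // exprn_ge0.
elim: n => [|n IH]; first by rewrite big_ord0 addn0 subrr.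
by rewrite big_ord_recr /= IH addnS exprS; field.
Qed.

Lemma geo_test (u : nat -> C) (A : R) K0 :
  (forall k, (K0 <= k)%N -> cabs (u k) <= A * 2^-1 ^+ k) ->
  exists l, clim (fun K => \sum_(k < K) u k) l.
Proof.
move=> h.
have A0 : 0 <= A.
  have := le_trans (cabs_ge0 _) (h K0 (leqnn _)).
  by rewrite pmulr_lge0 // exprn_gt0.
pose B := \sum_(k < K0) cabs (u k).
apply: (@mtest u (fun k => (if (k < K0)%N then cabs (u k) else 0) + A * 2^-1 ^+ k)
   (B + A * 2)).
  move=> k; case: ltnP => hk; last by rewrite add0r h.
  by rewrite lerDl mulr_ge0 // exprn_ge0.
move=> K; rewrite big_split /= lerD //.
  rewrite -big_mkcond /= /B.
  case: (leqP K K0) => hK.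
    rewrite (big_ord_widen_cond _ (fun k => (k < K0)%N) (fun k => cabs (u k)) hK) /=.
    by rewrite big_mkcond /= ler_sum // => i _; case: ifP => // _; rewrite cabs_ge0.
  by rewrite (big_ord_widen _ (fun k => cabs (u k)) (ltnW hK)).
rewrite -mulr_sumr ler_wpM2l //.
by have := sum_pow2 K 0; rewrite expr0 mulr1; under eq_bigr do rewrite add0n.
Qed.

Lemma geo_tail (u : nat -> C) (A : R) K0 l : clim (fun K => \sum_(k < K) u k) l ->
  (forall k, (K0 <= k)%N -> cabs (u k) <= A * 2^-1 ^+ k) ->
  forall K, (K0 <= K)%N -> cabs (l - \sum_(k < K) u k) <= 2 * A * 2^-1 ^+ K.
Proof.
move=> hl h K hK.
have A0 : 0 <= A.
  have := le_trans (cabs_ge0 _) (h K0 (leqnn _)).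
  by rewrite pmulr_lge0 // exprn_gt0.
apply: (@clim_dist _ _ _ _ K hl) => n hn.
rewrite -(subnKC hn) big_split_ord /= addrAC subrr add0r.
apply: le_trans (cabs_sum _ _ _) _.
apply: (@le_trans _ _ (\sum_(i < n - K) A * 2^-1 ^+ (K + i))).
  by apply: ler_sum => i _; apply: h; apply: leq_trans hK (leq_addr _ _).
by rewrite -mulr_sumr mulrAC mulrC ler_wpM2r // sum_pow2.
Qed.

End Limits.

(** * Power series estimates for the complex exponential *)

Section ComplexExponential.
Context {R : realType}.
Local Notation C := (Cplx R).
Implicit Types (z w : C) (x y : R).

Lemma derive_bound (f df : R -> R) (K y : R) :
  (forall x, is_derive x 1 f (df x)) ->
  (forall c, `|c| <= `|y| -> `|df c| <= K) -> `|f y - f 0| <= K * `|y|.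
Proof.
move=> hf hK.
have hc a b : {within `[a, b], continuous f}.
  by apply: derivable_within_continuous => x _; have [] := hf x.
case: (leP 0 y) => y0.
  have [c hc1 ->] := MVT_segment y0 (fun x _ => hf x) (hc _ _).
  rewrite subr0 normrM ler_wpM2r // hK //.
  by move: hc1; rewrite in_itv /= => /andP[h1 h2]; rewrite !ger0_norm.
have [c hc1] := MVT_segment (ltW y0) (fun x _ => hf x) (hc _ _).
rewrite distrC => ->.
rewrite sub0r normrM normrN ler_wpM2r // hK //.
move: hc1; rewrite in_itv /= => /andP[h1 h2].
by rewrite !ler0_norm ?lerN2 // ltW.
Qed.

Lemma sin_le_norm y : `|sin y| <= `|y|.
Proof.
have := @derive_bound (@sin R) cos 1 y (fun x => is_derive_sin x)
  (fun c _ => cos_max c).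
by rewrite sin0 subr0 mul1r.
Qed.

Lemma cos_sub1_le y : `|cos y - 1| <= y ^+ 2.
Proof.
have := @derive_bound (@cos R) (fun x => - sin x) `|y| y (fun x => is_derive_cos x).
rewrite cos0 -normrM -expr2 ger0_norm ?sqr_ge0 //; apply => c hc.
by rewrite normrN (le_trans (sin_le_norm c)).
Qed.

Lemma sin_sub_le y : `|y| <= 1 -> `|sin y - y| <= y ^+ 2.
Proof.
move=> y1.
have hd x : is_derive x 1 (@sin R \- id) (cos x - 1) by apply: is_deriveB.
have := @derive_bound _ (fun x => cos x - 1) `|y| y hd.
rewrite /= sin0 subr0 subr0 -normrM -expr2 ger0_norm ?sqr_ge0 //; apply => c hc.
apply: le_trans (cos_sub1_le c) _.
rewrite -(real_normK (num_real c)) expr2.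
by have := normr_ge0 c; nra.
Qed.

Lemma expR_sub1D_le x : `|x| <= 2^-1 -> 0 <= expR x - 1 - x <= 2 * x ^+ 2.
Proof.
rewrite ler_norml => /andP[x1 x2].
have h1 := expR_ge1Dx x; have h2 := expR_ge1Dx (- x).
apply/andP; split; first by lra.
have h3 : expR x * expR (- x) = 1 by rewrite -expRD subrr expR0.
have h4 := expR_gt0 x.
have h5 : expR x * (1 - x) <= expR x * expR (- x) by rewrite ler_wpM2l // ltW.
rewrite h3 in h5.
nra.
Qed.

(** A crude constant suffices: the estimate is applied at [z / N], where $N$ errors of size
    $O(N^{-2})$ add up to $O(1/N)$. *)
Lemma cexp_taylor_small w : cabs w <= 2^-1 ->
  cabs (cexp w - 1 - w) <= 8 * cabs w ^+ 2.
Proof.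
move=> hw; rewrite cabs_sqr.
set x := re w; set y := im w.
have hx : `|x| <= 2^-1 := le_trans (cabs_re _) hw.
have hy : `|y| <= 2^-1 := le_trans (cabs_im _) hw.
apply: le_trans (cabs_le_reim _) _; rewrite !reimE re_cexp im_cexp -/x -/y.
have /andP[e1 e2] := expR_sub1D_le hx.
have := cos_sub1_le y; have := sin_sub_le (le_trans hy _).
rewrite ler_norml => /(_ _)/andP; case; first lra.
move=> s1 s2; rewrite ler_norml => /andP[c1 c2].
move: hx hy; rewrite !ler_norml => /andP[x1 x2] /andP[y1 y2].
have E0 := expR_gt0 x.
have E2 : expR x <= 2 by nra.
set E := expR x in e1 e2 E0 E2 *; set c := cos y in c1 c2 *; set s := sin y in s1 s2 *.
have A1 : `|E * c - 1 - x| <= 2 * x ^+ 2 + 2 * y ^+ 2.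
  have -> : E * c - 1 - x = (E - 1 - x) + E * (c - 1) by ring.
  rewrite ler_norml; apply/andP; split; nra.
have A2 : `|E * s - 0 - y| <= 4 * y ^+ 2 + 4 * x ^+ 2.
  have -> : E * s - 0 - y = E * (s - y) + (E - 1 - x) * y + x * y by ring.
  have q1 : - (x ^+2 + y ^+2) <= x * y <= x ^+2 + y ^+2.
    by apply/andP; split; nra.
  have q2 : - (2 * x ^+ 2) <= (E - 1 - x) * y <= 2 * x ^+2.
    by apply/andP; split; nra.
  case/andP: q1 => q1 q1'; case/andP: q2 => q2 q2'.
  have q3 : E * (s - y) <= 2 * y ^+ 2.
    have : E * (s - y) <= E * y ^+ 2 by rewrite ler_wpM2l // ltW.
    by have := sqr_ge0 y; nra.
  have q4 : - (2 * y ^+ 2) <= E * (s - y).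
    have : E * (- y ^+ 2) <= E * (s - y) by rewrite ler_wpM2l // ltW.
    by have := sqr_ge0 y; nra.
  have := sqr_ge0 x; have := sqr_ge0 y.
  rewrite ler_norml => ? ?; apply/andP; split; lra.
have := sqr_ge0 x; have := sqr_ge0 y; lra.
Qed.

Lemma cabs_subX (a b : C) (M : R) n : 1 <= M -> cabs a <= M -> cabs b <= M ->
  cabs (a ^+ n - b ^+ n) <= n%:R * cabs (a - b) * M ^+ n.
Proof.
move=> M1 ha hb; have M0 : 0 <= M by lra.
elim: n => [|n IH]; first by rewrite subrr cabs0 mul0r mul0r.
have -> : a ^+ n.+1 - b ^+ n.+1 = a * (a ^+ n - b ^+ n) + (a - b) * b ^+ n.
  by rewrite !exprS; ring.
apply: le_trans (cabsD _ _) _; rewrite !cabsM cabsX.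
have h1 : cabs b ^+ n <= M ^+ n by rewrite lerXn2r ?nnegrE ?cabs_ge0.
have h2 := exprn_ge0 n M0.
have h3 := cabs_ge0 (a - b).
have h4 : cabs (a - b) * cabs b ^+ n <= cabs (a - b) * M ^+ n.+1.
  rewrite ler_wpM2l //; apply: le_trans h1 _.
  by rewrite exprS ler_peMl.
have h5 : cabs a * cabs (a ^+ n - b ^+ n) <= M * (n%:R * cabs (a - b) * M ^+ n).
  by rewrite ler_pM ?cabs_ge0.
apply: le_trans (lerD h5 h4) _.
by rewrite -natr1 exprS le_eqVlt; apply/orP; left; apply/eqP; ring.
Qed.

Definition fexp (K : fieldType) (n : nat) (z : K) : K :=
  \sum_(m < n.+1) (m`!%:R)^-1 * z ^+ m.

Lemma fexp_series n x : fexp n x = series (exp_coeff x) n.+1.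
Proof.
rewrite /fexp /series /= big_mkord; apply: eq_bigr => i _.
by rewrite exp_coeffE.
Qed.

Lemma fexp_le n x : 0 <= x -> fexp n x <= expR x.
Proof.
move=> x0; rewrite fexp_series; apply: nondecreasing_cvgn_le.
  apply/nondecreasing_seqP => k; rewrite /series /= big_nat_recr //= lerDl.
  exact: exp_coeff_ge0.
exact: is_cvg_series_exp_coeff.
Qed.

(** Since $N(N-1)\cdots(N-m+1)\le N^m$, each coefficient of $(1+z/N)^N$ is at most that of the
    exponential series. Coefficient differences are then nonnegative, and errors at $z$ are
    dominated by the same errors at $|z|$. *)
Lemma binom_le_fact N m : 'C(N, m)%:R / N%:R ^+ m <= (m`!%:R)^-1 :> R.
Proof.
have [->|N0] := posnP N.
  case: m => [|m]; first by rewrite bin0 expr0 fact0 divr1 invr1.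
  by rewrite bin0n mul0r invr_ge0.
have hf : (0 : R) < m`!%:R by rewrite ltr0n fact_gt0.
rewrite ler_pdivrMr ?exprn_gt0 ?ltr0n // mulrC ler_pdivlMr //.
rewrite -natrM bin_ffact -natrX ler_nat.
elim: m N {N0 hf} => [|m IH] N; first by rewrite ffactn0 expn0.
case: N => [|N]; first by rewrite ffact0n.
rewrite ffactnS expnS leq_mul // (leq_trans (IH _)) //.
by case: m {IH} => [|m]; rewrite ?expn0 // leq_exp2r.
Qed.

Lemma onePdivX (K : fieldType) (z : K) N :
  (1 + z / N%:R) ^+ N = \sum_(m < N.+1) ('C(N, m)%:R / N%:R ^+ m) * z ^+ m.
Proof.
rewrite exprDn; apply: eq_bigr => i _.
by rewrite expr1n mul1r exprMn exprVn -mulr_natl (mulrC (z ^+ i)) mulrA.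
Qed.

Lemma fexp_onePdivX_le N z :
  cabs (fexp N z - (1 + z / N%:R) ^+ N) <=
  fexp N (cabs z) - (1 + cabs z / N%:R) ^+ N.
Proof.
rewrite !onePdivX /fexp -!sumrB.
apply: le_trans (cabs_sum _ _ _) _; apply: ler_sum => i _.
rewrite -!mulrBl cabsM cabsX ler_wpM2r ?exprn_ge0 ?cabs_ge0 //.
rewrite -!rc_nat -rcX.
rewrite -!rcV -rcM -rcB.
by rewrite cabs_rc ger0_norm // subr_ge0 binom_le_fact.
Qed.

(** Both $e^{z/N}$ and $1+z/N$ have modulus at most $e^{|z|/N}$; comparing their $N$-th powers
    through [cabs_subX] costs $N$ times their distance. *)
Lemma cexp_onePdivX_le N z : (0 < N)%N -> 2 * cabs z <= N%:R ->
  cabs (cexp z - (1 + z / N%:R) ^+ N) <= (8 * cabs z ^+ 2 * expR (cabs z)) / N%:R.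
Proof.
move=> N0 hN.
have N0' : (0 : R) < N%:R by rewrite ltr0n.
have N1' : N%:R != 0 :> C by rewrite -rc_nat -cabs_eq0 cabs_rc normr_eq0 gt_eqF.
have hn : cabs (N%:R : C) = N%:R by rewrite -rc_nat cabs_rc ger0_norm.
set w := z / N%:R.
have cw : cabs w = cabs z / N%:R by rewrite cabsM cabsV hn.
have zE : z = w *+ N by rewrite -mulr_natr divfK.
rewrite {1}zE cexpMn.
have w0 := cabs_ge0 w.
have eM : expR (cabs w) ^+ N = expR (cabs z).
  by rewrite -expRM_natl mulrC cw divfK // gt_eqF.
apply: le_trans (@cabs_subX (cexp w) (1 + w) (expR (cabs w)) N _ _ _) _.
- by rewrite -expR0 ler_expR.
- rewrite cabs_cexp ler_expR; apply: le_trans (ler_norm _) (cabs_re _).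
- apply: le_trans (cabsD _ _) _; rewrite cabs1; exact: expR_ge1Dx.
rewrite eM [leRHS]mulrAC ler_wpM2r ?expR_ge0 // opprD addrA.
have h : cabs w <= 2^-1 by rewrite cw ler_pdivrMr //; lra.
have := cexp_taylor_small h; rewrite cw => h2.
apply: le_trans (ler_wpM2l (ltW N0') h2) _.
rewrite le_eqVlt; apply/orP; left; apply/eqP; field; exact: lt0r_neq0.
Qed.

(** [cexp] is built from the real cosine and sine, so its power series is reached through
    $(1+z/N)^N$, which is close to [cexp z] and to the Taylor polynomial of degree $N$. Every error
    at $z$ is bounded by its analogue at $|z|$ up to $O(1/N)$, and the analogues telescope to the
    real remainder. *)
Lemma cexp_fexp_le n z : cabs (cexp z - fexp n z) <= expR (cabs z) - fexp n (cabs z).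
Proof.
have x0 := cabs_ge0 z; set x := cabs z in x0 *.
(* 16 is twice the 8 of [cexp_onePdivX_le], which is used once at [z] and once at the real point
   [x]. *)
apply: (@le_div_nat _ _ _ (16 * x ^+ 2 * expR x)).
have [N0 hN0] := nat_ge (2 * x).
exists (maxn (maxn N0 n) 1) => N; rewrite !geq_max -andbA => /and3P[h1 h2 h3].
have H1 := @cexp_onePdivX_le N z h3 (hN0 N h1).
have H2 := @fexp_onePdivX_le N z.
have H3 : cabs (fexp N z - fexp n z) <= fexp N x - fexp n x.
  rewrite /fexp -(subnKC h2) -addSn !big_split_ord /= !(addrAC _ _ (- _)) !subrr !add0r.
  apply: le_trans (cabs_sum _ _ _) _; apply: ler_sum => i _.
  rewrite cabsM cabsX cabsV -rc_nat cabs_rc ger0_norm //.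
have H4 := @fexp_le N x x0.
have cx : cabs (rc x) = x by rewrite cabs_rc ger0_norm.
have := @cexp_onePdivX_le N (rc x) h3; rewrite cx => /(_ (hN0 N h1)).
rewrite cexp_rc -rc_nat -rcV -rcM -rc1 -rcD -rcX -rcB cabs_rc ler_norml => /andP[_ H5].
apply: le_trans (cabs_triangle _ _ ((1 + z / N%:R) ^+ N)) _.
have := cabs_triangle ((1 + z / N%:R) ^+ N) (fexp n z) (fexp N z).
rewrite (cabs_distC _ (fexp N z)).
rewrite -/x in H1 H2.
have -> : 16 * x ^+ 2 * expR x / N%:R = 8 * x ^+ 2 * expR x / N%:R + 8 * x ^+ 2 * expR x / N%:R by field; rewrite pnatr_eq0 -lt0n.
lra.
Qed.

Lemma cexp_sub1_le z : cabs (cexp z - 1) <= cabs z * expR (cabs z).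
Proof.
have := cexp_fexp_le 0 z; rewrite /fexp !big_ord_recl !big_ord0 /= !expr0 !fact0 !invr1 !mulr1 !addr0.
move/le_trans; apply.
have := expR_ge1Dx (- cabs z); have := expR_gt0 (cabs z).
have h3 : expR (cabs z) * expR (- cabs z) = 1 by rewrite -expRD subrr expR0.
move=> h1 h2.
have : expR (cabs z) * (1 + - cabs z) <= expR (cabs z) * expR (- cabs z) by rewrite ler_wpM2l // ltW.
rewrite h3; lra.
Qed.

Lemma cexp_taylor1 z : cabs (cexp z - 1 - z) <= cabs z ^+ 2 * expR (cabs z).
Proof.
have := cexp_fexp_le 1 z.
rewrite /fexp !big_ord_recl !big_ord0 /= !expr0 !expr1 !factS !fact0 !muln1 !invr1 !mul1r !addr0.
rewrite opprD addrA => /le_trans; apply.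
set x := cabs z.
have x0 : 0 <= x := cabs_ge0 z.
have h3 : expR x * expR (- x) = 1 by rewrite -expRD subrr expR0.
have h1 := expR_gt0 x; have h2 := expR_ge1Dx (- x).
have h4 : expR x * (1 - x) <= expR x * expR (- x) by rewrite ler_wpM2l // ltW.
rewrite h3 in h4.
have : x * (expR x * (1 - x)) <= x * 1 by rewrite ler_wpM2l.
nra.
Qed.

End ComplexExponential.

(** * Exponential sums and positivity of Poisson extensions *)

Section ExponentialSums.
Context {R : realType}.
Local Notation C := (Cplx R).
Local Notation expsum := (seq (C * R)).
Implicit Types (E F : expsum) (s z : C) (m : R -> R) (t x : R).

(** An exponential sum is a list of pairs (coefficient, frequency), repetitions allowed; a pair
    $(c,x)$ stands for $c\,e^{-xs}$. *)
Definition ev E s : C := \sum_(p <- E) p.1 * cexp (- (s * rc p.2)).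
Definition re_ev E t : R := re (ev E (mkC 0 t)).
Definition scalE (c : C) E : expsum := [seq (c * p.1, p.2) | p <- E].
Definition mulE E F : expsum := [seq (p.1 * q.1, p.2 + q.2) | p <- E, q <- F].
Definition conjC (z : C) : C := mkC (re z) (- im z).
Definition conjE E : expsum := [seq (conjC p.1, - p.2) | p <- E].
Definition multE m E : expsum := [seq (p.1 * rc (m p.2), p.2) | p <- E].
(** The constant term of [re_ev E], that is, its time average over $[0,T]$ as $T\to\infty$
    ([trig_int_mean]). *)
Definition mean E : R := \sum_(p <- E) re p.1 * (p.2 == 0)%:R.

Lemma ev_nil s : ev [::] s = 0. Proof. by rewrite /ev big_nil. Qed.
Lemma ev_cons p E s : ev (p :: E) s = p.1 * cexp (- (s * rc p.2)) + ev E s.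
Proof. by rewrite /ev big_cons. Qed.
Lemma ev_cat E F s : ev (E ++ F) s = ev E s + ev F s.
Proof. by rewrite /ev big_cat. Qed.
Lemma ev_scal c E s : ev (scalE c E) s = c * ev E s.
Proof. by rewrite /ev big_map mulr_sumr; apply: eq_bigr => p _; rewrite mulrA. Qed.
Lemma ev_mul E F s : ev (mulE E F) s = ev E s * ev F s.
Proof.
rewrite /ev big_allpairs_dep mulr_suml; apply: eq_bigr => p _.
rewrite mulr_sumr; apply: eq_bigr => q _ /=.
by rewrite rcD mulrDr opprD cexpD; ring.
Qed.
Lemma ev_const c s : ev [:: (c, 0)] s = c.
Proof. by rewrite ev_cons ev_nil rc0 mulr0 oppr0 cexp0 mulr1 addr0. Qed.

Lemma re_conjC z : re (conjC z) = re z. Proof. by []. Qed.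
Lemma im_conjC z : im (conjC z) = - im z. Proof. by []. Qed.
Lemma conjCD z w : conjC (z + w) = conjC z + conjC w.
Proof. by apply: C_ext; rewrite ?reD ?imD !(re_conjC, im_conjC) ?reD ?imD ?opprD. Qed.
Lemma conjCM z w : conjC (z * w) = conjC z * conjC w.
Proof.
by apply: C_ext; rewrite ?(reM (conjC _)) ?(imM (conjC _)) !(re_conjC, im_conjC) ?reM ?imM; ring.
Qed.
Lemma mulC_conj z : z * conjC z = rc (cabs z ^+ 2).
Proof. by apply: C_ext; rewrite ?reM ?imM ?re_rc ?im_rc re_conjC im_conjC ?cabs_sqr; ring. Qed.

Lemma cexp_mkC (a t x : R) :
  cexp (- (mkC a t * rc x)) = rc (expR (- (a * x))) * mkC (cos (t * x)) (- sin (t * x)).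
Proof.
have -> : - (mkC a t * rc x) = mkC (- (a * x)) (- (t * x)).
  by apply: C_ext; rewrite ?(reM (mkC _ _)) ?(imM (mkC _ _)) ?reN ?imN ?reM ?imM ?re_rc ?im_rc ?re_mkC ?im_mkC; ring.
apply: C_ext; rewrite ?re_cexp ?im_cexp ?reM ?imM re_rc im_rc !re_mkC !im_mkC.
  by rewrite cosN; ring.
by rewrite sinN; ring.
Qed.

Lemma cexp_it (t x : R) : cexp (- (mkC 0 t * rc x)) = mkC (cos (t * x)) (- sin (t * x)).
Proof. by rewrite cexp_mkC mul0r oppr0 expR0 rc1 mul1r. Qed.

Lemma ev_conj E t : ev (conjE E) (mkC 0 t) = conjC (ev E (mkC 0 t)).
Proof.
elim: E => [|p E IH].
  by rewrite !ev_nil; apply: C_ext; rewrite ?re_conjC ?im_conjC ?im0 ?oppr0.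
rewrite /= !ev_cons IH conjCD conjCM /=; congr (_ * _ + _).
by rewrite !cexp_it; apply: C_ext; rewrite ?re_conjC ?im_conjC ?re_mkC ?im_mkC mulrN ?cosN ?sinN.
Qed.

Lemma ev_mul_conj E t : ev (mulE E (conjE E)) (mkC 0 t) = rc (cabs (ev E (mkC 0 t)) ^+ 2).
Proof. by rewrite ev_mul ev_conj mulC_conj. Qed.

Lemma re_ev_cat E F t : re_ev (E ++ F) t = re_ev E t + re_ev F t.
Proof. by rewrite /re_ev ev_cat reD. Qed.
Lemma re_ev_scal (c : R) E t : re_ev (scalE (rc c) E) t = c * re_ev E t.
Proof. by rewrite /re_ev ev_scal !reimE mul0r subr0. Qed.
Lemma mean_cat E F : mean (E ++ F) = mean E + mean F.
Proof. by rewrite /mean big_cat. Qed.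
Lemma mean_scal (c : R) E : mean (scalE (rc c) E) = c * mean E.
Proof.
rewrite /mean big_map mulr_sumr; apply: eq_bigr => p _ /=.
by rewrite !reimE mul0r subr0 mulrA.
Qed.

Lemma ev_mult m E s : ev (multE m E) s = \sum_(p <- E) rc (m p.2) * (p.1 * cexp (- (s * rc p.2))).
Proof. by rewrite /ev big_map; apply: eq_bigr => p _ /=; ring. Qed.
Lemma re_ev_mult m E t : re_ev (multE m E) t =
  \sum_(p <- E) m p.2 * re (p.1 * cexp (- (mkC 0 t * rc p.2))).
Proof.
rewrite /re_ev ev_mult re_sum; apply: eq_bigr => p _.
by rewrite (reM (rc _)) re_rc im_rc mul0r subr0.
Qed.
Lemma mean_mult m E : m 0 = 1 -> mean (multE m E) = mean E.
Proof.
move=> m0; rewrite /mean big_map; apply: eq_bigr => p _ /=.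
case: eqP => [->|]; rewrite ?mulr0 // m0; congr (_ * _).
by rewrite rc1 mulr1.
Qed.

(** A substitute for positive definiteness: the class contains nonnegative constants and cosines and
    is closed under sums, products and pointwise limits, so no representing measure has to be
    produced. *)
Definition positive_mult m := forall E, (forall t, 0 <= re_ev E t) ->
  forall t, 0 <= re_ev (multE m E) t.

Lemma positive_mult_eq m m' : m =1 m' -> positive_mult m -> positive_mult m'.
Proof. by move=> h hm E hE t; rewrite /multE; under eq_map do rewrite -h; exact: hm. Qed.
Lemma positive_mult_const c : 0 <= c -> positive_mult (fun => c).
Proof. by move=> c0 E hE t; rewrite re_ev_mult -mulr_sumr -re_sum mulr_ge0 //; exact: hE. Qed.
Lemma positive_multD m m' : positive_mult m -> positive_mult m' ->
  positive_mult (m \+ m').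
Proof.
move=> h h' E hE t; rewrite re_ev_mult; under eq_bigr do rewrite mulrDl.
by rewrite big_split /= -!re_ev_mult addr_ge0 ?h ?h'.
Qed.
Lemma positive_multM m m' : positive_mult m -> positive_mult m' ->
  positive_mult (m \* m').
Proof.
move=> h h' E hE t.
suff -> : multE (m \* m') E = multE m (multE m' E) by apply: h => u; exact: h'.
by rewrite /multE -map_comp; apply: eq_map => p /=; rewrite rcM; congr (_, _); ring.
Qed.
Lemma positive_multX m n : positive_mult m -> positive_mult (fun x => m x ^+ n).
Proof.
move=> h; elim: n => [|n IH].
  apply: (@positive_mult_eq (fun=> 1)) => [x|]; first by rewrite expr0.
  exact: positive_mult_const.
apply: (@positive_mult_eq (m \* (fun x => m x ^+ n))) => [x|]; first by rewrite exprS.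
exact: positive_multM.
Qed.

(* Multiplication by [cos (a x)] averages the two translates by [a] and [-a]. *)
Lemma positive_mult_cos a : positive_mult (fun x => cos (a * x)).
Proof.
move=> E hE t.
suff -> : re_ev (multE (fun x => cos (a * x)) E) t = 2^-1 * (re_ev E (t + a) + re_ev E (t - a)).
  by rewrite mulr_ge0 // addr_ge0.
rewrite re_ev_mult /re_ev /ev !re_sum -big_split mulr_sumr; apply: eq_bigr => -[c x] _ /=.
rewrite !cexp_it !reM !re_mkC !im_mkC mulrDl mulrBl cosD cosB sinD sinB; by field.
Qed.

(** Pointwise convergence is enough because a fixed [E] involves finitely many frequencies. *)
Lemma positive_mult_lim (m_ : nat -> R -> R) m :
  (forall n, positive_mult (m_ n)) ->
  (forall x e, 0 < e -> exists N, forall n, (N <= n)%N -> `|m_ n x - m x| <= e) ->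
  positive_mult m.
Proof.
move=> hp hl E hE t; rewrite -[leRHS]addr0; apply: le_eps.
suff H e : 0 < e -> exists N, forall n, (N <= n)%N ->
    `|re_ev (multE (m_ n) E) t - re_ev (multE m E) t| <= e.
  move=> e /H[N /(_ _ (leqnn _))]; rewrite ler_norml addr0 => /andP[_].
  by have := hp N E hE t; lra.
clear hE hp.
elim: E e => [|p E IH] e e0.
  by exists 0 => n _; rewrite !re_ev_mult !big_nil subrr normr0 ltW.
have e20 : 0 < e / 2 by lra.
have [N1 H1] := IH _ e20.
set r := re (p.1 * cexp (- (mkC 0 t * rc p.2))).
have r0 : 0 < 1 + `|r| by rewrite ltr_wpDr.
have [N2 H2] := hl p.2 (e / 2 / (1 + `|r|)) (divr_gt0 e20 r0).
exists (maxn N1 N2) => n; rewrite geq_max => /andP[n1 n2].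
move: (H1 n n1); rewrite !re_ev_mult !big_cons -/r => {}H1.
rewrite opprD addrACA -mulrBl [leRHS]splitr.
apply: le_trans (ler_normD _ _) (lerD _ H1).
rewrite normrM; apply: le_trans (_ : `|m_ n p.2 - m p.2| * (1 + `|r|) <= _).
  by rewrite ler_wpM2l // lerDr.
by rewrite -ler_pdivlMr // H2.
Qed.

(** The classical iteration for $1-\sqrt{1-y}$, the fixed point of $w\mapsto (y+w^2)/2$. Its
    iterates are polynomials in $y$ with nonnegative coefficients, hence preserve
    [positive_mult]. *)
Fixpoint sqrt_iter (k : nat) (y : R) : R :=
  if k is k'.+1 then 2^-1 * (y + sqrt_iter k' y ^+ 2) else 0.

(** With $y=1-s^2$ the error obeys $d'=d-d^2/2-sd\le d-d^2/2$, a recursion that decays like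
    $2/(k+2)$. At $s=0$ the convergence is not geometric, so this rate is what can be propagated for
    all $s$ at once. *)
Lemma sqrt_iter_cvg k (s : R) : 0 <= s <= 1 ->
  0 <= sqrt_iter k (1 - s ^+ 2) <= 1 - s /\
  1 - s - sqrt_iter k (1 - s ^+ 2) <= 2 / (k.+2)%:R.
Proof.
move=> /andP[s0 s1]; elim: k => [|k [/andP[h1 h2] h3]] /=.
  by rewrite subr0 divff // lexx; split; lra.
set w := sqrt_iter k _ in h1 h2 h3 *.
split; first by apply/andP; split; nra.
have k2 : (2 : R) <= k.+2%:R by rewrite ler_nat.
rewrite -(natr1 k.+2); set K := k.+2%:R in h3 k2 *.
have K0 : 0 < K by lra.
set d := 1 - s - w in h3.
have -> : 1 - s - 2^-1 * (1 - s ^+ 2 + w ^+ 2) = d - d ^+ 2 / 2 - s * d.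
  by rewrite /d; field.
have d0 : 0 <= d by rewrite /d; lra.
have sd : 0 <= s * d by exact: mulr_ge0.
have hd : d * K <= 2 by rewrite -ler_pdivlMr.
rewrite ler_pdivlMr; last lra.
have d1 : d <= 1 by rewrite /d; nra.
have h : (d - d ^+ 2 / 2) * (K + 1) <= 2.
  have q : K * K * ((d - d ^+ 2 / 2) * (K + 1)) <= 2 * (K * K).
    set u := d * K in hd.
    have -> : K * K * ((d - d ^+ 2 / 2) * (K + 1)) = (u * K - u ^+ 2 / 2) * (K + 1).
      by rewrite /u; field.
    have u0 : 0 <= u by rewrite /u mulr_ge0 // ltW.
    have q1 : u * K - u ^+ 2 / 2 <= 2 * K - 2 by nra.
    have : (u * K - u ^+ 2 / 2) * (K + 1) <= (2 * K - 2) * (K + 1) by rewrite ler_wpM2r //; lra.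
    nra.
  have KK : 0 < K * K by exact: mulr_gt0.
  by rewrite -(ler_pM2l KK) (mulrC (K * K) 2).
have : 0 <= s * d * (K + 1) by rewrite mulr_ge0 //; lra.
nra.
Qed.

(** For $y=\cos^2(ax)$ the limit $1-\sqrt{1-y}$ of the iteration equals $1-|\sin(ax)|$. This
    produces the corner at $0$ that $e^{-\sigma|x|}$ has. *)
Lemma positive_mult_sin a : positive_mult (fun x => 1 - `|sin (a * x)|).
Proof.
apply: (@positive_mult_lim (fun k x => sqrt_iter k (cos (a * x) ^+ 2))).
  elim => [|k IH] /=; first exact: positive_mult_const.
  apply: (@positive_multM (fun=> 2^-1)); first exact: positive_mult_const.
  apply: positive_multD; apply: positive_multX => //; exact: positive_mult_cos.
move=> x e e0; have [N hN] := nat_ge (2 / e).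
exists N => n hn.
have s01 : 0 <= `|sin (a * x)| <= 1 by rewrite normr_ge0 sin_max.
have [/andP[h1 h2] h3] := sqrt_iter_cvg n s01.
rewrite cos2sin2 -(real_normK (num_real (sin (a * x)))) distrC.
move: h1 h2 h3; set v := sqrt_iter _ _ => h1 h2 h3; rewrite (ger0_norm (x := 1 - _ - _)) ?subr_ge0 //.
apply: le_trans h3 _; rewrite ler_pdivrMr // mulrC -ler_pdivrMr //.
by apply: hN; apply: leq_trans hn _; rewrite -addn2 leq_addr.
Qed.

Lemma sin_pow_cvg (u : R) (n : nat) : (0 < n)%N -> 0 <= u -> 2 * u <= n%:R ->
  `|(1 - `|sin (u / n%:R)|) ^+ n - expR (- u)| <= (u ^+ 2 + 8 * u ^+ 2 * expR u) / n%:R.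
Proof.
move=> n0 u0 un.
have n0' : (0 : R) < n%:R by rewrite ltr0n.
set a := u / n%:R.
have a0 : 0 <= a by rewrite divr_ge0.
have a2 : a <= 2^-1 by rewrite /a ler_pdivrMr //; lra.
have an : `|a| <= 1 by rewrite ger0_norm //; lra.
have h1 := sin_sub_le an.
have h2 : `| `|sin a| - a | <= a ^+ 2.
  by rewrite -{2}(ger0_norm a0); apply: le_trans (ler_dist_dist _ _) h1.
have s1 := sin_max a.
have cm1 (v : R) : 0 <= v -> v <= 1 -> cabs (rc (1 - v)) <= 1.
  by move=> ? ?; rewrite cabs_rc ler_norml; apply/andP; split; lra.
have := @cabs_subX _ (rc (1 - `|sin a|)) (rc (1 - a)) 1 n (lexx _) (cm1 _ (normr_ge0 _) s1) (cm1 _ a0 _).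
rewrite -!rcX -!rcB !cabs_rc expr1n mulr1 => /(_ ltac:(lra)) h3.
have := @cexp_onePdivX_le _ n (rc (- u)) n0.
rewrite cabs_rc normrN (ger0_norm u0) => /(_ un).
rewrite cexp_rc -rc_nat -rcV -rcM -rc1 -rcD -rcX -rcB cabs_rc mulNr -/a => h4.
rewrite -(subrKA ((1 - a) ^+ n)) mulrDl; apply: le_trans (ler_normD _ _) (lerD _ _).
  apply: le_trans h3 _.
  have -> : 1 - `|sin a| - (1 - a) = - (`|sin a| - a) by ring.
  rewrite normrN; apply: le_trans (_ : n%:R * a ^+ 2 <= _); first by rewrite ler_wpM2l // ltW.
  by rewrite /a le_eqVlt; apply/orP; left; apply/eqP; field; rewrite gt_eqF.
by rewrite distrC.
Qed.

(** On the imaginary axis this exponential sum takes the values of the bounded harmonic extension of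
    [re_ev E] at [sigma + i t]. *)
Definition poisson (sigma : R) E := multE (fun x => expR (- (sigma * `|x|))) E.

(** $e^{-\sigma|x|}=\lim_n (1-|\sin(\sigma x/n)|)^n$, a pointwise limit of powers of positive
    multipliers. *)
Lemma positive_mult_poisson sigma : 0 <= sigma ->
  positive_mult (fun x => expR (- (sigma * `|x|))).
Proof.
move=> s0; apply: (@positive_mult_lim
  (fun n x => (1 - `|sin (sigma / n%:R * x)|) ^+ n)).
  move=> n; apply: positive_multX; exact: positive_mult_sin.
move=> x e e0; set u := sigma * `|x|.
have u0 : 0 <= u by rewrite mulr_ge0.
have [N1 h1] := nat_ge (2 * u).
have [N2 h2] := nat_ge ((u ^+ 2 + 8 * u ^+ 2 * expR u) / e).
exists (maxn (maxn N1 N2) 1) => n; rewrite !geq_max -andbA => /and3P[n1 n2 n3].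
have -> : `|sin (sigma / n%:R * x)| = `|sin (u / n%:R)|.
  have -> : u / n%:R = sigma / n%:R * `|x| by rewrite /u mulrAC.
  by case: (ger0P x) => // _; rewrite mulrN sinN normrN.
apply: le_trans (sin_pow_cvg n3 u0 (h1 _ n1)) _.
by rewrite ler_pdivrMr ?ltr0n // (mulrC e) -ler_pdivrMr // h2.
Qed.

Lemma poisson_ge0 sigma E : 0 <= sigma -> (forall t, 0 <= re_ev E t) ->
  forall t, 0 <= re_ev (poisson sigma E) t.
Proof. by move=> s0 hE t; exact: positive_mult_poisson. Qed.

(** The indicator of frequency $0$ is the limit of $e^{-n|x|}$, so taking the mean is itself a
    positive multiplier. Inequalities between means thus follow from pointwise ones without
    integration. *)
Lemma mean_ge0 E : (forall t, 0 <= re_ev E t) -> 0 <= mean E.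
Proof.
move=> hE.
suff /(_ E hE 0) : positive_mult (fun x => (x == 0)%:R).
  rewrite re_ev_mult /mean; congr (_ <= _); apply: eq_bigr => p _.
  rewrite mulrC; congr (_ * _).
  suff -> : mkC 0 0 * rc p.2 = 0 by rewrite oppr0 cexp0 mulr1.
  by apply: C_ext; rewrite !reimE ?re_mkC ?im_mkC !mul0r ?subr0 ?addr0.
apply: (@positive_mult_lim (fun n x => expR (- (n%:R * `|x|)))).
  by move=> n; apply: positive_mult_poisson.
move=> x e e0; case: eqP => [->|/eqP x0].
  by exists 0 => n _; rewrite normr0 mulr0 oppr0 expR0 subrr normr0 ltW.
have x1 : 0 < `|x| by rewrite normr_gt0.
have [N hN] := nat_ge (e^-1 / `|x|).
exists N => n hn; rewrite subr0 ger0_norm ?expR_ge0 // expRN.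
have := hN n hn; rewrite ler_pdivrMr // => h.
have h1 := expR_ge1Dx (n%:R * `|x|).
rewrite -[leRHS]invrK lef_pV2 ?posrE ?invr_gt0 ?expR_gt0 //; lra.
Qed.

End ExponentialSums.

(** * Dirichlet polynomials and their exponentials *)

Section DirichletPolynomials.
Context {R : realType}.
Local Notation C := (Cplx R).
Local Notation dsum := (seq (C * nat)).
Implicit Types (L M : dsum) (s z : C) (sigma t x : R) (n m N : nat).

Definition evD L s : C := \sum_(p <- L) p.1 * nat_cpowN p.2 s.
Definition absD L sigma : R := \sum_(p <- L) cabs p.1 * expR (- (sigma * ln p.2%:R)).
Definition scalD (c : C) L : dsum := [seq (c * p.1, p.2) | p <- L].
Definition mulD L M : dsum := [seq (p.1 * q.1, (p.2 * q.2)%N) | p <- L, q <- M].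
Definition coef L n : C := \sum_(p <- L | p.2 == n) p.1.
Fixpoint powD L m : dsum := if m is m'.+1 then mulD L (powD L m') else [:: (1, 1%N)].
Definition expD N L : dsum := flatten [seq scalD (rc (m`!%:R)^-1) (powD L m) | m <- iota 0 N.+1].

Lemma nat_cpowNE n s : nat_cpowN n s = cexp (- (s * rc (ln n%:R))).
Proof. by []. Qed.

Lemma cabs_nat_cpowN n s : cabs (nat_cpowN n s) = expR (- (re s * ln n%:R)).
Proof. by rewrite nat_cpowNE cabs_cexp reN reM im_rc re_rc mulr0 subr0. Qed.

Lemma nat_cpowNM n m s : (0 < n)%N -> (0 < m)%N ->
  nat_cpowN (n * m) s = nat_cpowN n s * nat_cpowN m s.
Proof.
move=> n0 m0; rewrite !nat_cpowNE natrM lnM ?posrE ?ltr0n //.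
by rewrite rcD mulrDr opprD cexpD.
Qed.

Lemma evD_scal c L s : evD (scalD c L) s = c * evD L s.
Proof. by rewrite /evD big_map mulr_sumr; apply: eq_bigr => p _; rewrite mulrA. Qed.
Lemma absD_scal c L sigma : absD (scalD c L) sigma = cabs c * absD L sigma.
Proof. by rewrite /absD big_map mulr_sumr; apply: eq_bigr => p _; rewrite cabsM mulrA. Qed.
Lemma absD_ge0 L sigma : 0 <= absD L sigma.
Proof. by apply: sumr_ge0 => p _; rewrite mulr_ge0 ?cabs_ge0 ?expR_ge0. Qed.
Lemma cabs_evD L s : cabs (evD L s) <= absD L (re s).
Proof.
apply: le_trans (cabs_sum _ _ _) _; apply: ler_sum => p _.
by rewrite cabsM cabs_nat_cpowN.
Qed.

Definition posD L := all (fun p => (0 < p.2)%N) L.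

Lemma posD_mul L M : posD L -> posD M -> posD (mulD L M).
Proof.
move=> /allP hL /allP hM; apply/allP => _ /allpairsP[[p q] /= [pL qM ->]] /=.
by rewrite muln_gt0 (hL _ pL) (hM _ qM).
Qed.

Lemma evD_mul L M s : posD L -> posD M -> evD (mulD L M) s = evD L s * evD M s.
Proof.
move=> /allP hL /allP hM.
rewrite /evD big_allpairs_dep mulr_suml big_seq [RHS]big_seq; apply: eq_bigr => p pL.
rewrite mulr_sumr big_seq [RHS]big_seq; apply: eq_bigr => q qM /=.
by rewrite nat_cpowNM ?(hL _ pL) ?(hM _ qM) //; ring.
Qed.

Lemma absD_mul L M sigma : posD L -> posD M -> absD (mulD L M) sigma = absD L sigma * absD M sigma.
Proof.
move=> /allP hL /allP hM.
rewrite /absD big_allpairs_dep mulr_suml big_seq [RHS]big_seq; apply: eq_bigr => p pL.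
rewrite mulr_sumr big_seq [RHS]big_seq; apply: eq_bigr => q qM /=.
rewrite natrM lnM ?posrE ?ltr0n ?(hL _ pL) ?(hM _ qM) // cabsM mulrDr opprD expRD.
by ring.
Qed.

Lemma posD_pow L m : posD L -> posD (powD L m).
Proof. by move=> hL; elim: m => [//|m IH]; exact: posD_mul. Qed.

Lemma evD_pow L m s : posD L -> evD (powD L m) s = evD L s ^+ m.
Proof.
move=> hL; elim: m => [|m IH] /=.
  by rewrite /evD big_seq1 /= mul1r nat_cpowNE ln1 rc0 mulr0 oppr0 cexp0 expr0.
by rewrite evD_mul ?posD_pow // IH exprS.
Qed.

Lemma absD_pow L m sigma : posD L -> absD (powD L m) sigma = absD L sigma ^+ m.
Proof.
move=> hL; elim: m => [|m IH] /=.
  by rewrite /absD big_seq1 /= cabs1 mul1r ln1 mulr0 oppr0 expR0 expr0.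
by rewrite absD_mul ?posD_pow // IH exprS.
Qed.

Lemma evD_exp N L s : posD L -> evD (expD N L) s = fexp N (evD L s).
Proof.
move=> hL; rewrite {1}/evD big_flatten big_map /fexp -(big_mkord xpredT (fun m => (m`!%:R)^-1 * _ ^+ m)).
rewrite /index_iota subn0; apply: eq_bigr => m _.
by rewrite -[LHS]/(evD (scalD _ _) s) evD_scal evD_pow // rcV rc_nat.
Qed.

Lemma absD_exp N L sigma : posD L -> absD (expD N L) sigma = fexp N (absD L sigma).
Proof.
move=> hL; rewrite {1}/absD big_flatten big_map /fexp -(big_mkord xpredT (fun m => (m`!%:R)^-1 * _ ^+ m)).
rewrite /index_iota subn0; apply: eq_bigr => m _.
by rewrite -[LHS]/(absD (scalD _ _) sigma) absD_scal absD_pow // cabs_rc ger0_norm.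
Qed.

Lemma coef_scal c L n : coef (scalD c L) n = c * coef L n.
Proof. by rewrite /coef big_map mulr_sumr. Qed.

Lemma sum_by_index (V : nmodType) (F : C * nat -> V) L N :
  \sum_(p <- L | (p.2 <= N)%N) F p = \sum_(i < N.+1) \sum_(p <- L | p.2 == i) F p.
Proof.
elim: L => [|p L IH]; first by rewrite big_nil big1 // => i _; rewrite big_nil.
rewrite big_cons IH; case: ifP => hp.
  rewrite (bigD1 (inord p.2)) //= [in RHS](bigD1 (inord p.2)) //= !big_cons.
  rewrite !inordK ?ltnS // eqxx addrA; congr (_ + _); apply: eq_bigr => i hi.
  rewrite big_cons ifN //; apply: contraNN hi => /eqP h.
  by rewrite -val_eqE /= inordK // h.
apply: eq_bigr => i _; rewrite big_cons ifN //.
by apply/negP => /eqP h; move: (ltn_ord i); rewrite ltnS -h hp.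
Qed.

Lemma coef_sum L (h : nat -> C) N :
  \sum_(p <- L | (p.2 <= N)%N) p.1 * h p.2 = \sum_(i < N.+1) coef L i * h i.
Proof.
rewrite (sum_by_index (fun p => p.1 * h p.2)); apply: eq_bigr => i _.
by rewrite /coef mulr_suml; apply: eq_bigr => p /eqP ->.
Qed.

Lemma coef_mul L M n : (0 < n)%N ->
  coef (mulD L M) n = \sum_(i < n.+1) coef L i * (if (i %| n)%N then coef M (n %/ i) else 0).
Proof.
move=> n0.
rewrite -(coef_sum L (fun i => if (i %| n)%N then coef M (n %/ i) else 0)).
rewrite /coef big_mkcond big_allpairs_dep [RHS]big_mkcond; apply: eq_bigr => p _ /=.
have e q : (p.2 * q == n)%N = (p.2 %| n)%N && (q == n %/ p.2)%N.
  case: (posnP p.2) => [->|p0]; first by rewrite mul0n dvd0n eq_sym (gtn_eqF n0).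
  apply/eqP/andP => [<-|[hd /eqP ->]]; last by rewrite mulnC divnK.
  by rewrite dvdn_mulr // mulKn.
under eq_bigr do rewrite e.
case: ifP => hp; last first.
  by rewrite big1 // => q _; case: ifP => // /andP[/(dvdn_leq n0)]; rewrite hp.
case: ifP => hd; last by rewrite mulr0 big1.
by rewrite -big_mkcond mulr_sumr.
Qed.

Lemma coef_mul_ext L L' M M' n : (0 < n)%N ->
  (forall i, (0 < i <= n)%N -> coef L i = coef L' i) ->
  (forall i, (0 < i <= n)%N -> coef M i = coef M' i) ->
  coef (mulD L M) n = coef (mulD L' M') n.
Proof.
move=> n0 hL hM; rewrite !coef_mul //; apply: eq_bigr => i _.
case: ifP => hd; last by rewrite !mulr0.
have i0 := dvdn_gt0 n0 hd.
rewrite hL ?hM //; first by rewrite divn_gt0 // dvdn_leq //= leq_div.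
by rewrite i0 -ltnS ltn_ord.
Qed.

Lemma coef_pow_ext L L' m n : (0 < n)%N ->
  (forall i, (0 < i <= n)%N -> coef L i = coef L' i) ->
  coef (powD L m) n = coef (powD L' m) n.
Proof.
move=> n0 h; elim: m n n0 h => [//|m IH] n n0 h /=.
apply: coef_mul_ext => // i /andP[i0 hi]; apply: IH => // j /andP[j0 hj].
by apply: h; rewrite j0 (leq_trans hj).
Qed.

(** All indices of an $m$-th power are at least $2^m$. Hence a given coefficient of the exponential
    of a Dirichlet series without constant term is a finite sum. *)
Lemma coef_pow_small L m n : all (fun p => (1 < p.2)%N) L -> (n < 2 ^ m)%N ->
  coef (powD L m) n = 0.
Proof.
move=> hL hn.
have : all (fun p => (2 ^ m <= p.2)%N) (powD L m).
  elim: m {hn} => [//|m IH]; apply/allP => _ /allpairsP[[p q] /= [pL qM ->]] /=.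
  by rewrite expnS leq_mul // ?(allP hL _ pL) ?(allP IH _ qM).
move=> /allP H; rewrite /coef big_seq_cond big1 // => p /andP[/H h /eqP e].
by rewrite e leqNgt hn in h.
Qed.

Lemma coef_exp N L n : coef (expD N L) n = \sum_(m < N.+1) rc (m`!%:R)^-1 * coef (powD L m) n.
Proof.
rewrite /coef big_flatten big_map -(big_mkord xpredT (fun m => rc (m`!%:R)^-1 * coef (powD L m) n)).
by rewrite /index_iota subn0; apply: eq_bigr => m _; rewrite -/(coef _ _) coef_scal.
Qed.

End DirichletPolynomials.

(** * The exponential of a convergent Dirichlet series *)

Section DirichletExponential.
Context {R : realType}.
Local Notation C := (Cplx R).
Variable L : nat -> seq (C * nat).
Hypothesis L_ge2 : forall K, all (fun p => (1 < p.2)%N) (L K).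
Hypothesis L_stable : forall K n, (0 < n <= K)%N -> coef (L K) n = coef (L n) n.
Hypothesis L_bound : forall sigma : R, 0 < sigma ->
  exists B, forall K, absD (L K) sigma <= B.

(** Stage $n$ already gives the final value: coefficients of index at most $n$ no longer change in
    [L], and powers beyond the $n$-th do not reach index $n$ ([coef_exp_stable]). *)
Definition exp_coefs n : C := coef (expD n (L n)) n.

Let L_pos K : posD (L K).
Proof. by apply: sub_all (L_ge2 K) => p; exact: ltnW. Qed.

Lemma coef_exp_stable N n : (0 < n <= N)%N -> coef (expD N (L N)) n = exp_coefs n.
Proof.
move=> /andP[n0 hN]; rewrite /exp_coefs !coef_exp.
have -> : N.+1 = (n.+1 + (N - n))%N by rewrite addSn subnKC.
rewrite big_split_ord /= [X in _ + X]big1 ?addr0; last first.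
  move=> i _; rewrite -[mulD _ _]/(powD (L N) (n + i).+1) coef_pow_small ?mulr0 //.
  apply: leq_trans (ltn_expl _ (isT : 1 < 2)%N) _.
  by rewrite leq_exp2l // ltnW // leq_addr.
apply: eq_bigr => m _; congr (_ * _); apply: coef_pow_ext => // i /andP[i0 hi].
by rewrite L_stable ?i0 ?(leq_trans hi) // [RHS]L_stable ?i0.
Qed.

Lemma exp_coefs_evD N s :
  \sum_(1 <= n < N.+1) exp_coefs n * nat_cpowN n s =
  \sum_(p <- expD N (L N) | (p.2 <= N)%N) p.1 * nat_cpowN p.2 s.
Proof.
rewrite (coef_sum _ (fun n => nat_cpowN n s)).
rewrite -(big_mkord xpredT (fun i => coef (expD N (L N)) i * nat_cpowN i s)).
rewrite [RHS]big_nat_recl // big_add1 /=.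
have -> : coef (expD N (L N)) 0 = 0.
  rewrite coef_exp big1 // => m _; rewrite coef_pow_small ?mulr0 //.
  by rewrite expn_gt0.
rewrite mul0r add0r !big_nat; apply: eq_bigr => i /andP[_ hi].
by rewrite coef_exp_stable.
Qed.

Lemma exp_coefs_abs N sigma :
  \sum_(1 <= n < N.+1) cabs (exp_coefs n) * expR (- (sigma * ln n%:R)) <=
  fexp N (absD (L N) sigma).
Proof.
rewrite -absD_exp // /absD.
apply: le_trans (_ : \sum_(p <- expD N (L N) | (p.2 <= N)%N) cabs p.1 * expR (- (sigma * ln p.2%:R)) <= _); last first.
  rewrite [leLHS]big_mkcond ler_sum // => p _; case: ifP => // _.
  by rewrite mulr_ge0 ?cabs_ge0 ?expR_ge0.
rewrite (sum_by_index (fun p => cabs p.1 * expR (- (sigma * ln p.2%:R)))).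
rewrite -(big_mkord xpredT (fun i => \sum_(p <- expD N (L N) | p.2 == i) cabs p.1 * expR (- (sigma * ln p.2%:R)))).
rewrite [leRHS]big_nat_recl // [leLHS]big_add1 /= -[leLHS]add0r lerD //.
  by apply: sumr_ge0 => p _; rewrite mulr_ge0 ?cabs_ge0 ?expR_ge0.
rewrite !big_nat; apply: ler_sum => i /andP[_ hi].
rewrite -(@coef_exp_stable N) //.
under [leRHS]eq_bigr => p /eqP -> do [].
rewrite -mulr_suml ler_wpM2r ?expR_ge0 //; exact: cabs_sum.
Qed.

Lemma fexp_tail_mono N (x B : R) : 0 <= x -> x <= B ->
  expR x - fexp N x <= expR B - fexp N B.
Proof.
move=> x0 xB; have B0 : 0 <= B by lra.
rewrite lerBlDr.
apply: limr_le; first exact: is_cvg_series_exp_coeff.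
near=> M.
have hM : (N.+1 <= M)%N by near: M; exists N.+1.
apply: le_trans (_ : fexp M.-1 B - fexp N B + fexp N x <= _); last first.
  by rewrite lerD2r lerD2r; exact: fexp_le.
rewrite -[in leLHS](ltn_predK hM) -fexp_series -lerBlDr /fexp.
have -> : M.-1.+1 = (N.+1 + (M - N.+1))%N by rewrite subnKC // (ltn_predK hM).
rewrite !big_split_ord /= !(addrAC _ _ (- _)) !subrr !add0r.
apply: ler_sum => i _; rewrite ler_wpM2l ?invr_ge0 //.
by rewrite lerXn2r ?nnegrE.
Unshelve. all: by end_near. Qed.

Lemma fexp_cvg (B e : R) : 0 < e -> exists N0, forall N, (N0 <= N)%N -> expR B - fexp N B <= e.
Proof.
move=> e0.
have /cvgrPdist_le/(_ _ e0)[N0 _ H] := is_cvg_series_exp_coeff B.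
exists N0 => N hN; rewrite fexp_series.
have := H N.+1 (leq_trans hN (leqnSn _)); apply: le_trans; exact: ler_norm.
Qed.

Lemma cexp_dist_le z w (B : R) : re w <= B -> cabs (z - w) <= 1 ->
  cabs (cexp z - cexp w) <= expR B * expR 1 * cabs (z - w).
Proof.
move=> hw h1.
have -> : cexp z - cexp w = cexp w * (cexp (z - w) - 1).
  by rewrite mulrBr mulr1 -cexpD (addrC w) subrK.
rewrite cabsM cabs_cexp -mulrA.
apply: ler_pM; rewrite ?expR_ge0 ?cabs_ge0 ?ler_expR //.
apply: le_trans (cexp_sub1_le _) _; rewrite mulrC ler_wpM2r ?cabs_ge0 //.
by rewrite ler_expR.
Qed.

Variable f : C -> C.
Hypothesis L_cvg : forall sigma e : R, 0 < sigma -> 0 < e -> exists K0, forall K,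
  (K0 <= K)%N -> forall t, cabs (evD (L K) (mkC sigma t) - f (mkC sigma t)) <= e.

(** The difference consists of terms of index $n>N$, for which $n^{-\sigma}\le
    N^{-\sigma/2}n^{-\sigma/2}$: half of the abscissa buys decay in $N$, the other half keeps the
    sum bounded. *)
Lemma exp_coefs_tail N (sigma t B : R) : (0 < N)%N -> 0 < sigma ->
  (forall K, absD (L K) (sigma / 2) <= B) ->
  cabs (\sum_(1 <= n < N.+1) exp_coefs n * nat_cpowN n (mkC sigma t)
        - fexp N (evD (L N) (mkC sigma t))) <= expR (- (sigma / 2 * ln N%:R)) * expR B.
Proof.
move=> N0 s0 hB; have s20 : 0 <= sigma / 2 by rewrite divr_ge0 // ltW.
rewrite exp_coefs_evD -evD_exp // /evD.
rewrite [in X in _ - X](bigID (fun p => (p.2 <= N)%N)) /= opprD addNKr cabsN.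
apply: le_trans (cabs_sum _ _ _) _.
apply: le_trans (_ : expR (- (sigma / 2 * ln N%:R)) * fexp N (absD (L N) (sigma / 2)) <= _); last first.
  rewrite ler_wpM2l ?expR_ge0 //; apply: le_trans (fexp_le _ (absD_ge0 _ _)) _.
  by rewrite ler_expR.
rewrite -absD_exp // /absD mulr_sumr.
rewrite [leLHS]big_mkcond ler_sum // => p _; case: ifPn; last first.
  by move=> _; rewrite !mulr_ge0 ?cabs_ge0 ?expR_ge0.
rewrite -ltnNge => hp.
rewrite cabsM cabs_nat_cpowN re_mkC mulrCA ler_wpM2l ?cabs_ge0 //.
rewrite -expRD ler_expR -opprD lerN2 -mulrDr.
have h : ln N%:R <= ln p.2%:R :> R.
  by rewrite ler_ln ?posrE ?ltr0n ?ler_nat ?(ltnW hp) // (leq_ltn_trans _ hp).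
have : sigma / 2 * (ln N%:R + ln p.2%:R) <= sigma / 2 * (2 * ln p.2%:R) by rewrite ler_wpM2l //; lra.
by move=> /le_trans; apply; rewrite mulrA divfK.
Qed.

Lemma expR_ln_small (sigma A e : R) : 0 < sigma -> 0 < e ->
  exists N0, forall N, (N0 <= N)%N -> A * expR (- (sigma * ln N%:R)) <= e.
Proof.
move=> s0 e0.
have [N0 h0] := nat_ge (expR (`|A| / e / sigma)).
exists N0 => N hN; have := h0 N hN => h.
have N1 : (0 : R) < N%:R by apply: lt_le_trans h; exact: expR_gt0.
have : `|A| / e / sigma <= ln N%:R by rewrite -ler_expR lnK.
rewrite ler_pdivrMr // ler_pdivrMr // => h2.
apply: le_trans (ler_wpM2r (expR_ge0 _) (ler_norm A)) _.
rewrite expRN ler_pdivrMr ?expR_gt0 //; apply: le_trans h2 _.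
rewrite mulrC (mulrC _ sigma) ler_wpM2l //; first exact: ltW.
by have := expR_ge1Dx (sigma * ln N%:R); lra.
Qed.

(** Three errors are added: dropping indices beyond [N], cutting the exponential series at degree
    [N], and replacing [f] by [L N]. None depends on [t]; this uniformity later lets whole vertical
    lines be compared through means. *)
Lemma exp_coefs_cvg (sigma e : R) : 0 < sigma -> 0 < e ->
  exists N0, forall N, (N0 <= N)%N -> forall t,
  cabs (\sum_(1 <= n < N.+1) exp_coefs n * nat_cpowN n (mkC sigma t)
        - cexp (f (mkC sigma t))) <= e.
Proof.
move=> s0 e0.
have s20 : 0 < sigma / 2 by rewrite divr_gt0.
have e30 : 0 < e / 3 by rewrite divr_gt0.
have [B1 hB1] := L_bound s20; have [B hB] := L_bound s0.
have [N1 h1] := expR_ln_small (expR B1) s20 e30.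
have [N2 h2] := fexp_cvg B e30.
have EB : 0 < expR B * expR 1 :> R by rewrite mulr_gt0 ?expR_gt0.
(* The minimum with 1 meets the hypothesis of [cexp_dist_le]; the other bound makes its conclusion
   at most [e / 3]. *)
have d0 : 0 < Num.min 1 (e / 3 / (expR B * expR 1)) by rewrite lt_min ltr01 divr_gt0.
have [N3 h3] := L_cvg s0 d0.
exists (maxn (maxn N1 N2) (maxn N3 1)) => N; rewrite !geq_max => /andP[/andP[n1 n2] /andP[n3 n4]] t.
set s := mkC sigma t.
have hf : cabs (f s) <= B.
  have cl : clim (fun K => evD (L K) s) (f s).
    by move=> d /(L_cvg s0)[K hK]; exists K => n /hK; apply.
  rewrite -[f s]subr0; apply: (clim_dist (N := 0) cl) => n _; rewrite subr0.
  by apply: le_trans (cabs_evD _ _) _; exact: hB.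
have hfr : re (f s) <= B by apply: le_trans hf; apply: le_trans (cabs_re _); exact: ler_norm.
have H1 := @exp_coefs_tail N sigma t B1 n4 s0 hB1.
rewrite -/s in H1.
set z := evD (L N) s in H1 *.
have hz : cabs z <= B by apply: le_trans (cabs_evD _ _) _; exact: hB.
have H2 : cabs (fexp N z - cexp z) <= e / 3.
  rewrite cabs_distC; apply: le_trans (cexp_fexp_le _ _) _.
  by apply: le_trans (fexp_tail_mono _ (cabs_ge0 z) hz) _; exact: h2.
have := h3 N n3 t; rewrite -/s -/z le_min => /andP[q1 q2].
have H3 := cexp_dist_le hfr q1.
have H4 : expR B * expR 1 * cabs (z - f s) <= e / 3 by rewrite mulrC -ler_pdivlMr.
have := h1 N n1; rewrite mulrC => H5.
have := cabs_triangle (\sum_(1 <= n < N.+1) exp_coefs n * nat_cpowN n s) (cexp (f s)) (fexp N z).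
have := cabs_triangle (fexp N z) (cexp (f s)) (cexp z).
lra.
Qed.

Lemma exp_coefs_bound sigma : 0 < sigma -> exists B, forall N,
  \sum_(1 <= n < N.+1) cabs (exp_coefs n) * expR (- (sigma * ln n%:R)) <= B.
Proof.
move=> /L_bound[B hB]; exists (expR B) => N.
apply: le_trans (exp_coefs_abs _ _) _.
by apply: le_trans (fexp_le _ (absD_ge0 _ _)) _; rewrite ler_expR.
Qed.

End DirichletExponential.

(** * Differentiability of Dirichlet series *)

Section DirichletDerivative.
Context {R : realType}.
Local Notation C := (Cplx R).
Variables (a : nat -> C) (g : C -> C).
Hypothesis a_bound : forall sigma : R, 0 < sigma -> exists B, forall N,
  \sum_(1 <= n < N.+1) cabs (a n) * expR (- (sigma * ln n%:R)) <= B.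
Hypothesis g_sum : forall s, 0 < re s ->
  clim (fun N => \sum_(1 <= n < N.+1) a n * nat_cpowN n s) (g s).

Lemma ln_nat_ge0 n : 0 <= ln n%:R :> R.
Proof.
case: n => [|n]; first by rewrite ln0.
by rewrite ln_ge0 // ler1n.
Qed.

(** The exponent $\sigma$ is split in three: $\sigma/4$ pays for the increment $h$, $\sigma/2$
    absorbs $x^2=\ln^2 n$ through $(\sigma x/4)^2\le e^{\sigma x/2}$, whence $16/\sigma^2$, and
    $\sigma/4$ is left for summability. *)
Lemma term_taylor n (s h : C) (sigma : R) : 0 < sigma -> re s = sigma ->
  h != 0 -> cabs h <= sigma / 4 ->
  cabs (h^-1 * (nat_cpowN n (h + s) - nat_cpowN n s) + rc (ln n%:R) * nat_cpowN n s)
  <= cabs h * (16 / sigma ^+ 2 * expR (- (sigma / 4 * ln n%:R))).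
Proof.
move=> s0 hs h0 hh; set x : R := ln n%:R; have x0 : 0 <= x := ln_nat_ge0 n.
set w := - (h * rc x).
have -> : nat_cpowN n (h + s) = cexp w * nat_cpowN n s.
  by rewrite !nat_cpowNE -cexpD -opprD -mulrDl.
have -> : h^-1 * (cexp w * nat_cpowN n s - nat_cpowN n s) + rc x * nat_cpowN n s =
    h^-1 * (cexp w - 1 - w) * nat_cpowN n s.
  by rewrite /w; field.
rewrite !cabsM cabsV cabs_nat_cpowN hs -/x.
have cw : cabs w = cabs h * x by rewrite cabsN cabsM cabs_rc ger0_norm.
have c0 : 0 < cabs h by rewrite cabs_gt0.
have h1 := cexp_taylor1 w; rewrite cw in h1.
have e0 := expR_ge0 (- (sigma * x)).
apply: le_trans (_ : (cabs h)^-1 * ((cabs h * x) ^+ 2 * expR (cabs h * x)) * expR (- (sigma * x)) <= _).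
  by rewrite ler_wpM2r // ler_wpM2l // invr_ge0 ltW.
have -> : (cabs h)^-1 * ((cabs h * x) ^+ 2 * expR (cabs h * x)) * expR (- (sigma * x)) =
   cabs h * (x ^+ 2 * (expR (cabs h * x) * expR (- (sigma * x)))).
  by field; rewrite gt_eqF.
apply: ler_wpM2l; first exact: ltW.
rewrite -expRD.
have h2 : expR (cabs h * x - sigma * x) <= expR (- (sigma / 2 * x)) * expR (- (sigma / 4 * x)).
  rewrite -expRD ler_expR.
  have : cabs h * x <= sigma / 4 * x by rewrite ler_wpM2r.
  have : sigma * x = sigma / 4 * x + sigma / 4 * x + sigma / 2 * x by field.
  lra.
apply: le_trans (ler_wpM2l (sqr_ge0 x) h2) _.
rewrite mulrA ler_wpM2r ?expR_ge0 //.
have -> : expR (- (sigma / 2 * x)) = (expR (sigma / 4 * x) ^+ 2)^-1.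
  by rewrite -expRM_natl -expRN; congr expR; field.
have h3 := expR_ge1Dx (sigma / 4 * x).
have q0 : 0 <= sigma / 4 * x by rewrite mulr_ge0 // divr_ge0 // ltW.
rewrite ler_pdivrMr ?exprn_gt0 ?expR_gt0 //.
have -> : x ^+ 2 = 16 / sigma ^+ 2 * (sigma / 4 * x) ^+ 2 by field; rewrite gt_eqF.
rewrite ler_wpM2l ?divr_ge0 ?sqr_ge0 //.
by rewrite lerXn2r ?nnegrE ?expR_ge0 //; lra.
Qed.

(** Summing [term_taylor] bounds the difference quotient minus the termwise derivative by a multiple
    of $|h|$, so complex differentiability needs no theorem on uniform limits. *)
Lemma dirichlet_derivable s : 0 < re s -> derivable g s 1.
Proof.
move=> s0; set sigma := re s in s0.
have s40 : 0 < sigma / 4 by rewrite divr_gt0.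
have s20 : 0 < sigma / 2 by rewrite divr_gt0.
have [B hB] := a_bound s40; have [B2 hB2] := a_bound s20.
have [d hd] : exists d, clim (fun N => \sum_(1 <= n < N.+1) - a n * (rc (ln n%:R) * nat_cpowN n s)) d.
  have [|K|d hd] := @mtest _ (fun k => - a k.+1 * (rc (ln k.+1%:R) * nat_cpowN k.+1 s))
     (fun k => 2 / sigma * (cabs (a k.+1) * expR (- (sigma / 2 * ln k.+1%:R)))) (2 / sigma * B2).
  - move=> k; rewrite !cabsM cabsN cabs_rc ger0_norm ?ln_nat_ge0 // cabs_nat_cpowN -/sigma.
    set x := ln _; have x0 : 0 <= x := ln_nat_ge0 _.
    rewrite [leRHS]mulrCA ler_wpM2l ?cabs_ge0 //.
    have -> : expR (- (sigma * x)) = expR (- (sigma / 2 * x)) * expR (- (sigma / 2 * x)).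
      by rewrite -expRD; congr expR; field.
    rewrite mulrA ler_wpM2r ?expR_ge0 // expRN ler_pdivrMr ?expR_gt0 //.
    have h3 := expR_ge1Dx (sigma / 2 * x).
    have {1}-> : x = 2 / sigma * (sigma / 2 * x) by field; rewrite gt_eqF.
    apply: ler_wpM2l; first by rewrite divr_ge0 // ltW.
    lra.
  - rewrite -mulr_sumr; apply: ler_wpM2l; first by rewrite divr_ge0 // ltW.
    by have := hB2 K; rewrite big_add1 /= big_mkord.
  exists d => e /hd[N hN]; exists N => n /hN.
  by rewrite big_add1 /= big_mkord.
have key h : h != 0 -> cabs h <= sigma / 4 ->
    cabs (h^-1 * (g (h + s) - g s) - d) <= cabs h * (16 / sigma ^+ 2 * B).
  move=> h0 hh.
  have rhs : 0 < re (h + s).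
    rewrite reD -/sigma; have := le_trans (cabs_re h) hh.
    by rewrite ler_norml => /andP[]; lra.
  apply: le_eps => e e0.
  have ch0 : 0 < cabs h by rewrite cabs_gt0.
  have e1 : 0 < e / 3 by lra.
  have e2 : 0 < e / 3 * cabs h by rewrite mulr_gt0.
  have [N1 h1] := g_sum rhs e2; have [N2 h2] := g_sum s0 e2; have [N3 h3] := hd _ e1.
  set N := maxn N1 (maxn N2 N3).
  have {}h1 := h1 N (leq_maxl _ _).
  have {}h2 := h2 N (leq_trans (leq_maxl _ _) (leq_maxr _ _)).
  have {}h3 := h3 N (leq_trans (leq_maxr _ _) (leq_maxr _ _)).
  move: h1 h2 h3.
  set A := \sum_(1 <= n < N.+1) _; set A' := \sum_(1 <= n < N.+1) _; set D := \sum_(1 <= n < N.+1) _ => h1 h2 h3.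
  have h4 : cabs (h^-1 * (A - A') - D) <= cabs h * (16 / sigma ^+ 2 * B).
    rewrite /A /A' /D -sumrB mulr_sumr -sumrB.
    apply: le_trans (cabs_sum _ _ _) _.
    apply: le_trans (_ : cabs h * (16 / sigma ^+ 2 * (\sum_(1 <= n < N.+1) cabs (a n) * expR (- (sigma / 4 * ln n%:R)))) <= _); last first.
      apply: ler_wpM2l; first exact: cabs_ge0.
      by apply: ler_wpM2l; [rewrite divr_ge0 ?sqr_ge0|exact: hB].
    rewrite mulrA mulr_sumr; apply: ler_sum => n _.
    have -> : h^-1 * (a n * nat_cpowN n (h + s) - a n * nat_cpowN n s) - - a n * (rc (ln n%:R) * nat_cpowN n s)
       = a n * (h^-1 * (nat_cpowN n (h + s) - nat_cpowN n s) + rc (ln n%:R) * nat_cpowN n s) by ring.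
    rewrite cabsM [leRHS]mulrCA; apply: ler_wpM2l; first exact: cabs_ge0.
    by rewrite -[leRHS]mulrA; exact: term_taylor.
  have -> : h^-1 * (g (h + s) - g s) - d = (h^-1 * (A - A') - D) + (h^-1 * (g (h + s) - A) - h^-1 * (g s - A')) + (D - d) by ring.
  apply: le_trans (cabsD _ _) _.
  apply: le_trans (lerD (cabsD _ _) (lexx _)) _.
  have h5 : cabs (h^-1 * (g (h + s) - A)) <= e / 3.
    by rewrite cabsM cabsV cabs_distC mulrC ler_pdivrMr.
  have h6 : cabs (h^-1 * (g s - A')) <= e / 3.
    by rewrite cabsM cabsV cabs_distC mulrC ler_pdivrMr.
  have := cabsB (h^-1 * (g (h + s) - A)) (h^-1 * (g s - A')).
  lra.
apply/cvg_ex; exists d; apply/cvgrPdist_le => eps eps0.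
have [epsE r0] := gt0_rc eps0.
set K := 16 / sigma ^+ 2 * B in key.
pose del := Num.min (sigma / 4) (re eps / (1 + `|K|)).
have K0 : 0 < 1 + `|K| by rewrite ltr_wpDr.
have del0 : 0 < del by rewrite lt_min s40 divr_gt0.
exists (rc del); first by rewrite -rc0 /= ltrc.
move=> h /= hdel h0.
rewrite sub0r normrN normC_cabs ltrc lt_min in hdel.
case/andP: hdel => d1 d2.
rewrite epsE normC_cabs lerc cabs_distC.
apply: le_trans (_ : cabs (h^-1 * (g (h + s) - g s) - d) <= _).
  by rewrite /GRing.scale /= mulr1.
apply: le_trans (key h h0 (ltW d1)) _.
move: d2; rewrite ltr_pdivlMr // => d2.
apply: le_trans (ler_wpM2l (cabs_ge0 h) (ler_norm K)) _.
by apply: le_trans (ltW d2); rewrite ler_wpM2l ?cabs_ge0 // lerDr.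
Qed.

End DirichletDerivative.

(* The library's filter instance for [nbhs s] is not found by typeclass resolution
   when [s : Cplx R]; it is supplied explicitly here. *)
Section ComplexContinuity.
Context {R : realType}.
Local Notation C := (Cplx R).
Implicit Types (h : C -> C) (s : C).

Lemma C_cvgP h s0 (l : C) :
  (forall r : R, 0 < r -> \forall s \near s0, cabs (h s - l) <= r) -> h s @[s --> s0] --> l.
Proof.
move=> H; apply/(@cvgrPdist_le _ _ _ _ (nbhs_filter s0)) => eps eps0.
have [e r0] := gt0_rc eps0.
apply: (@filterS _ _ (nbhs_filter s0) _ _ _ (H _ r0)) => s.
by rewrite e normC_cabs lerc cabs_distC re_rc.
Qed.

Lemma C_cvg_cst (a s0 : C) : (fun=> a) s @[s --> s0] --> a.
Proof. exact: (@cvg_cst _ _ _ _ (nbhs_filter s0)). Qed.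
Lemma C_cvgM h h' s0 (a b : C) : h s @[s --> s0] --> a -> h' s @[s --> s0] --> b ->
  (h s * h' s) @[s --> s0] --> a * b.
Proof. move=> H1 H2; exact: (@cvgM _ _ _ (nbhs_filter s0) _ _ _ _ H1 H2). Qed.
Lemma C_cvgD h h' s0 (a b : C) : h s @[s --> s0] --> a -> h' s @[s --> s0] --> b ->
  (h s + h' s) @[s --> s0] --> a + b.
Proof. move=> H1 H2; exact: (@cvgD _ _ _ _ (nbhs_filter s0) _ _ _ _ H1 H2). Qed.
Lemma C_cvgN h s0 (a : C) : h s @[s --> s0] --> a -> (- h s) @[s --> s0] --> - a.
Proof. move=> H1; exact: (@cvgN _ _ _ _ (nbhs_filter s0) _ _ H1). Qed.
Lemma C_cvgV h s0 (a : C) : a != 0 -> h s @[s --> s0] --> a -> (h s)^-1 @[s --> s0] --> a^-1.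
Proof. move=> H1 H2; exact: (@cvgV _ _ _ (nbhs_filter s0) _ _ H1 H2). Qed.

Lemma nat_cpowN_cvg n s0 : nat_cpowN n s @[s --> s0] --> nat_cpowN n s0.
Proof.
apply: C_cvgP => r r0.
set x : R := ln n%:R; have x0 : 0 <= x := ln_nat_ge0 n.
set B := re (- (s0 * rc x)).
have Q0 : 0 < expR B * expR 1 by rewrite mulr_gt0 ?expR_gt0.
pose m := Num.min 1 (r / (expR B * expR 1)).
have m0 : 0 < m by rewrite lt_min ltr01 divr_gt0.
have x1 : 0 < 1 + x by lra.
exists (rc (m / (1 + x))); first by rewrite -rc0 /= ltrc divr_gt0.
move=> s /=; rewrite normC_cabs ltrc ltr_pdivlMr // => hs.
have h : cabs (- (s * rc x) - - (s0 * rc x)) <= m.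
  have -> : - (s * rc x) - - (s0 * rc x) = (s0 - s) * rc x by ring.
  rewrite cabsM cabs_rc (ger0_norm x0); apply: le_trans (ltW hs).
  by rewrite ler_wpM2l ?cabs_ge0 // lerDr.
have [h1 h2] : cabs (- (s * rc x) - - (s0 * rc x)) <= 1 /\
    cabs (- (s * rc x) - - (s0 * rc x)) <= r / (expR B * expR 1).
  by move: h; rewrite /m le_min => /andP.
apply: le_trans (cexp_dist_le (lexx _) h1) _.
by rewrite mulrC -ler_pdivlMr.
Qed.

Lemma evD_cvg (P : seq (C * nat)) s0 : evD P s @[s --> s0] --> evD P s0.
Proof.
elim: P => [|p P IH].
  rewrite /evD big_nil (_ : (fun s => _) = fun=> 0); first exact: C_cvg_cst.
  by apply: funext => s; rewrite big_nil.
rewrite /evD big_cons (_ : (fun s => _) = fun s => p.1 * nat_cpowN p.2 s + evD P s).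
  apply: (@C_cvgD (fun s => p.1 * nat_cpowN p.2 s) (evD P)); last exact: IH.
  by apply: (@C_cvgM (fun=> p.1)); [exact: C_cvg_cst | exact: nat_cpowN_cvg].
by apply: funext => s; rewrite big_cons.
Qed.

End ComplexContinuity.

(** * The singular function attached to a nonnegative series *)

Section RationalFrequencies.
Context {R : realType}.
Local Notation C := (Cplx R).
Implicit Types (E F : seq (C * R)).

Definition rat_freq (x : R) := exists a b : nat, [/\ (0 < a)%N, (0 < b)%N & x = ln a%:R - ln b%:R].
Definition rat_freqs E := forall p, p \in E -> rat_freq p.2.

Lemma rat_freqD x y : rat_freq x -> rat_freq y -> rat_freq (x + y).
Proof.
move=> [a [b [a0 b0 ->]]] [a' [b' [a0' b0' ->]]]; exists (a * a')%N, (b * b')%N.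
rewrite !muln_gt0 a0 b0 a0' b0'; split => //.
by rewrite !natrM !lnM ?posrE ?ltr0n //; ring.
Qed.
Lemma rat_freqN x : rat_freq x -> rat_freq (- x).
Proof. by move=> [a [b [a0 b0 ->]]]; exists b, a; rewrite opprB. Qed.
Lemma rat_freq0 : rat_freq 0.
Proof. by exists 1%N, 1%N; rewrite subrr. Qed.
Lemma rat_freqMn x n : rat_freq x -> rat_freq (n%:R * x).
Proof.
move=> hx; elim: n => [|n IH]; first by rewrite mul0r; exact: rat_freq0.
by rewrite -natr1 mulrDl mul1r; exact: rat_freqD.
Qed.

Lemma rat_freqs_cat E F : rat_freqs E -> rat_freqs F -> rat_freqs (E ++ F).
Proof. by move=> h h' p; rewrite mem_cat => /orP[/h|/h']. Qed.
Lemma rat_freqs_mul E F : rat_freqs E -> rat_freqs F -> rat_freqs (mulE E F).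
Proof.
by move=> h h' _ /allpairsP[[p q] /= [/h hp /h' hq ->]] /=; exact: rat_freqD.
Qed.
Lemma rat_freqs_scal c E : rat_freqs E -> rat_freqs (scalE c E).
Proof. by move=> h _ /mapP[p /h hp ->]. Qed.
Lemma rat_freqs_conj E : rat_freqs E -> rat_freqs (conjE E).
Proof. by move=> h _ /mapP[p /h hp ->]; exact: rat_freqN. Qed.
Lemma rat_freqs_const c : rat_freqs [:: (c, 0)].
Proof. by move=> p; rewrite inE => /eqP ->; exact: rat_freq0. Qed.

(** After reduction to a common denominator, everything is scaled by [B.+1]. Large numerators leave
    the low indices free, so each coefficient of the infinite sum receives finitely many
    contributions; a large [q] gives decay in the half-plane. *)
Lemma common_denominator E (B : nat) : rat_freqs E ->
  exists (q : nat) (E' : seq (C * nat)), [/\ (B < q)%N, all (fun p => (B < p.2)%N) E' &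
    E = [seq (p.1, ln p.2%:R - ln q%:R) | p <- E']].
Proof.
move=> hE.
suff [d [E' [d0 hE' ->]]] : exists (d : nat) (E' : seq (C * nat)), [/\ (0 < d)%N,
    all (fun p => (0 < p.2)%N) E' & E = [seq (p.1, ln p.2%:R - ln d%:R) | p <- E']].
  exists (d * B.+1)%N, [seq (p.1, (p.2 * B.+1)%N) | p <- E']; split.
  - by rewrite -[X in (X < _)%N]mul1n; apply: leq_ltn_trans (leq_mul d0 (leqnn B)) _; rewrite ltn_mul2l d0 /=.
  - rewrite all_map; apply: sub_all hE' => p /= p0.
    by apply: leq_ltn_trans (_ : p.2 * B < _)%N; rewrite ?leq_pmull // ltn_mul2l p0 /=.
  - rewrite -map_comp; apply/eq_in_map => p /(allP hE') p0 /=.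
    by rewrite !natrM !lnM ?posrE ?ltr0n //; congr (_, _); ring.
elim: E hE => [|[c x] E IH] hE; first by exists 1%N, [::].
have [|d [E' [d0 hE' eE]]] := IH; first by move=> p pE; apply: hE; rewrite inE pE orbT.
have [/= a [b [a0 b0 ->]]] := hE (c, x) (mem_head _ _).
exists (b * d)%N, ((c, (a * d)%N) :: [seq (p.1, (p.2 * b)%N) | p <- E']); split.
- by rewrite muln_gt0 b0.
- by rewrite /= muln_gt0 a0 d0 /= all_map; apply: sub_all hE' => p /= p0; rewrite muln_gt0 p0.
- rewrite /= !natrM !lnM ?posrE ?ltr0n //; congr ((_, _) :: _); first by ring.
  rewrite eE -map_comp; apply/eq_in_map => p /(allP hE') p0 /=.
  by rewrite !natrM !lnM ?posrE ?ltr0n //; congr (_, _); ring.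
Qed.

End RationalFrequencies.

(** * Geometric sums and the Fejer kernel *)

Section Geometric.
Context {R : realType}.
Local Notation C := (Cplx R).

Lemma geom_sum (w : C) n : (1 - w) * \sum_(j < n) w ^+ j = 1 - w ^+ n.
Proof.
elim: n => [|n IH]; first by rewrite big_ord0 mulr0 expr0 subrr.
by rewrite big_ord_recr /= mulrDr IH exprS; ring.
Qed.

Lemma geom_sum_le (r : R) n : 0 <= r -> r < 1 -> \sum_(j < n) r ^+ j <= (1 - r)^-1.
Proof.
move=> r0 r1; have h : (1 - r) * \sum_(j < n) r ^+ j = 1 - r ^+ n.
  elim: n => [|n IH]; first by rewrite big_ord0 mulr0 expr0 subrr.
  by rewrite big_ord_recr /= mulrDr IH exprS; ring.
have r1' : 0 < 1 - r by lra.
by rewrite -[leRHS]mul1r ler_pdivlMr // mulrC h lerBlDr lerDl exprn_ge0.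
Qed.

(** The sum of the Dirichlet kernels is $|\sum_{j<J}e^{ij\theta}|^2$. *)
Lemma fejer_ge0 (th : R) J :
  0 <= \sum_(m < J) (1 + 2 * \sum_(j < m) cos (j.+1%:R * th)).
Proof.
pose x n := \sum_(j < n) cos (j%:R * th); pose y n := \sum_(j < n) sin (j%:R * th).
suff -> : \sum_(m < J) (1 + 2 * \sum_(j < m) cos (j.+1%:R * th)) = x J ^+ 2 + y J ^+ 2.
  by rewrite addr_ge0 ?sqr_ge0.
elim: J => [|J IH]; first by rewrite /x /y !big_ord0 expr0n addr0.
rewrite big_ord_recr /= IH /x /y !big_ord_recr /= -/(x J) -/(y J).
have -> : \sum_(j < J) cos (j.+1%:R * th) = cos (J%:R * th) * x J + sin (J%:R * th) * y J.
  rewrite /x /y !mulr_sumr -big_split /= (reindex_inj rev_ord_inj); apply: eq_bigr => j _ /=.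
  rewrite -cosB -mulrBl; congr (cos (_ * _)).
  by rewrite subnSK // natrB // ltnW.
have := cos2Dsin2 (J%:R * th).
set a := cos _; set b := sin _ => h.
have -> : 1 + 2 * (a * x J + b * y J) = (a ^+ 2 + b ^+ 2) + 2 * (a * x J + b * y J) by rewrite h.
by ring.
Qed.

End Geometric.

(** * Estimates for the completed terms in the half-plane *)

Section Interior.
Context {R : realType}.
Local Notation C := (Cplx R).
Variables (E : nat -> seq (C * R)) (phi : nat -> R -> R) (c : R).
Hypothesis c_gt0 : 0 < c.
Hypothesis phiE : forall k t, ev (E k) (mkC 0 t) = rc (phi k t).
Hypothesis phi_ge0 : forall k t, 0 <= phi k t.
Hypothesis phi_sum : forall K t, \sum_(k < K) phi k t <= c.

Variables (q : nat -> nat) (E' : nat -> seq (C * nat)).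
Hypothesis E_E' : forall k, E k = [seq (p.1, ln p.2%:R - ln (q k)%:R) | p <- E' k].
Hypothesis E'_gt : forall k, all (fun p => (k.+1 < p.2)%N) (E' k).

Definition total_abs k : R := \sum_(p <- E k) cabs p.1.
Definition freq_bound k : R := \sum_(p <- E k) `|p.2|.
Local Notation M := total_abs.
Local Notation X := freq_bound.
Local Notation Lq := (fun k => ln (q k)%:R : R).
(** Each summand has one purpose: $1$ bounds $|w_k|$ away from $1$ uniformly in $k$; $X_k$ makes
    every frequency of $\phi_k w_k^j$, $j\ge1$, nonnegative; $k(k+M_k)$ yields [beta_small];
    $X_kM_k8^k$ makes $\phi_k w_k$ close to its boundary size up to $8^{-k}$ ([evD_E'_le]). *)
Local Notation q_bound := (fun k : nat => 1 + X k + k%:R * (k%:R + M k) + X k * M k * 8 ^+ k).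
Hypothesis q_large : forall k, q_bound k <= Lq k.

Lemma M_ge0 k : 0 <= M k. Proof. by apply: sumr_ge0 => p _; exact: cabs_ge0. Qed.
Lemma X_ge0 k : 0 <= X k. Proof. by apply: sumr_ge0. Qed.

Lemma freq_le k p : p \in E k -> `|p.2| <= X k.
Proof.
rewrite /freq_bound; elim: (E k) => // r s IH; rewrite inE big_cons => /orP[/eqP ->|/IH h].
  by rewrite lerDl sumr_ge0.
by apply: le_trans h _; rewrite lerDr.
Qed.

Lemma Lq_ge1 k : 1 <= Lq k.
Proof.
apply: le_trans (q_large k); have := X_ge0 k; have := M_ge0 k => hM hX.
have : 0 <= k%:R * (k%:R + M k) by rewrite mulr_ge0 // addr_ge0.
have : 0 <= X k * M k * 8 ^+ k by rewrite mulr_ge0 ?exprn_ge0 // mulr_ge0.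
lra.
Qed.

Lemma LqX_ge k : X k + k%:R * (k%:R + M k) <= Lq k.
Proof.
apply: le_trans (q_large k); have := X_ge0 k; have := M_ge0 k => hM hX.
have : 0 <= X k * M k * 8 ^+ k by rewrite mulr_ge0 ?exprn_ge0 // mulr_ge0.
lra.
Qed.

Lemma LqX_ge2 k : X k * M k * 8 ^+ k <= Lq k - X k.
Proof.
have := q_large k; have := M_ge0 k.
have : 0 <= k%:R * (k%:R + M k) by rewrite mulr_ge0 // addr_ge0 // M_ge0.
lra.
Qed.

Lemma q_gt1 k : (1 < q k)%N.
Proof.
rewrite -(ltr_nat R) -ltr_ln ?posrE ?ltr01 //.
  by rewrite ln1; have := Lq_ge1 k; lra.
by case: (q k) (Lq_ge1 k) => [|n]; rewrite ?ltr0n // ln0 //; lra.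
Qed.

Definition w k s : C := nat_cpowN (q k) s.

Lemma wE k s : w k s = cexp (- (s * rc (Lq k))). Proof. by []. Qed.

Lemma cabs_w k s : cabs (w k s) = expR (- (re s * Lq k)).
Proof. exact: cabs_nat_cpowN. Qed.

Lemma evD_E' k s : evD (E' k) s = ev (E k) s * w k s.
Proof.
rewrite E_E' /ev /evD big_map mulr_suml; apply: eq_bigr => p _ /=.
by rewrite -mulrA wE -cexpD nat_cpowNE rcB; congr (_ * cexp _); ring.
Qed.

Definition beta k (sigma : R) : R := M k * expR (- (sigma * (Lq k - X k))).

Lemma beta_ge0 k sigma : 0 <= beta k sigma.
Proof. by rewrite mulr_ge0 ?M_ge0 ?expR_ge0. Qed.

Lemma absD_E' k sigma : 0 <= sigma -> absD (E' k) sigma <= beta k sigma.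
Proof.
move=> s0; rewrite /absD /beta /total_abs E_E' big_map mulr_suml.
rewrite big_seq [leRHS]big_seq; apply: ler_sum => p pE /=.
rewrite ler_wpM2l ?cabs_ge0 // ler_expR lerN2 ler_wpM2l //.
have : (p.1, ln p.2%:R - ln (q k)%:R) \in E k by rewrite E_E'; apply/mapP; exists p.
move=> /freq_le /=; rewrite ler_norml => /andP[h _]; lra.
Qed.

Lemma expR1_ge2 : 2 <= expR 1 :> R.
Proof. by have := expR_ge1Dx (1 : R); lra. Qed.

Lemma expRN_nat_le k : expR (- k%:R) <= 2^-1 ^+ k :> R.
Proof.
rewrite expRN exprVn lef_pV2 ?posrE ?expR_gt0 ?exprn_gt0 //.
rewrite -[X in expR X]mulr1 expRM_natl lerXn2r ?nnegrE ?expR_ge0 //.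
exact: expR1_ge2.
Qed.

(** Once $\sigma k\ge1$, the exponent is at least $k+M_k$, and $e^{-M_k}$ absorbs the factor
    $M_k$. *)
Lemma beta_small (sigma : R) k : 0 < sigma -> sigma^-1 <= k%:R -> beta k sigma <= 2^-1 ^+ k.
Proof.
move=> s0 hk; apply: le_trans (expRN_nat_le k).
have hs : 1 <= sigma * k%:R by rewrite mulrC -ler_pdivrMr // mul1r.
have hM := M_ge0 k.
have h : - (sigma * (Lq k - X k)) <= - k%:R - M k.
  rewrite lerNl opprD !opprK.
  apply: le_trans (_ : sigma * (k%:R * (k%:R + M k)) <= _); last first.
    by apply: ler_wpM2l; [exact: ltW|have := LqX_ge k; lra].
  by rewrite mulrA ler_peMl // addr_ge0.
apply: le_trans (_ : M k * expR (- k%:R - M k) <= _).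
  by rewrite ler_wpM2l // ler_expR.
rewrite expRD mulrCA ler_piMr ?expR_ge0 // expRN ler_pdivrMr ?expR_gt0 // mul1r.
by have := expR_ge1Dx (M k); lra.
Qed.

Lemma beta_summable (sigma : R) : 0 < sigma ->
  exists B, 0 <= B /\ forall K, \sum_(k < K) beta k sigma <= B.
Proof.
move=> s0; have [K0 hK0] := nat_ge sigma^-1.
exists (\sum_(k < K0) beta k sigma + 2); split.
  by rewrite addr_ge0 // sumr_ge0 // => k _; exact: beta_ge0.
move=> K; case: (leqP K K0) => hK.
  rewrite -(subnKC hK) big_split_ord /= -addrA lerDl addr_ge0 //.
  by apply: sumr_ge0 => k _; exact: beta_ge0.
rewrite -(subnKC (ltnW hK)) big_split_ord /= lerD2l.
apply: le_trans (_ : \sum_(i < K - K0) 2^-1 ^+ (K0 + i) <= _).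
  by apply: ler_sum => i _; apply: beta_small => //; apply: hK0; rewrite leq_addr.
apply: le_trans (sum_pow2 _ _) _; rewrite -[leRHS]mulr1 ler_wpM2l //.
by apply: exprn_ile1; lra.
Qed.

Definition kap (sigma : R) : R := (1 - expR (- sigma))^-1.

Lemma expRN_lt1 (sigma : R) : 0 < sigma -> expR (- sigma) < 1.
Proof. by move=> s0; rewrite expR_lt1; lra. Qed.

Lemma kap_gt0 sigma : 0 < sigma -> 0 < kap sigma.
Proof. by move=> /expRN_lt1 h; rewrite invr_gt0; lra. Qed.

Lemma cabs_w_le k s : 0 < re s -> cabs (w k s) <= expR (- re s).
Proof. by move=> s0; rewrite cabs_w ler_expR lerN2 ler_peMr ?Lq_ge1 // ltW. Qed.

Lemma cabs_1w k s : 0 < re s -> 1 - expR (- re s) <= cabs (1 - w k s).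
Proof.
move=> s0; have := cabs_w_le k s0; have := cabsD (1 - w k s) (w k s).
by rewrite subrK cabs1; lra.
Qed.

Lemma w1_neq0 k s : 0 < re s -> 1 - w k s != 0.
Proof.
move=> s0; rewrite -cabs_gt0; apply: lt_le_trans (cabs_1w k s0).
by have := expRN_lt1 s0; lra.
Qed.

Definition F k s : C := - 2%:R * evD (E' k) s / (1 - w k s).

Lemma cabs_nat n : cabs (n%:R : C) = n%:R.
Proof. by rewrite -rc_nat cabs_rc ger0_norm. Qed.

Lemma F_le k s : 0 < re s -> cabs (F k s) <= 2 * kap (re s) * beta k (re s).
Proof.
move=> s0; rewrite /F !cabsM cabsV cabsN cabs_nat -mulrA -[leRHS]mulrA (mulrC (kap _)).
apply: ler_wpM2l => //; apply: ler_pM; rewrite ?cabs_ge0 ?invr_ge0 ?cabs_ge0 //.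
  by apply: le_trans (cabs_evD _ _) _; apply: absD_E'; exact: ltW.
rewrite /kap lef_pV2 ?posrE ?cabs_1w // ?cabs_gt0 ?w1_neq0 //.
by have := expRN_lt1 s0; lra.
Qed.

Lemma F_small s k : 0 < re s -> (re s)^-1 <= k%:R ->
  cabs (F k s) <= 2 * kap (re s) * 2^-1 ^+ k.
Proof.
move=> s0 hk; apply: le_trans (F_le k s0) _.
apply: ler_wpM2l; last exact: beta_small.
by rewrite mulr_ge0 // ltW // kap_gt0.
Qed.

Definition f s : C := xget 0 [set l | clim (fun K => \sum_(k < K) F k s) l].

Lemma f_eq s l : clim (fun K => \sum_(k < K) F k s) l -> f s = l.
Proof.
move=> hl; rewrite /f; case: xgetP => [y -> /= hy|/(_ l)]; last by [].
apply/eqP; rewrite -subr_eq0 -cabs_eq0 eq_le cabs_ge0 andbT.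
apply: le_eps => e e0; have e20 : 0 < e / 2 by lra.
have [N hN] := hl _ e20; rewrite add0r.
apply: le_trans (_ : e / 2 <= _); last lra.
apply: (clim_dist hy) => n /hN; exact.
Qed.

Lemma f_clim s : 0 < re s -> clim (fun K => \sum_(k < K) F k s) (f s).
Proof.
move=> s0; have [K0 hK0] := nat_ge (re s)^-1.
have [|l hl] := @geo_test _ (fun k => F k s) (2 * kap (re s)) K0.
  by move=> k /hK0; exact: F_small.
by rewrite (f_eq hl).
Qed.

Lemma f_tail s K : 0 < re s -> (re s)^-1 <= K%:R ->
  cabs (f s - \sum_(k < K) F k s) <= 4 * kap (re s) * 2^-1 ^+ K.
Proof.
move=> s0 hK.
have := @geo_tail _ (fun k => F k s) (2 * kap (re s)) K _ (f_clim s0) _ K (leqnn _).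
rewrite mulrA -natrM; apply => k hk; apply: F_small => //.
by apply: le_trans hK _; rewrite ler_nat.
Qed.

(** * The Dirichlet series of [f] *)

Definition block k j : seq (C * nat) := [seq (- 2%:R * p.1, (p.2 * q k ^ j)%N) | p <- E' k].
(** The double series obtained from $F_k=\sum_j(-2)\phi_k w_k^{j+1}$, cut to the square $k,j<K$.
    Indices in [block k j] exceed both [k.+1] and [j], so index $n$ is met only for $k,j<n$ and
    coefficients stabilise. *)
Definition L K : seq (C * nat) :=
  flatten [seq flatten [seq block k j | j <- iota 0 K] | k <- iota 0 K].

Lemma big_L (V : nmodType) (G : C * nat -> V) (P : pred (C * nat)) K :
  \sum_(p <- L K | P p) G p = \sum_(k < K) \sum_(j < K) \sum_(p <- block k j | P p) G p.
Proof.
rewrite big_flatten big_map.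
rewrite -(big_mkord xpredT (fun k => \sum_(j < K) \sum_(p <- block k j | P p) G p)).
rewrite /index_iota subn0; apply: eq_bigr => k _.
rewrite big_flatten big_map.
rewrite -(big_mkord xpredT (fun j => \sum_(p <- block k j | P p) G p)).
by rewrite /index_iota subn0.
Qed.

Lemma block_gt k j p : p \in block k j -> (k.+1 < p.2)%N /\ (j < p.2)%N.
Proof.
move=> /mapP[r /(allP (E'_gt k)) hr ->] /=.
have hq : (0 < q k ^ j)%N by rewrite expn_gt0 (ltnW (q_gt1 k)).
split; first by apply: leq_trans hr _; rewrite leq_pmulr.
apply: leq_trans (ltn_expl j (q_gt1 k)) _; rewrite leq_pmull //.
exact: leq_trans hr.
Qed.

Lemma L_ge2 K : all (fun p => (1 < p.2)%N) (L K).
Proof.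
apply/allP => p /flatten_mapP[k _ /flatten_mapP[j _ /block_gt[h _]]].
exact: leq_ltn_trans h.
Qed.

Lemma coef_block k j n : (n <= k)%N || (n <= j)%N -> coef (block k j) n = 0.
Proof.
move=> h; rewrite /coef big_seq_cond big1 // => p /andP[/block_gt[h1 h2] /eqP e].
rewrite e in h1 h2; case/orP: h => h.
  by have := leq_trans (ltnW h1) h; rewrite ltnn.
by have := leq_trans h2 h; rewrite ltnn.
Qed.

Lemma L_stable K n : (0 < n <= K)%N -> coef (L K) n = coef (L n) n.
Proof.
move=> /andP[_ hn]; rewrite /coef !big_L -/(coef _ _).
rewrite [RHS](big_ord_widen K (fun k => \sum_(j < n) coef (block k j) n) hn).
rewrite [RHS]big_mkcond; apply: eq_bigr => k _.
case: ltnP => hk; last first.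
  by rewrite big1 // => j _; rewrite -/(coef _ _) coef_block ?hk.
rewrite [RHS](big_ord_widen K (fun j => coef (block k j) n) hn) [RHS]big_mkcond.
apply: eq_bigr => j _; case: ltnP => hj //.
by rewrite -/(coef _ _) coef_block ?hj ?orbT.
Qed.

Lemma evD_block k j s : evD (block k j) s = - 2%:R * evD (E' k) s * w k s ^+ j.
Proof.
rewrite /evD big_map mulr_sumr mulr_suml big_seq [RHS]big_seq; apply: eq_bigr => p pE /=.
have hq := ltnW (q_gt1 k).
have p0 : (0 < p.2)%N by apply: leq_trans (allP (E'_gt k) _ pE).
rewrite nat_cpowNM ?expn_gt0 ?hq //.
suff -> : nat_cpowN (q k ^ j) s = w k s ^+ j by ring.
elim: j => [|j IH]; first by rewrite expn0 nat_cpowNE ln1 rc0 mulr0 oppr0 cexp0.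
by rewrite expnS nat_cpowNM ?expn_gt0 ?hq // IH exprS.
Qed.

Lemma absD_block k j sigma : 0 <= sigma -> absD (block k j) sigma <= 2 * beta k sigma * expR (- sigma) ^+ j.
Proof.
move=> s0; apply: le_trans (_ : 2 * absD (E' k) sigma * expR (- sigma) ^+ j <= _); last first.
  by rewrite ler_wpM2r ?exprn_ge0 ?expR_ge0 // ler_wpM2l // absD_E'.
rewrite /absD big_map mulr_sumr mulr_suml big_seq [leRHS]big_seq; apply: ler_sum => p pE /=.
have hq := ltnW (q_gt1 k).
have p0 : (0 < p.2)%N by apply: leq_trans (allP (E'_gt k) _ pE).
rewrite natrM lnM ?posrE ?ltr0n ?expn_gt0 ?hq // natrX lnXn ?ltr0n //.
rewrite cabsM cabsN cabs_nat -!mulrA ler_wpM2l // ler_wpM2l ?cabs_ge0 //.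
rewrite mulrDr opprD expRD ler_wpM2l ?expR_ge0 // -expRM_natl ler_expR.
by rewrite mulrN lerN2 mulrC ler_wpM2l // -[leRHS]mulr_natl ler_peMr // Lq_ge1.
Qed.

Lemma L_bound sigma : 0 < sigma -> exists B, forall K, absD (L K) sigma <= B.
Proof.
move=> s0; have [B [B0 hB]] := beta_summable s0.
exists (2 * B * kap sigma) => K; rewrite /absD big_L.
apply: le_trans (_ : \sum_(k < K) 2 * beta k sigma * kap sigma <= _); last first.
  by rewrite -mulr_suml -mulr_sumr ler_wpM2r ?(ltW (kap_gt0 s0)) // ler_wpM2l.
apply: ler_sum => k _.
apply: le_trans (_ : \sum_(j < K) 2 * beta k sigma * expR (- sigma) ^+ j <= _).
  by apply: ler_sum => j _; apply: absD_block; exact: ltW.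
rewrite -mulr_sumr; apply: ler_wpM2l; first by rewrite mulr_ge0 ?beta_ge0.
by apply: geom_sum_le; rewrite ?expR_ge0 ?expRN_lt1.
Qed.

Lemma evD_L K s : 0 < re s -> evD (L K) s = \sum_(k < K) F k s * (1 - w k s ^+ K).
Proof.
move=> s0; rewrite /evD big_L; apply: eq_bigr => k _.
under eq_bigr do rewrite -/(evD _ _) evD_block.
by rewrite -mulr_sumr /F -geom_sum mulrA divfK // w1_neq0.
Qed.

(** Besides the tail of $\sum F_k$, cutting the geometric series costs
    $\sum_{k<K}F_kw_k^K=O(e^{-\sigma K})$. All bounds depend on the real part only, hence the
    uniformity in [t]. *)
Lemma L_cvg sigma e : 0 < sigma -> 0 < e -> exists K0, forall K,
  (K0 <= K)%N -> forall t, cabs (evD (L K) (mkC sigma t) - f (mkC sigma t)) <= e.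
Proof.
move=> s0 e0; have e20 : 0 < e / 2 by lra.
have [B [B0 hB]] := beta_summable s0.
have [K1 h1] := nat_ge sigma^-1.
have [K2 h2] := pow2_small (4 * kap sigma) e20.
have [K3 h3] := pow2_small (2 * kap sigma * B) (mulr_gt0 e20 s0).
have [K4 h4] := nat_ge ((2 * kap sigma * B) / (e / 2) / sigma).
exists (maxn (maxn K1 K2) K4) => K; rewrite !geq_max -andbA => /and3P[k1 k2 k4] t.
set s := mkC sigma t; have s0' : 0 < re s by [].
rewrite evD_L //.
under eq_bigr do rewrite mulrBr mulr1.
rewrite sumrB addrAC; apply: le_trans (cabsB _ _) _; rewrite [leRHS]splitr lerD //.
  rewrite cabs_distC; apply: le_trans (f_tail s0' (h1 _ k1)) _; exact: h2.
apply: le_trans (cabs_sum _ _ _) _.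
apply: le_trans (_ : \sum_(k < K) (2 * kap sigma * beta k sigma) * expR (- sigma) ^+ K <= _).
  apply: ler_sum => k _; rewrite cabsM cabsX ler_pM ?cabs_ge0 ?exprn_ge0 ?cabs_ge0 //.
    exact: (F_le k s0').
  by rewrite lerXn2r ?nnegrE ?cabs_ge0 ?expR_ge0 // (cabs_w_le k s0').
rewrite -mulr_suml -mulr_sumr.
apply: le_trans (_ : (2 * kap sigma * B) * expR (- sigma) ^+ K <= _).
  apply: ler_wpM2r; first by rewrite exprn_ge0 ?expR_ge0.
  by apply: ler_wpM2l; [rewrite mulr_ge0 // ltW // kap_gt0|exact: hB].
rewrite -expRM_natl mulrN expRN ler_pdivrMr ?expR_gt0 //.
have := h4 K k4; rewrite ler_pdivrMr // ler_pdivrMr // => /le_trans; apply.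
rewrite mulrC ler_wpM2l ?(ltW e20) //.
by have := expR_ge1Dx (K%:R * sigma); lra.
Qed.

(** * Comparison with Poisson extensions *)

Definition V k sigma t : R := re_ev (poisson sigma (E k)) t.

Lemma re_ev_E k t : re_ev (E k) t = phi k t.
Proof. by rewrite /re_ev phiE re_rc. Qed.

Lemma V_ge0 k sigma t : 0 <= sigma -> 0 <= V k sigma t.
Proof. by move=> s0; apply: poisson_ge0 => // u; rewrite re_ev_E. Qed.

Lemma poisson_cat (A B : seq (C * R)) sigma t :
  re_ev (poisson sigma (A ++ B)) t = re_ev (poisson sigma A) t + re_ev (poisson sigma B) t.
Proof. by rewrite /poisson /multE map_cat re_ev_cat. Qed.

Lemma poisson_scal (r : R) (A : seq (C * R)) sigma t :
  re_ev (poisson sigma (scalE (rc r) A)) t = r * re_ev (poisson sigma A) t.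
Proof.
rewrite -re_ev_scal; congr (re_ev _ t); rewrite /poisson /multE /scalE -!map_comp.
by apply: eq_map => p /=; rewrite mulrA.
Qed.

Lemma re_ev_flatten (A : nat -> seq (C * R)) K t :
  re_ev (flatten [seq A k | k <- iota 0 K]) t = \sum_(k < K) re_ev (A k) t.
Proof.
rewrite -(big_mkord xpredT (fun k => re_ev (A k) t)) /index_iota subn0.
elim: (iota 0 K) => [|k s IH]; first by rewrite /re_ev ev_nil big_nil.
by rewrite /= re_ev_cat IH big_cons.
Qed.

Lemma mean_flatten (A : nat -> seq (C * R)) K :
  mean (flatten [seq A k | k <- iota 0 K]) = \sum_(k < K) mean (A k).
Proof.
rewrite -(big_mkord xpredT (fun k => mean (A k))) /index_iota subn0.
elim: (iota 0 K) => [|k s IH]; first by rewrite /mean !big_nil.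
by rewrite /= mean_cat IH big_cons.
Qed.

Lemma poisson_flatten (A : nat -> seq (C * R)) sigma K t :
  re_ev (poisson sigma (flatten [seq A k | k <- iota 0 K])) t = \sum_(k < K) re_ev (poisson sigma (A k)) t.
Proof.
rewrite -(re_ev_flatten (fun k => poisson sigma (A k))); congr (re_ev _ t).
rewrite /poisson /multE map_flatten.
by rewrite -map_comp.
Qed.

(** Positivity of the Poisson extension is applied to $c-\sum_{k<K}\phi_k\ge0$; the multiplier is
    $1$ at frequency $0$ and keeps the constant. *)
Lemma V_sum sigma t K : 0 <= sigma -> \sum_(k < K) V k sigma t <= c.
Proof.
move=> s0.
pose W := [:: (rc c, 0)] ++ scalE (rc (-1)) (flatten [seq E k | k <- iota 0 K]).
have : 0 <= re_ev (poisson sigma W) t.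
  apply: poisson_ge0 => // u; rewrite /W re_ev_cat re_ev_scal re_ev_flatten.
  rewrite {1}/re_ev ev_const re_rc mulN1r subr_ge0.
  by under eq_bigr do rewrite re_ev_E.
rewrite /W poisson_cat poisson_scal poisson_flatten mulN1r.
rewrite {1}/re_ev /poisson /multE /= normr0 mulr0 oppr0 expR0 mulr1 ev_const re_rc.
by rewrite subr_ge0.
Qed.

Lemma reZ (a : R) (z : C) : re (rc a * z) = a * re z.
Proof. by rewrite reM re_rc im_rc mul0r subr0. Qed.

Lemma F_ev k s : F k s = - 2%:R * ev (E k) s * w k s / (1 - w k s).
Proof. by rewrite /F evD_E' !mulrA. Qed.

(* Tested against the Fejer kernel of the dilated circle, [phi k >= 0] shows that
   [phi k] minus its product with the Dirac comb on [(2 pi / Lq k) Z], whose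
   analytic completion is [F k], lies below [phi k]. *)
Lemma F_le_V k sigma t : 0 < sigma -> re (F k (mkC sigma t)) <= V k sigma t.
Proof.
move=> s0; set s := mkC sigma t; have s0' : 0 < re s by [].
pose dir m : seq (C * R) := [seq (2%:R, j.+1%:R * Lq k) | j <- iota 0 m].
pose W J := flatten [seq (E k ++ mulE (E k) (dir m)) | m <- iota 0 J].
have dirE m z : ev (dir m) z = \sum_(j < m) 2%:R * cexp (- (z * rc (j.+1%:R * Lq k))).
  rewrite /ev big_map -(big_mkord xpredT (fun j => 2%:R * cexp (- (z * rc (j.+1%:R * Lq k))))).
  by rewrite /index_iota subn0.
have W0 J u : 0 <= re_ev (W J) u.
  rewrite /W re_ev_flatten.
  have -> : \sum_(m < J) re_ev (E k ++ mulE (E k) (dir m)) u =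
      phi k u * \sum_(m < J) (1 + 2 * \sum_(j < m) cos (j.+1%:R * (u * Lq k))).
    rewrite mulr_sumr; apply: eq_bigr => m _.
    rewrite re_ev_cat re_ev_E {1}/re_ev ev_mul phiE reM re_rc im_rc mul0r subr0 mulrDr mulr1.
    congr (_ + _ * _); rewrite dirE re_sum mulr_sumr; apply: eq_bigr => j _.
    rewrite reM -rc_nat re_rc im_rc mul0r subr0 cexp_it re_mkC.
    by congr (_ * cos _); ring.
  by rewrite mulr_ge0 ?fejer_ge0.
have PW J : re_ev (poisson sigma (W J)) t =
    J%:R * (V k sigma t - re (F k s)) + \sum_(m < J) re (F k s * w k s ^+ m).
  rewrite /W poisson_flatten.
  rewrite (eq_bigr (fun m : 'I_J => (V k sigma t - re (F k s)) + re (F k s * w k s ^+ m))); last first.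
    move=> m _; rewrite poisson_cat -/(V _ _ _) -addrA; congr (_ + _).
    have -> : re_ev (poisson sigma (mulE (E k) (dir m))) t = re (ev (mulE (E k) (dir m)) s).
      rewrite re_ev_mult /ev re_sum big_seq [RHS]big_seq; apply: eq_bigr => _ /allpairsP[[p r] /= [pE rE ->]] /=.
      (* All frequencies of the product with the comb are nonnegative, because those of [E k] are at
         least [- X k] and [X k <= Lq k]. On such sums the Poisson extension is the real part of the
         analytic continuation. *)
      have h0 : 0 <= p.2 + r.2.
        have /mapP[j _ ->] /= := rE.
        have := freq_le pE; rewrite ler_norml => /andP[h _].
        have h2 : X k <= Lq k.
          by apply: le_trans (LqX_ge k); rewrite lerDl mulr_ge0 // addr_ge0 // M_ge0.
        have : Lq k <= j.+1%:R * Lq k.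
          by rewrite ler_peMl ?ler1n //; have := Lq_ge1 k; lra.
        by lra.
      by rewrite (ger0_norm h0) cexp_it /s cexp_mkC -reZ mulrCA.
    rewrite ev_mul dirE -reN -reD; congr re.
    have -> : \sum_(j < m) 2%:R * cexp (- (s * rc (j.+1%:R * Lq k))) = 2%:R * w k s * \sum_(j < m) w k s ^+ j.
      rewrite mulr_sumr; apply: eq_bigr => j _; rewrite -mulrA; congr (_ * _).
      rewrite -exprS wE -cexpMn; congr cexp; rewrite rcM rc_nat -mulr_natl; ring.
    rewrite F_ev; apply: (mulfI (w1_neq0 k s0')).
    set G := \sum_(j < m) _.
    have -> : (1 - w k s) * (ev (E k) s * (2%:R * w k s * G)) = ev (E k) s * 2%:R * w k s * ((1 - w k s) * G) by ring.
    rewrite geom_sum.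
    by field; exact: w1_neq0.
  by rewrite big_split /= sumr_const card_ord -[X in X + _]mulr_natl.
(* In [PW] the last sum stays bounded in [J], so dividing the nonnegative total by [J] leaves the
   difference in the limit. *)
apply: (@le_div_nat _ _ _ (cabs (F k s) * kap sigma)); exists 1%N => J J0.
have J0' : (0 : R) < J%:R by rewrite ltr0n.
have := poisson_ge0 (ltW s0) (W0 J) t; rewrite PW => h.
have h2 : \sum_(m < J) re (F k s * w k s ^+ m) <= cabs (F k s) * kap sigma.
  apply: le_trans (_ : \sum_(m < J) cabs (F k s) * expR (- sigma) ^+ m <= _).
    apply: ler_sum => m _; apply: le_trans (ler_norm _) _; apply: le_trans (cabs_re _) _.
    rewrite cabsM cabsX ler_wpM2l ?cabs_ge0 // lerXn2r ?nnegrE ?cabs_ge0 ?expR_ge0 //.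
    exact: (cabs_w_le k s0').
  rewrite -mulr_sumr ler_wpM2l ?cabs_ge0 // geom_sum_le ?expR_ge0 ?expRN_lt1 //.
rewrite -lerBlDl ler_pdivlMr //; lra.
Qed.

Lemma re_sum_F_le_V K sigma t : 0 < sigma ->
  re (\sum_(k < K) F k (mkC sigma t)) <= \sum_(k < K) V k sigma t.
Proof. by move=> s0; rewrite re_sum; apply: ler_sum => k _; exact: F_le_V. Qed.

Lemma re_f_le s : 0 < re s -> re (f s) <= c.
Proof.
move=> s0; apply: (clim_re_le (N := 0) (f_clim s0)) => K _.
rewrite -(mkCE s); apply: le_trans (re_sum_F_le_V K _ s0) _.
by apply: V_sum; exact: ltW.
Qed.

(** * The function [g] and its coefficients *)

Definition g s : C := cexp (f s - rc c).
Definition acoef n : C := rc (expR (- c)) * exp_coefs L n.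

Lemma gE s : g s = rc (expR (- c)) * cexp (f s).
Proof. by rewrite /g addrC cexpD -rcN cexp_rc. Qed.

Lemma g_neq0 s : g s != 0. Proof. exact: cexp_neq0. Qed.

Lemma g_le1 s : 0 < re s -> cabs (g s) <= 1.
Proof.
by move=> s0; rewrite cabs_cexp -expR0 ler_expR reD reN re_rc subr_le0 re_f_le.
Qed.

Lemma acoef_cvg (sigma e : R) : 0 < sigma -> 0 < e ->
  exists N0, forall N, (N0 <= N)%N -> forall t,
  cabs (\sum_(1 <= n < N.+1) acoef n * nat_cpowN n (mkC sigma t) - g (mkC sigma t)) <= e.
Proof.
move=> s0 e0.
have [N0 h] := exp_coefs_cvg L_ge2 L_stable L_bound L_cvg s0 (mulr_gt0 e0 (expR_gt0 c)).
exists N0 => N hN t; have := h N hN t.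
rewrite gE /acoef; under [in X in _ -> X]eq_bigr do rewrite -mulrA.
rewrite -mulr_sumr -mulrBr cabsM cabs_rc ger0_norm ?expR_ge0 // => {}h.
by rewrite expRN mulrC ler_pdivrMr ?expR_gt0.
Qed.

Lemma acoef_clim s : 0 < re s ->
  clim (fun N => \sum_(1 <= n < N.+1) acoef n * nat_cpowN n s) (g s).
Proof.
move=> s0 e e0; have [N0 h] := acoef_cvg s0 e0; exists N0 => N hN.
by have := h N hN (im s); rewrite mkCE.
Qed.

Lemma acoef_bound sigma : 0 < sigma -> exists B, forall N,
  \sum_(1 <= n < N.+1) cabs (acoef n) * expR (- (sigma * ln n%:R)) <= B.
Proof.
move=> s0; have [B hB] := exp_coefs_bound L_ge2 L_stable L_bound s0.
exists (expR (- c) * B) => N.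
apply: le_trans (ler_wpM2l (expR_ge0 _) (hB N)).
rewrite mulr_sumr; apply: ler_sum => n _.
by rewrite cabsM cabs_rc ger0_norm ?expR_ge0 // mulrA.
Qed.

Lemma g_derivable s : 0 < re s -> derivable g s 1.
Proof. exact: (dirichlet_derivable acoef_bound acoef_clim). Qed.

(** * The square norm of the coefficients *)

Lemma mean_mul_conj (P : seq (C * R)) : uniq [seq p.2 | p <- P] ->
  mean (mulE P (conjE P)) = \sum_(p <- P) cabs p.1 ^+ 2.
Proof.
move=> hP; rewrite /mean big_allpairs_dep big_seq [RHS]big_seq; apply: eq_bigr => p pP.
rewrite big_map (bigD1_seq p) //=; last exact: map_uniq hP.
rewrite addrN eqxx mulr1 mulC_conj re_rc big_seq_cond big1 ?addr0 // => r /andP[rP rp].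
rewrite subr_eq0; case: eqP => [e|]; last by rewrite mulr0.
case/negP: rp; apply/eqP.
have [i hi er] := nthP p rP; have [j hj ep] := nthP p pP.
have ij : i = j.
  apply/eqP; rewrite -(nth_uniq p.2 _ _ hP) ?size_map // !(nth_map p) // er ep.
  exact/eqP.
by rewrite -er ij ep.
Qed.

(** On the line of abscissa $\sigma$ the weighted square sum is the mean of $|p|^2$ for a partial
    sum $p$ close to $g$. Pointwise $|g|^2$ is nearly at most $e^{2(V-c)}$ with
    $V=\sum_{k<K}V_k\in[0,c]$, and convexity makes this linear in $V$. The mean of $V$ equals that
    of $\sum_{k<K}\phi_k$, whatever $\sigma$ is, so $\sigma$ can tend to $0$. *)
Lemma norm2_partial (delta : R) : (forall K, \sum_(k < K) mean (E k) <= delta) ->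
  forall N, \sum_(1 <= n < N.+1) cabs (acoef n) ^+ 2 <= expR (- (2 * c)) + delta / c.
Proof.
move=> hdelta N.
set T := expR (- (2 * c)) + delta / c.
suff key (sigma eta : R) : 0 < sigma -> 0 < eta -> eta <= 1 ->
    \sum_(1 <= n < N.+1) cabs (acoef n) ^+ 2 * expR (- (sigma * ln n%:R)) ^+ 2 <= T + 36 * eta.
  have T0 (eta : R) : 0 < eta -> eta <= 1 -> 0 <= T + 36 * eta.
    move=> e0 e1; apply: le_trans (key 1 eta ltr01 e0 e1).
    by apply: sumr_ge0 => n _; rewrite mulr_ge0 ?sqr_ge0.
  apply: le_eps => e e0.
  pose eta := Num.min 1 (e / 72).
  have eta0 : 0 < eta by rewrite lt_min ltr01 divr_gt0.
  have eta1 : eta <= 1 by rewrite ge_min lexx.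
  have eta2 : eta <= e / 72 by rewrite ge_min lexx orbT.
  have TT := T0 eta eta0 eta1.
  have lnN := @ln_nat_ge0 R N.
  pose Z := T + 36 * eta.
  pose y := e / 2 / (1 + Z).
  have Z1 : 0 < 1 + Z by rewrite /Z; lra.
  have y0 : 0 < y by rewrite !divr_gt0.
  (* Chosen so that removing the weights costs at most $N^{2\sigma}\le 1+y$; the $1+$ in the last
     denominator covers $\ln N=0$. *)
  pose sigma := ln (1 + y) / 2 / (1 + ln N%:R).
  have lny : 0 < ln (1 + y) by rewrite ln_gt0 // ltrDl.
  have s0 : 0 < sigma by rewrite !divr_gt0 //; lra.
  have hs : expR (2 * (sigma * ln N%:R)) <= 1 + y.
    rewrite -[leRHS]lnK ?posrE; last lra.
    rewrite ler_expR /sigma.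
    have -> : 2 * (ln (1 + y) / 2 / (1 + ln N%:R) * ln N%:R) = ln (1 + y) * (ln N%:R / (1 + ln N%:R)).
      by field; rewrite gt_eqF //; lra.
    by rewrite ler_piMr ?(ltW lny) // ler_pdivrMr; lra.
  apply: le_trans (_ : (T + 36 * eta) * expR (2 * (sigma * ln N%:R)) <= _).
    rewrite -ler_pdivrMr ?expR_gt0 // -expRN.
    apply: le_trans (key sigma eta s0 eta0 eta1).
    rewrite mulr_suml !big_nat; apply: ler_sum => n /andP[n1 n2].
    rewrite ler_wpM2l ?sqr_ge0 // -expRM_natl ler_expR mulrN lerN2 ler_wpM2l // ler_wpM2l ?(ltW s0) //.
    by rewrite ler_ln ?posrE ?ltr0n // ?ler_nat // (leq_trans n1).
  apply: le_trans (ler_wpM2l TT hs) _; rewrite -/Z mulrDr mulr1.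
  have : Z * y <= e / 2.
    by rewrite /y mulrCA ler_piMr ?divr_ge0 // ?(ltW e0) // ler_pdivrMr // mul1r lerDr.
  by rewrite /Z; lra.
move=> s0 eta0 eta1.
have [K0 hK0] := nat_ge sigma^-1.
have [K1 hK1] := pow2_small (4 * kap sigma) eta0.
set K := maxn K0 K1.
have [N1 hN1] := acoef_cvg s0 eta0.
set N' := maxn N N1.
pose P : seq (C * R) := [seq (acoef n * rc (expR (- (sigma * ln n%:R))), ln n%:R) | n <- index_iota 1 N'.+1].
(* [W] represents $e^{-2c}+36\eta+V/c-|p|^2$. Its pointwise nonnegativity becomes, through
   [mean_ge0] and Parseval's identity, the inequality for the coefficients. *)
pose W := [:: (rc (expR (- (2 * c)) + 36 * eta), 0)] ++
  (scalE (rc c^-1) (flatten [seq poisson sigma (E k) | k <- iota 0 K]) ++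
   scalE (rc (-1)) (mulE P (conjE P))).
have PE t : ev P (mkC 0 t) = \sum_(1 <= n < N'.+1) acoef n * nat_cpowN n (mkC sigma t).
  rewrite /ev big_map; apply: eq_bigr => n _ /=.
  by rewrite nat_cpowNE cexp_it cexp_mkC mulrA.
have : 0 <= mean W.
  apply: mean_ge0 => t; rewrite /W !re_ev_cat !re_ev_scal re_ev_flatten.
  rewrite {1}/re_ev ev_const re_rc {2}/re_ev ev_mul_conj re_rc PE mulN1r.
  set VK := \sum_(k < K) _; set s := mkC sigma t; have s0' : 0 < re s by [].
  have VK0 : 0 <= VK by apply: sumr_ge0 => k _; apply: V_ge0; exact: ltW.
  have VKc : VK <= c by apply: V_sum; exact: ltW.
  set S := \sum_(k < K) F k s.
  have SV : re S <= VK by exact: re_sum_F_le_V.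
  have Sf : cabs (f s - S) <= eta.
    apply: le_trans (f_tail s0' _) _; first by apply: hK0; rewrite leq_maxl.
    by apply: hK1; rewrite leq_maxr.
  set z := cexp (S - rc c).
  have z1 : cabs z <= 1.
    by rewrite cabs_cexp -expR0 ler_expR reD reN re_rc; lra.
  have zV : cabs z ^+ 2 <= expR (- (2 * c)) + VK / c.
    rewrite cabs_cexp -expRM_natl reD reN re_rc.
    have lam0 : 0 <= VK / c by rewrite divr_ge0 // ltW.
    have lam1 : VK / c <= 1 by rewrite ler_pdivrMr // mul1r.
    apply: le_trans (_ : expR (2 * (VK - c)) <= _).
      by rewrite ler_expR ler_wpM2l // lerD2r.
    (* Convexity of the exponential between $-2c$ and $0$, with weight $V_K/c$ at $0$. *)
    have cv : expR (2 * (VK - c)) <= (1 - VK / c) * expR (- (2 * c)) + (VK / c) * 1.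
      have := @convex_expR R (Itv01 lam0 lam1) 0 (- (2 * c)).
      rewrite !convRE /= expR0 /unstable.onem mulr0 add0r => h.
      have -> : 2 * (VK - c) = (1 - VK / c) * - (2 * c) by field; rewrite gt_eqF.
      by rewrite [leRHS]addrC.
    apply: le_trans cv _; rewrite mulr1 lerD2r ler_piMl ?expR_ge0 //; lra.
  have gz : cabs (g s - z) <= 4 * eta.
    have e3 : expR 1 <= 4 :> R.
      have h1 := expR_ge1Dx (- 2^-1 : R); have h2 := expR_gt0 (2^-1 : R).
      have h3 : expR 2^-1 * expR (- 2^-1) = 1 :> R by rewrite -expRD subrr expR0.
      have -> : expR 1 = expR 2^-1 ^+ 2 :> R by rewrite -expRM_natl divff.
      nra.
    have := @cexp_dist_le _ (f s - rc c) (S - rc c) 0.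
    have -> : f s - rc c - (S - rc c) = f s - S by ring.
    rewrite expR0 mul1r => h.
    apply: le_trans (h _ _) _; last by rewrite ler_pM ?expR_ge0 ?cabs_ge0.
      by rewrite reD reN re_rc; lra.
    by apply: le_trans Sf _.
  have := hN1 N' (leq_maxr _ _) t; rewrite -/s.
  set p := \sum_(1 <= n < N'.+1) _ => pg.
  have pz : cabs p <= cabs z + 5 * eta.
    have := cabsD (p - g s) (g s - z + z); rewrite subrK subrK.
    by have := cabsD (g s - z) z; rewrite subrK; lra.
  (* $(|z|+5\eta)^2\le|z|^2+10\eta+25\eta^2$ since $|z|\le1$, and $\eta\le1$; this is below
     $|z|^2+36\eta$. *)
  have p2 : cabs p ^+ 2 <= cabs z ^+ 2 + 36 * eta.
    have := cabs_ge0 p; have := cabs_ge0 z; nra.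
  rewrite (mulrC c^-1); lra.
rewrite /W !mean_cat !mean_scal mean_flatten mean_mul_conj; last first.
  rewrite -map_comp map_inj_in_uniq ?iota_uniq // => n m.
  rewrite !mem_index_iota /= => /andP[n1 _] /andP[m1 _] e.
  by apply/eqP; rewrite -(eqr_nat R); apply/eqP/ln_inj; rewrite ?posrE ?ltr0n.
rewrite big_map /mean big_seq1 /= eqxx mulr1 -/(mean _).
have mP k : mean (poisson sigma (E k)) = mean (E k).
  by rewrite /poisson mean_mult // normr0 mulr0 oppr0 expR0.
under eq_bigr => k _ do rewrite -/(mean _) mP.
set Sm := \sum_(k < K) _; set SN := \sum_(1 <= n < N'.+1) _ => h.
have : SN = \sum_(1 <= n < N'.+1) cabs (acoef n) ^+ 2 * expR (- (sigma * ln n%:R)) ^+ 2.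
  by apply: eq_bigr => n _; rewrite cabsM cabs_rc ger0_norm ?expR_ge0 // exprMn.
move=> SNE; apply: le_trans (_ : SN <= _).
  rewrite SNE [leRHS](big_cat_nat (n := N.+1)) //= ?ltnS ?leq_maxl // lerDl.
  by apply: sumr_ge0 => n _; rewrite mulr_ge0 ?sqr_ge0.
have : c^-1 * Sm <= delta / c by rewrite mulrC ler_wpM2r ?invr_ge0 ?(ltW c_gt0) // hdelta.
by rewrite /T; lra.
Qed.

(** * Points of the axis away from the poles *)

Lemma cos_nat2pi (x : R) n : cos (x - n%:R * (2 * pi)) = cos x.
Proof.
have h2 : cos (2 * pi) = 1 :> R /\ sin (2 * pi) = 0 :> R.
  by split; rewrite mulr_natl ?cos2pi ?sin2pi.
have hs : cos (n%:R * (2 * pi)) = 1 :> R /\ sin (n%:R * (2 * pi)) = 0 :> R.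
  case: h2 => h2 h3; elim: n => [|n [IH1 IH2]]; first by rewrite mul0r cos0 sin0.
  by rewrite -natr1 mulrDl mul1r cosD sinD IH1 IH2 h2 h3; split; ring.
by rewrite cosB hs.1 hs.2 mulr1 mulr0 addr0.
Qed.

(** [n] is the integer nearest to $|\theta|/2\pi$. Working with $|\theta|$ keeps it natural; both
    signs of $t$ are recovered by [sym_itv]. *)
Lemma mod_2pi (th : R) : exists n : nat,
  `| `|th| - n%:R * (2 * pi)| <= pi /\ cos `| `|th| - n%:R * (2 * pi)| = cos th.
Proof.
have p0 := pi_gt0 R.
pose n := Num.trunc (`|th| / (2 * pi) + 2^-1).
exists n; rewrite cos_norm cos_nat2pi cos_norm; split => //.
have x0 : 0 <= `|th| / (2 * pi) + 2^-1.
  by rewrite addr_ge0 ?invr_ge0 // divr_ge0 // mulr_ge0 // ltW.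
have /andP[h1 h2] := truncn_itv x0.
rewrite -/n in h1 h2.
have e : `|th| = `|th| / (2 * pi) * (2 * pi) by rewrite divfK // mulf_neq0 // gt_eqF.
set u := `|th| / (2 * pi) in h1 h2 e.
rewrite e -mulrBl normrM (ger0_norm (x := 2 * pi)); last by rewrite mulr_ge0 // ltW.
have : `|u - n%:R| <= 2^-1.
  by rewrite ler_norml; apply/andP; split; move: h2; rewrite -(natr1 n); lra.
move=> h; apply: le_trans (ler_wpM2r _ h) _; first by rewrite mulr_ge0 // ltW.
by rewrite mulrA mulVf // mul1r.
Qed.

Lemma cos_near1 (th d : R) : 0 < d -> d <= 2^-1 -> 1 - d ^+ 2 / 2 < cos th ->
  exists n : nat, `| `|th| - n%:R * (2 * pi)| <= 2 * d.
Proof.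
move=> d0 d1 h; have [n [h1 h2]] := mod_2pi th; exists n.
set y := `|_ - _| in h1 h2 *.
rewrite leNgt; apply/negP => hy.
have p2 := pi_ge2 R.
have : cos y < cos (2 * d).
  have i1 : y \in `[0, pi] by rewrite in_itv /= normr_ge0 h1.
  have i2 : 2 * d \in `[0, pi] by rewrite in_itv /=; apply/andP; split; lra.
  by rewrite (ltr_cos i2 i1).
rewrite h2 => h3.
have : cos (2 * d) = 1 - 2 * sin d ^+ 2.
  by rewrite mulr_natl cos_mulr2n cos2sin2; ring.
have := @sin_sub_le _ d; rewrite ger0_norm ?(ltW d0) // => /(_ ltac:(lra)).
rewrite ler_norml => /andP[h4 _] h5.
have : d / 2 <= sin d by nra.
nra.
Qed.

Lemma cos_eq1 (th : R) : cos th = 1 -> exists n : nat, `|th| = n%:R * (2 * pi).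
Proof.
move=> h; have [n [h1 h2]] := mod_2pi th; exists n.
set y := `|_ - _| in h1 h2.
have y0 : 0 <= y by exact: normr_ge0.
suff : y = 0 by rewrite /y => /eqP; rewrite normr_eq0 subr_eq0 => /eqP.
apply/eqP; rewrite eq_le y0 andbT leNgt; apply/negP => yp.
have p2 := pi_ge2 R.
have : cos y < cos 0.
  have i1 : y \in `[0, pi] by rewrite in_itv /= y0 h1.
  have i2 : (0 : R) \in `[0, pi] by rewrite in_itv /=; apply/andP; split; lra.
  by rewrite (ltr_cos i2 i1).
by rewrite h2 h cos0 ltxx.
Qed.

Lemma w_it k t : w k (mkC 0 t) = mkC (cos (t * Lq k)) (- sin (t * Lq k)).
Proof. by rewrite wE cexp_it. Qed.

Lemma cabs_1w_it k t : cabs (1 - w k (mkC 0 t)) ^+ 2 = 2 - 2 * cos (t * Lq k).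
Proof.
rewrite cabs_sqr w_it reD reN re1 re_mkC imD imN im1 im_mkC.
by have := cos2Dsin2 (t * Lq k); lra.
Qed.

(** The rate $4^{-k-1}$ is a compromise: slow enough for the series to converge against numerators
    of size $8^{-k}$, fast enough for the exceptional sets to have summable measure. *)
Definition good t := (forall k, 1 - w k (mkC 0 t) != 0) /\
  (exists K0, forall k, (K0 <= k)%N -> 4^-1 ^+ k.+1 <= cabs (1 - w k (mkC 0 t))).

Local Notation mu := (@lebesgue_measure R).

Definition sym_itv (a r : R) : set R := `[a - r, a + r]%classic `|` `[- a - r, - a + r]%classic.

Lemma sym_itvP a r t : `| `|t| - a| <= r -> sym_itv a r t.
Proof.
rewrite ler_norml => /andP[h1 h2]; case: (ger0P t) h1 h2 => t0 h1 h2.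
  by left; rewrite /= in_itv /=; apply/andP; split; lra.
by right; rewrite /= in_itv /=; apply/andP; split; lra.
Qed.

Lemma measurable_sym_itv a r : measurable (sym_itv a r).
Proof. by apply: measurableU. Qed.

Lemma mu_itv_le (a r : R) : 0 <= r -> (mu [set` `[a - r, a + r]%R] <= (2 * r)%:E)%E.
Proof.
move=> r0; rewrite lebesgue_measure_itv /=; case: ifP => _; last by rewrite lee_fin mulr_ge0.
by rewrite -EFinB lee_fin; lra.
Qed.

Lemma mu_sym_itv_le a r : 0 <= r -> (mu (sym_itv a r) <= (4 * r)%:E)%E.
Proof.
move=> r0; apply: le_trans (measureU2 _ _ _) _ => //.
apply: le_trans (leeD (mu_itv_le a r0) (mu_itv_le (- a) r0)) _.
by rewrite -EFinD lee_fin; lra.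
Qed.

Lemma mu_bigU_le (I : nat -> set R) (b : R) n : (forall i, measurable (I i)) ->
  (forall i, mu (I i) <= b%:E)%E ->
  (mu (\big[setU/set0]_(i < n) I i) <= (n%:R * b)%:E)%E.
Proof.
move=> mI hI; elim: n => [|n IH]; first by rewrite big_ord0 measure0 mul0r.
rewrite big_ord_recr /=; apply: le_trans (measureU2 _ _ _) _ => //.
- by apply: bigsetU_measurable => i _; exact: mI.
- exact: mI.
by apply: le_trans (leeD IH (hI n)) _; rewrite -EFinD lee_fin -natr1 mulrDl mul1r.
Qed.

(** Within $|t|\le k$ there are about $k\,L_k$ zeros of $1-w_k(it)$ of each sign, where $L_k=\ln
    q_k$, each surrounded at radius $2\cdot4^{-k-1}/L_k$. The factor $L_k$ cancels in the total
    length, which makes the measure bound independent of how large $q_k$ is. *)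
Definition bad_cover k : set R :=
  \big[setU/set0]_(i < (Num.trunc (k%:R * Lq k)).+1)
    sym_itv (i%:R * (2 * pi) / Lq k) (2 * 4^-1 ^+ k.+1 / Lq k).

Lemma Lq_gt0 k : 0 < Lq k. Proof. by apply: lt_le_trans (Lq_ge1 k). Qed.

Lemma bad_coverP k t : `|t| <= k%:R -> cabs (1 - w k (mkC 0 t)) < 4^-1 ^+ k.+1 -> bad_cover k t.
Proof.
move=> tk h; set d := 4^-1 ^+ k.+1 in h.
have d0 : 0 < d by rewrite exprn_gt0.
have d1 : d <= 4^-1 by rewrite /d exprS ler_piMr // exprn_ile1 //; lra.
have L0 := Lq_gt0 k.
have h2 : 1 - d ^+ 2 / 2 < cos (t * Lq k).
  have := cabs_1w_it k t; have : cabs (1 - w k (mkC 0 t)) ^+ 2 < d ^+ 2.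
    by rewrite ltrXn2r ?nnegrE ?cabs_ge0 // ltW.
  lra.
have d2 : d <= 2^-1 by lra.
have [n hn] := cos_near1 d0 d2 h2.
rewrite normrM (ger0_norm (ltW L0)) in hn.
have p2 := pi_ge2 R.
have nk : (n < (Num.trunc (k%:R * Lq k)).+1)%N.
  rewrite ltnS truncn_ge_nat; last by rewrite mulr_ge0 // ltW.
  move: hn; rewrite ler_norml => /andP[hn _].
  have q1 : `|t| * Lq k <= k%:R * Lq k by rewrite ler_wpM2r // ltW.
  have q2 : n%:R * 4 <= n%:R * (2 * pi) :> R by rewrite ler_wpM2l //; lra.
  case: (posnP n) => [->|n0]; first by rewrite mulr_ge0 // ltW.
  have : (1 : R) <= n%:R by rewrite ler1n.
  lra.
rewrite /bad_cover -(bigcup_mkord _ (fun i => sym_itv (i%:R * (2 * pi) / Lq k) (2 * 4^-1 ^+ k.+1 / Lq k))).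
exists n => //=; apply: sym_itvP.
have -> : `|t| - n%:R * (2 * pi) / Lq k = (`|t| * Lq k - n%:R * (2 * pi)) / Lq k.
  by field; rewrite gt_eqF.
rewrite normrM (ger0_norm (x := (Lq k)^-1)) ?invr_ge0 ?(ltW L0) //.
by rewrite ler_wpM2r // invr_ge0 ltW.
Qed.

Lemma measurable_bad_cover k : measurable (bad_cover k).
Proof. by apply: bigsetU_measurable => i _; exact: measurable_sym_itv. Qed.

Lemma mu_bad_cover_le k : (mu (bad_cover k) <= (8 * 2^-1 ^+ k)%:E)%E.
Proof.
have L0 := Lq_gt0 k; have L1 := Lq_ge1 k.
set r := 2 * 4^-1 ^+ k.+1 / Lq k.
have r0 : 0 <= r by rewrite divr_ge0 ?mulr_ge0 ?exprn_ge0 // ltW.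
apply: le_trans (@mu_bigU_le (fun i => sym_itv (i%:R * (2 * pi) / Lq k) r) (4 * r)
  (Num.trunc (k%:R * Lq k)).+1 _ _) _.
- by move=> i; exact: measurable_sym_itv.
- by move=> i; exact: mu_sym_itv_le.
rewrite lee_fin.
have h1 : (Num.trunc (k%:R * Lq k)).+1%:R <= k.+1%:R * Lq k.
  rewrite -natr1 -(natr1 k) mulrDl mul1r lerD //.
  by have /andP[] := truncn_itv (mulr_ge0 (ler0n R k) (ltW L0)).
apply: le_trans (ler_wpM2r _ h1) _; first by rewrite mulr_ge0.
have -> : k.+1%:R * Lq k * (4 * r) = k.+1%:R * (8 * 4^-1 ^+ k.+1).
  by rewrite /r; field; rewrite gt_eqF.
have h2 : k.+1%:R <= 2 ^+ k :> R by rewrite -natrX ler_nat; exact: ltn_expl.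
have e4 : 4^-1 ^+ k = 2^-1 ^+ k * 2^-1 ^+ k :> R.
  by rewrite -exprMn; congr (_ ^+ _); field.
have e2 : 2 ^+ k * 2^-1 ^+ k = 1 :> R by rewrite -exprMn divff // expr1n.
apply: le_trans (ler_wpM2r _ h2) _; first by rewrite mulr_ge0 ?exprn_ge0.
rewrite exprS e4.
have -> : 2 ^+ k * (8 * (4^-1 * (2^-1 ^+ k * 2^-1 ^+ k))) = 2 * ((2 ^+ k * 2^-1 ^+ k) * 2^-1 ^+ k) :> R by field.
by rewrite e2 mul1r ler_wpM2r ?exprn_ge0 //; lra.
Qed.

(** Borel-Cantelli: the measures are at most $8\cdot2^{-k}$, with total at most 16. *)
Lemma bad_limsup0 : mu (lim_sup_set bad_cover) = 0%E.
Proof.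
apply: lim_sup_set_cvg0; first exact: measurable_bad_cover.
apply: le_lt_trans (_ : 16%:E < +oo)%E; last exact: ltry.
apply: lime_le; first by apply: is_cvg_nneseries => n _ _; exact: measure_ge0.
apply: nearW => n; rewrite big_mkord.
apply: le_trans (_ : \sum_(i < n) (8 * 2^-1 ^+ i)%:E <= _)%E.
  by apply: lee_sum => i _; exact: mu_bad_cover_le.
rewrite sumEFin lee_fin -mulr_sumr.
by have := @sum_pow2 R n 0; rewrite expr0; under eq_bigr do rewrite add0n; lra.
Qed.

Lemma poles_negligible k : mu.-negligible [set t | 1 - w k (mkC 0 t) = 0].
Proof.
have H : mu.-negligible (\bigcup_n sym_itv (n%:R * (2 * pi) / Lq k) 0).
  apply: negligible_bigcup => n; apply/negligibleP; first exact: measurable_sym_itv.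
  apply/eqP; rewrite eq_le measure_ge0 andbT.
  by apply: le_trans (mu_sym_itv_le _ (lexx 0)) _; rewrite mulr0.
apply: negligibleS H => t /= ht; have L0 := Lq_gt0 k.
have [n hn] : exists n : nat, `|t * Lq k| = n%:R * (2 * pi).
  apply: cos_eq1; have := cabs_1w_it k t; rewrite ht cabs0 expr0n /=; lra.
exists n => //; apply: sym_itvP.
by rewrite -hn normrM (ger0_norm (ltW L0)) mulfK ?gt_eqF // subrr normr0.
Qed.

Lemma ae_good : {ae mu, forall t, good t}.
Proof.
have H : mu.-negligible ((\bigcup_k [set t | 1 - w k (mkC 0 t) = 0]) `|` lim_sup_set bad_cover).
  apply: negligibleU; first by apply: negligible_bigcup => k; exact: poles_negligible.
  apply/negligibleP; last exact: bad_limsup0.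
  by apply: bigcap_measurable => // n _; apply: bigcup_measurable => j _; exact: measurable_bad_cover.
apply: negligibleS H.
move=> t /= ng; apply: contrapT => /not_orP[h1 h2]; apply: ng; split.
  by move=> k; apply/eqP => e; apply: h1; exists k.
have [n hn] : exists n, ~ (\bigcup_(j >= n) bad_cover j) t.
  by apply: contrapT => /forallNP h; apply: h2 => n _; apply: contrapT; exact: h.
have [N hN] := nat_ge `|t|.
exists (maxn n N) => k; rewrite geq_max => /andP[kn kN].
rewrite leNgt; apply/negP => hlt; apply: hn; exists k => //.
exact: bad_coverP (hN k kN) hlt.
Qed.

(** * Nontangential limits at good points *)

Variable A : R.
Hypothesis phi_small : forall k t, `|t| <= k%:R -> phi k t <= A * 8^-1 ^+ k.

Lemma A_ge0 : 0 <= A.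
Proof.
have := @phi_small 0%N 0; rewrite normr0 expr0 mulr1 => /(_ (lexx _)).
by apply: le_trans.
Qed.

Lemma expR_sub1_le_abs (u v : R) : `|u| <= v -> `|expR u - 1| <= v * expR v.
Proof.
move=> uv; have v0 : 0 <= v := le_trans (normr_ge0 u) uv.
have h : `|expR u - 1| <= `|u| * expR `|u|.
  by have := cexp_sub1_le (rc u); rewrite cexp_rc -rc1 -rcB !cabs_rc.
by apply: le_trans h _; rewrite ler_pM ?expR_ge0 ?ler_expR.
Qed.

(** Moving from the axis to abscissa $x$ changes $\phi_k$ by at most $M_k\,xX_ke^{xX_k}$, while
    $|w_k|=e^{-xL_k}$ with $L_k=\ln q_k$. For $y=x(L_k-X_k)$ the largeness of $q_k$ bounds the
    product by $8^{-k}ye^{-y}\le8^{-k}$, uniformly in $x\ge0$. *)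
Lemma evD_E'_le k s : 0 <= re s -> cabs (evD (E' k) s) <= phi k (im s) + 8^-1 ^+ k.
Proof.
move=> s0; rewrite -(mkCE s) re_mkC im_mkC in s0 *; set x := re s in s0 *; set t := im s.
rewrite evD_E'.
pose D := \sum_(p <- E k) p.1 * (rc (expR (- (x * p.2))) - 1) * cexp (- (mkC 0 t * rc p.2)).
have -> : ev (E k) (mkC x t) = rc (phi k t) + D.
  rewrite -phiE /ev /D -big_split; apply: eq_bigr => p _ /=.
  by rewrite cexp_mkC cexp_it; ring.
rewrite mulrDl; apply: le_trans (cabsD _ _) _; rewrite !cabsM cabs_rc ger0_norm //.
have L0 := Lq_gt0 k.
have w1 : cabs (w k (mkC x t)) = expR (- (x * Lq k)) by rewrite cabs_w.
apply: lerD.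
  have w0 : cabs (w k (mkC x t)) <= 1.
    by rewrite w1 -[leRHS]expR0 ler_expR oppr_le0; apply: mulr_ge0 s0 (ltW L0).
  by rewrite -[leRHS]mulr1; apply: ler_wpM2l.
have hD : cabs D <= M k * (x * X k * expR (x * X k)).
  apply: le_trans (cabs_sum _ _ _) _; rewrite /total_abs mulr_suml.
  rewrite big_seq [leRHS]big_seq; apply: ler_sum => p /freq_le pX.
  rewrite !cabsM cabs_cexp -mulrA ler_wpM2l ?cabs_ge0 //.
  have -> : re (- (mkC 0 t * rc p.2)) = 0 by rewrite reN reM re_mkC re_rc im_rc; ring.
  rewrite expR0 mulr1 -rc1 -rcB cabs_rc; apply: expR_sub1_le_abs.
  by rewrite normrN normrM (ger0_norm s0) ler_wpM2l.
rewrite w1; apply: le_trans (ler_wpM2r (expR_ge0 _) hD) _.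
have -> : M k * (x * X k * expR (x * X k)) * expR (- (x * Lq k)) =
   x * (X k * M k) * expR (- (x * (Lq k - X k))).
  have -> : - (x * (Lq k - X k)) = x * X k + - (x * Lq k) by ring.
  by rewrite expRD; ring.
rewrite exprVn -[leRHS]mul1r ler_pdivlMr ?exprn_gt0 //.
have h := LqX_ge2 k; set y := x * (Lq k - X k).
have h1 : x * (X k * M k) * 8 ^+ k <= y by rewrite -mulrA ler_wpM2l.
rewrite mulrAC; apply: le_trans (ler_wpM2r (expR_ge0 _) h1) _.
rewrite expRN ler_pdivrMr ?expR_gt0 // mul1r.
by have := expR_ge1Dx y; lra.
Qed.

(** Let $d=|1-w_k(it)|$. If $s$ is within about $d/(8L_k)$ of $it$, where $L_k=\ln q_k$, then $w_k$
    has moved by at most $d/4$. Otherwise the Stolz condition forces $L_k\Re s\ge d/(8(1+a))$, so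
    $|w_k(s)|$ itself is far enough below 1. The constant does not depend on $k$, although $w_k$
    oscillates ever faster. *)
Lemma stolz_1w k t s (a : R) : 0 <= a -> 0 <= re s -> `|im s - t| <= a * re s ->
  cabs (1 - w k (mkC 0 t)) <= 16 * (1 + a) * cabs (1 - w k s).
Proof.
move=> a0 s0 hs; set d := cabs (1 - w k (mkC 0 t)).
have L0 := Lq_gt0 k.
have w01 : cabs (w k (mkC 0 t)) = 1 by rewrite cabs_w re_mkC mul0r oppr0 expR0.
have d0 : 0 <= d := cabs_ge0 _.
have d2 : d <= 2 by apply: le_trans (cabsB _ _) _; rewrite cabs1 w01.
set x := re s in s0 hs.
have [hx|hx] := leP ((1 + a) * (x * Lq k)) (d / 8).
  set z := - ((s - mkC 0 t) * rc (Lq k)).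
  have cz : cabs z <= d / 8.
    apply: le_trans hx; rewrite cabsN cabsM cabs_rc (ger0_norm (ltW L0)) mulrA ler_wpM2r ?(ltW L0) //.
    apply: le_trans (cabs_le_reim _) _; rewrite reD reN imD imN re_mkC im_mkC subr0 -/x ger0_norm //.
    by rewrite mulrDl mul1r lerD2l.
  have z0 := cabs_ge0 z.
  have e2 : expR (cabs z) <= 2.
    have : `|cabs z| <= 2^-1 by rewrite ger0_norm //; lra.
    by move=> /expR_sub1D_le /andP[_]; nra.
  have h1 : cabs (cexp z - 1) <= d / 4.
    by apply: le_trans (cexp_sub1_le z) _; nra.
  have ew : w k s = w k (mkC 0 t) * cexp z.
    by rewrite !wE -cexpD /z; congr cexp; ring.
  have : d <= cabs (1 - w k s) + cabs (w k s - w k (mkC 0 t)) by exact: cabs_triangle.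
  have -> : w k s - w k (mkC 0 t) = w k (mkC 0 t) * (cexp z - 1) by rewrite ew; ring.
  rewrite cabsM w01 mul1r => h2.
  have c0 := cabs_ge0 (1 - w k s).
  have : 16 * cabs (1 - w k s) <= 16 * (1 + a) * cabs (1 - w k s).
    by rewrite ler_wpM2r //; lra.
  lra.
set v := d / (8 * (1 + a)).
have a1 : 0 < 8 * (1 + a) by lra.
have vx : v <= x * Lq k by rewrite /v ler_pdivrMr // ltW //; lra.
have v0 : 0 <= v by rewrite divr_ge0 // ltW.
have v1 : v <= 1 by rewrite /v ler_pdivrMr //; lra.
have h1 : v / 2 <= 1 - expR (- v).
  have h := expR_ge1Dx v; have h' := expR_gt0 (- v).
  have h3 : expR v * expR (- v) = 1 by rewrite -expRD subrr expR0.
  have : (1 + v) * expR (- v) <= expR v * expR (- v) by rewrite ler_wpM2r // ltW.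
  rewrite h3.
  nra.
have h2 : 1 - expR (- v) <= cabs (1 - w k s).
  have := cabsD (1 - w k s) (w k s); rewrite subrK cabs1 cabs_w -/x.
  have : expR (- (x * Lq k)) <= expR (- v) by rewrite ler_expR lerN2.
  lra.
have : v / 2 <= cabs (1 - w k s) by lra.
rewrite -(ler_pM2l a1) /v => h3.
have e : 8 * (1 + a) * (d / (8 * (1 + a)) / 2) = d / 2 by field; lra.
rewrite e in h3; lra.
Qed.

(** The numerator is $O(8^{-k})$ and the denominator at least a multiple of $4^{-k}$;
    $128=2\cdot4\cdot16$ collects the factor of [F], the shift in [k.+1] and the constant of
    [stolz_1w]. *)
Lemma F_stolz k t s (a : R) : 0 <= a -> 0 <= re s -> `|im s - t| <= a * re s ->
  `|im s| <= k%:R -> 4^-1 ^+ k.+1 <= cabs (1 - w k (mkC 0 t)) ->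
  cabs (F k s) <= 128 * (1 + a) * (A + 1) * 2^-1 ^+ k.
Proof.
move=> a0 s0 hs hk hd.
have h1 := le_trans hd (stolz_1w k a0 s0 hs).
have h2 : cabs (evD (E' k) s) <= (A + 1) * 8^-1 ^+ k.
  apply: le_trans (evD_E'_le k s0) _; rewrite mulrDl mul1r lerD2r; exact: phi_small.
have A0 := A_ge0.
have c1 : 0 < cabs (1 - w k s).
  have : 0 < 4^-1 ^+ k.+1 :> R by rewrite exprn_gt0.
  move=> h; have := lt_le_trans h h1.
  by rewrite pmulr_rgt0 //; lra.
rewrite /F cabsM cabsV !cabsM cabsN cabs_nat ler_pdivrMr //.
have h3 : 2 * cabs (evD (E' k) s) <= 2 * ((A + 1) * 8^-1 ^+ k) by rewrite ler_wpM2l.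
apply: le_trans h3 _.
have e : 8^-1 ^+ k = 2^-1 ^+ k * 4^-1 ^+ k :> R.
  by rewrite -exprMn; congr (_ ^+ _); field.
rewrite e; rewrite exprS in h1.
have p2 : 0 <= 2^-1 ^+ k :> R by rewrite exprn_ge0.
have h4 : 8 * ((A + 1) * 2^-1 ^+ k) * (4^-1 * 4^-1 ^+ k) <=
   8 * ((A + 1) * 2^-1 ^+ k) * (16 * (1 + a) * cabs (1 - w k s)).
  by rewrite ler_wpM2l // mulr_ge0 // mulr_ge0 //; lra.
apply: le_trans (_ : _ <= 8 * ((A + 1) * 2^-1 ^+ k) * (4^-1 * 4^-1 ^+ k)) _.
  by rewrite le_eqVlt; apply/orP; left; apply/eqP; field.
by apply: le_trans h4 _; rewrite le_eqVlt; apply/orP; left; apply/eqP; ring.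
Qed.

Lemma F_cvg k (s0 : C) : 1 - w k s0 != 0 -> F k s @[s --> s0] --> F k s0.
Proof.
move=> h.
have c1 : (1 - w k s) @[s --> s0] --> 1 - w k s0.
  by apply: C_cvgD; [exact: C_cvg_cst|apply: C_cvgN; exact: nat_cpowN_cvg].
have c2 := @C_cvgM _ (fun=> - 2%:R) (evD (E' k)) s0 _ _ (@C_cvg_cst _ (- 2%:R) s0) (@evD_cvg _ (E' k) s0).
exact: (C_cvgM c2 (C_cvgV h c1)).
Qed.

Lemma sum_F_cvg K (s0 : C) : (forall k, 1 - w k s0 != 0) ->
  (\sum_(k < K) F k s) @[s --> s0] --> \sum_(k < K) F k s0.
Proof.
move=> h; elim: K => [|K IH].
  rewrite big_ord0 (_ : (fun s => _) = fun=> 0); first exact: C_cvg_cst.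
  by apply: funext => s; rewrite big_ord0.
rewrite big_ord_recr (_ : (fun s => _) = fun s => \sum_(k < K) F k s + F K s).
  exact: (C_cvgD IH (F_cvg (h K))).
by apply: funext => s; rewrite big_ord_recr.
Qed.

Lemma good_clim t : good t -> exists l, clim (fun K => \sum_(k < K) F k (mkC 0 t)) l.
Proof.
move=> [_ [K0 hK]]; have [N hN] := nat_ge `|t|.
have [|l hl] := @geo_test R (fun k => F k (mkC 0 t)) (128 * (1 + 1) * (A + 1)) (maxn K0 N); last by exists l.
move=> k; rewrite geq_max => /andP[k1 k2]; apply: (F_stolz (t := t)) => //.
- by rewrite im_mkC re_mkC mulr0 subrr normr0.
- exact: hN.
- exact: hK.
Qed.

(** The tail of $\sum F_k$ is small uniformly over the Stolz region near $it$, including $it$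
    itself, and the finite head is continuous there because $t$ avoids its poles. The three parts
    give [m / 3] each. *)
Lemma good_nontangential t l : good t ->
  clim (fun K => \sum_(k < K) F k (mkC 0 t)) l ->
  nontangential_limit g t (cexp (l - rc c)).
Proof.
move=> [g1 [K0 hK0]] hl a a0; apply/cvgrPdist_le => eps eps0.
have [epsE r0] := gt0_rc eps0; rewrite epsE; set r := re eps in r0 *; set B := re (l - rc c).
have Q0 : 0 < expR B * expR 1 by rewrite mulr_gt0 ?expR_gt0.
pose m := Num.min 1 (r / (expR B * expR 1)).
have m0 : 0 < m by rewrite lt_min ltr01 divr_gt0.
have m30 : 0 < m / 3 by rewrite divr_gt0.
pose Kc := 128 * (1 + a) * (A + 1).
have [N1 hN1] := nat_ge (`|t| + 1).
have [N2 hN2] := pow2_small (2 * Kc) m30.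
pose K := maxn (maxn K0 N1) N2.
have KK0 : (K0 <= K)%N by rewrite /K -maxnA leq_maxl.
have KN1 : (N1 <= K)%N by rewrite /K maxnAC leq_maxr.
have KN2 : (N2 <= K)%N by rewrite /K leq_maxr.
have tail s : 0 <= re s -> `|im s - t| <= a * re s -> `|im s| <= `|t| + 1 ->
    forall k, (K <= k)%N -> cabs (F k s) <= Kc * 2^-1 ^+ k.
  move=> s0 hs his k hk; apply: (F_stolz (t := t)) => //; first exact: ltW.
    by apply: le_trans his _; apply: hN1; exact: leq_trans hk.
  by apply: hK0; exact: leq_trans hk.
have ht : cabs (l - \sum_(k < K) F k (mkC 0 t)) <= m / 3.
  have H k : (K <= k)%N -> cabs (F k (mkC 0 t)) <= Kc * 2^-1 ^+ k.
    apply: tail; rewrite ?re_mkC ?im_mkC ?subrr ?normr0 ?mulr0 //.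
    by rewrite lerDl.
  exact: le_trans (geo_tail hl H (leqnn K)) (hN2 K KN2).
have m30C : 0 < rc (m / 3) by rewrite -rc0 ltrc.
have cS := @sum_F_cvg K (mkC 0 t) g1.
have near1 : \forall s \near (mkC 0 t : C), `|\sum_(k < K) F k (mkC 0 t) - \sum_(k < K) F k s| <= rc (m / 3).
  by move/cvgrPdist_le: cS => /(_ _ m30C).
have near2 : \forall s \near (mkC 0 t : C), `|(mkC 0 t : C) - s| <= 1.
  exists 1; first exact: ltr01.
  by move=> s /= /ltW.
rewrite near_withinE.
apply: filterS2 near1 near2 => s; rewrite !normC_cabs -rc1 !lerc => h1 h2 [s0 hs].
have his : `|im s| <= `|t| + 1.
  have := cabs_im (mkC 0 t - s); rewrite imD imN im_mkC => h3.
  have := ler_normB t (t - im s); rewrite opprB addrC subrK.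
  lra.
have hfs : cabs (f s - \sum_(k < K) F k s) <= m / 3.
  exact: le_trans (geo_tail (f_clim s0) (tail s (ltW s0) hs his) (leqnn K)) (hN2 K KN2).
have hfl : cabs (f s - l) <= m.
  have := cabs_triangle (f s) l (\sum_(k < K) F k s).
  have := cabs_triangle (\sum_(k < K) F k s) l (\sum_(k < K) F k (mkC 0 t)).
  rewrite (cabs_distC l) in ht; rewrite cabs_distC in h1.
  lra.
have e : f s - rc c - (l - rc c) = f s - l by ring.
have [q1 q2] : cabs (f s - l) <= 1 /\ cabs (f s - l) <= r / (expR B * expR 1).
  by move: hfl; rewrite /m le_min => /andP.
rewrite cabs_distC; apply: le_trans (@cexp_dist_le _ _ _ B (lexx _) _) _; rewrite e //.
by rewrite mulrC -ler_pdivlMr.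
Qed.

Lemma re_F_it k t : 1 - w k (mkC 0 t) != 0 -> re (F k (mkC 0 t)) = phi k t.
Proof.
move=> h; have hF : F k (mkC 0 t) * (1 - w k (mkC 0 t)) = - 2%:R * rc (phi k t) * w k (mkC 0 t).
  by rewrite F_ev phiE divfK.
have h2 := cabs_1w_it k t.
move: hF; move: (F k _) => z; rewrite w_it; set u := cos _ in h2 *; set v := sin _ => hF.
have uv : u ^+ 2 + v ^+ 2 = 1 by exact: cos2Dsin2.
have d0 : 0 < cabs (1 - w k (mkC 0 t)) ^+ 2 by rewrite exprn_gt0 // cabs_gt0.
rewrite h2 in d0.
have h3 := congr1 re hF; have h4 := congr1 im hF.
have e (p : R) : - 2%:R * rc p = rc (- 2 * p) :> C by rewrite rcM rcN rc_nat.
rewrite e !reM !reD !reN re1 !imD !imN im1 re_rc im_rc !re_mkC !im_mkC in h3.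
rewrite e !imM !reD !reN re1 !imD !imN im1 re_rc im_rc !re_mkC !im_mkC in h4.
(* The real part of $z(1-w)\overline{(1-w)}$, where $w=u-iv$; both components of $z(1-w)$ are known
   from [hF]. *)
have k1 : re z * ((1 - u) ^+ 2 + v ^+ 2) = (1 - u) * (re z * (1 - u) - im z * (0 - - v))
    + v * (re z * (0 - - v) + im z * (1 - u)) by ring.
rewrite h3 h4 in k1.
have v2 : v ^+ 2 = 1 - u ^+ 2 by rewrite -uv; ring.
have k3 : phi k t * v ^+ 2 = phi k t * (1 - u ^+ 2) by rewrite v2.
have k4 : re z * v ^+ 2 = re z * (1 - u ^+ 2) by rewrite v2.
have : (re z - phi k t) * (2 - 2 * u) = 0 by lra.
by move/eqP; rewrite mulf_eq0 (gt_eqF d0) orbF subr_eq0 => /eqP.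
Qed.

End Interior.

(** * Uniqueness of nontangential limits *)

Section BoundaryValue.
Context {R : realType}.
Local Notation C := (Cplx R).

Lemma boundary_value_eq (h : C -> C) t l : nontangential_limit h t l -> boundary_value h t = l.
Proof.
move=> hl; rewrite /boundary_value; case: xgetP => [l' -> /= hl'|/(_ l)]; last by [].
have cl : closure (stolz_region t 1) (mkC 0 t : C).
  move=> U [e e0 hU]; have [eE r0] := gt0_rc e0; rewrite eE in hU; set r := re e in r0 hU.
  exists (mkC (r / 2) t); split.
    split; first by rewrite re_mkC divr_gt0.
    by rewrite im_mkC re_mkC subrr normr0 mul1r divr_ge0 // ltW.
  apply: hU => /=; rewrite normC_cabs ltrc.
  have -> : mkC 0 t - mkC (r / 2) t = rc (- (r / 2)).
    by apply: C_ext; rewrite ?reD ?imD ?reN ?imN ?re_rc ?im_rc ?re_mkC ?im_mkC; ring.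
  by rewrite cabs_rc normrN ger0_norm; lra.
have pf := within_nbhs_proper cl.
exact: (cvg_unique (@norm_hausdorff C C) (hl' 1 ltr01) (hl 1 ltr01)).
Qed.

End BoundaryValue.

(** * The general construction *)

Section Core.
Context {R : realType}.
Local Notation C := (Cplx R).

Lemma clim_cvg (u : nat -> C) (l : C) : clim u l -> u n @[n --> \oo] --> l.
Proof.
move=> h; apply/cvgrPdist_le => eps eps0.
have [e r0] := gt0_rc eps0; have [N hN] := h _ r0.
by exists N => // n /hN; rewrite e normC_cabs lerc cabs_distC re_rc.
Qed.

Lemma clim_unshift (u : nat -> C) (l : C) : clim (fun n => u n.+1) l -> clim u l.
Proof.
move=> h e /h[N hN]; exists N.+1 => -[|n] //; exact: hN.
Qed.

Lemma norm2_le (a : nat -> C) (T : R) : 0 <= T ->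
  (forall N, \sum_(1 <= n < N.+1) cabs (a n) ^+ 2 <= T ^+ 2) -> (norm2 a <= T%:E)%E.
Proof.
move=> T0 h; rewrite /norm2.
have -> : T%:E = sqrte ((T ^+ 2)%:E) by rewrite /= sqrtr_sqr ger0_norm.
rewrite lee_sqrt; last by rewrite lee_fin sqr_ge0.
apply: lime_le; first by apply: is_cvg_nneseries => n _ _; rewrite lee_fin sqr_ge0.
apply: nearW => -[|N]; first by rewrite big_geq // lee_fin sqr_ge0.
by rewrite sumEFin lee_fin.
Qed.

(** [psi] is $\sum_k\phi_k(t)$, pinned down by order alone: it bounds all partial sums and lies
    below each eventual bound for them. The applications use it only through these two
    properties. *)
Theorem singular_type_construction (E : nat -> seq (C * R)) (phi : nat -> R -> R) (c A : R) :
  0 < c -> (forall k, rat_freqs (E k)) ->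
  (forall k t, ev (E k) (mkC 0 t) = rc (phi k t)) ->
  (forall k t, 0 <= phi k t) -> (forall K t, \sum_(k < K) phi k t <= c) ->
  (forall k t, `|t| <= k%:R -> phi k t <= A * 8^-1 ^+ k) ->
  exists (g : C -> C) (a : nat -> C),
  [/\ analytic_in right_half_plane g, represented_by g a,
      forall s, right_half_plane s -> g s != 0,
      forall s, right_half_plane s -> cabs (g s) <= 1 &
      (forall delta, (forall K, \sum_(k < K) mean (E k) <= delta) ->
         forall N, \sum_(1 <= n < N.+1) cabs (a n) ^+ 2 <= expR (- (2 * c)) + delta / c) /\
      {ae (@lebesgue_measure R), forall t, exists psi,
         [/\ cabs (boundary_value g t) = expR (psi - c),
             forall K, \sum_(k < K) phi k t <= psi &
             forall (K : nat) (r : R), (forall n, (K <= n)%N -> \sum_(k < n) phi k t <= r) -> psi <= r]}].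
Proof.
move=> c0 hE hphi phi0 hsum hsmall.
pose qb (k : nat) := 1 + freq_bound E k + k%:R * (k%:R + total_abs E k) +
   freq_bound E k * total_abs E k * 8 ^+ k.
have hq k : exists d : nat * seq (C * nat),
    [/\ qb k <= ln d.1%:R, all (fun p => (k.+1 < p.2)%N) d.2 &
        E k = [seq (p.1, ln p.2%:R - ln d.1%:R) | p <- d.2]].
  have [n hn] := nat_ge (expR (qb k)).
  have [q [E' [h1 h2 h3]]] := @common_denominator R (E k) (maxn k.+1 n) (hE k).
  exists (q, E'); split => //=.
    have h4 : expR (qb k) <= q%:R by apply: hn; apply: leq_trans (leq_maxr _ _) (ltnW h1).
    by rewrite -ler_expR lnK // posrE; apply: lt_le_trans h4; exact: expR_gt0.
  by apply: sub_all h2 => p; apply: leq_ltn_trans; exact: leq_maxl.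
have [d hd] := choice hq.
pose q k := (d k).1; pose E' k := (d k).2.
have hlarge k : qb k <= ln (q k)%:R by have [] := hd k.
have hgt k : all (fun p => (k.+1 < p.2)%N) (E' k) by have [] := hd k.
have hEE k : E k = [seq (p.1, ln p.2%:R - ln (q k)%:R) | p <- E' k] by have [] := hd k.
exists (g c q E'), (acoef c q E'); split.
- by move=> s s0; exact: (g_derivable hEE hgt hlarge).
- exists 0 => s s0; apply: clim_cvg; apply: clim_unshift.
  exact: (acoef_clim c hEE hgt hlarge s0).
- by move=> s s0; exact: g_neq0.
- by move=> s s0; exact: (g_le1 hphi phi0 hsum hEE hlarge s0).
split.
  by move=> delta hdelta N; exact: (norm2_partial c0 hphi phi0 hsum hEE hgt hlarge).
suff H (t : R) : good q t -> exists psi,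
    [/\ cabs (boundary_value (g c q E') t) = expR (psi - c),
        forall K, \sum_(k < K) phi k t <= psi &
        forall (K : nat) (r : R), (forall n, (K <= n)%N -> \sum_(k < n) phi k t <= r) -> psi <= r].
  by apply: negligibleS (ae_good hlarge) => t /= nt ht; apply: nt; exact: H.
move=> ht.
have [l hl] := good_clim hphi phi0 hEE hlarge hsmall ht.
have hn := @good_nontangential _ _ _ c hphi phi0 _ _ hEE hlarge _ hsmall _ _ ht hl.
exists (re l); split.
- by rewrite (boundary_value_eq hn) cabs_cexp reD reN re_rc.
- move=> K; apply: le_eps => e /hl[N hN].
  have h := hN (maxn K N) (leq_maxr _ _).
  have := cabs_re (\sum_(k < maxn K N) F q E' k (mkC 0 t) - l).
  rewrite reD reN re_sum => /le_trans/(_ h); rewrite ler_norml => /andP[_].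
  rewrite (eq_bigr (fun k : 'I__ => phi k t)) => [|k _]; last exact: (re_F_it hphi hEE (ht.1 k)).
  have : \sum_(k < K) phi k t <= \sum_(k < maxn K N) phi k t.
    by rewrite -(subnKC (leq_maxl K N)) big_split_ord /= lerDl sumr_ge0.
  lra.
- move=> K r hr; apply: (clim_re_le (N := K) hl) => n /hr hn'.
  by rewrite re_sum (eq_bigr (fun k : 'I__ => phi k t)) => [|k _] //; exact: (re_F_it hphi hEE (ht.1 k)).
Qed.

End Core.

(** * Mean values on the imaginary axis *)

Section LowerIntegral.
Import HBNNSimple.
Local Open Scope ereal_scope.
Context {d : measure_display} {T : measurableType d} {R : realType}.
Variable mu : {measure set T -> \bar R}.
Implicit Types (D : set T) (h f : T -> \bar R).

(** For nonnegative functions the integral is a supremum over simple functions below, hence monotone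
    without measurability. This spares a proof that the boundary values are measurable. *)
Lemma le_integral_nonmeasurable f h : (forall x, 0 <= f x) -> (forall x, f x <= h x) ->
  \int[mu]_x f x <= \int[mu]_x h x.
Proof.
move=> f0 fh; rewrite !ge0_integralTE //; last by move=> x; exact: le_trans (fh x).
apply: ereal_sup_le => _ [s hs <-]; exists s => // x; exact: le_trans (fh x).
Qed.

(** Removing the null set does not change the integral of the measurable [f]; after that the
    comparison is pointwise. *)
Lemma ae_integral_ge D f h : measurable D -> measurable_fun D f ->
  (forall x, 0 <= f x) -> (forall x, 0 <= h x) ->
  {ae mu, forall x, D x -> f x <= h x} ->
  \int[mu]_(x in D) f x <= \int[mu]_(x in D) h x.
Proof.
move=> mD mf f0 h0 [N [mN N0 sN]].
rewrite (@ge0_negligible_integral _ _ _ mu D N) //.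
rewrite [leLHS]integral_mkcond [leRHS]integral_mkcond; apply: le_integral_nonmeasurable => x.
  exact: erestrict_ge0.
rewrite !patchE; case: ifPn => [|_]; last by case: ifP.
rewrite inE => -[Dx Nx]; rewrite mem_set //.
by apply: contra_notP Nx => hx; apply: sN => /(_ Dx).
Qed.

(** Every simple function below [h] is almost everywhere below [f], and both of these are
    measurable. *)
Lemma ae_integral_le D f h : measurable D -> measurable_fun D f ->
  (forall x, 0 <= f x) -> (forall x, 0 <= h x) ->
  {ae mu, forall x, D x -> h x <= f x} ->
  \int[mu]_(x in D) h x <= \int[mu]_(x in D) f x.
Proof.
move=> mD mf f0 h0 hae.
rewrite [leLHS]integral_mkcond [leRHS]integral_mkcond ge0_integralTE; last first.
  by move=> x; exact: erestrict_ge0.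
apply: ge_ereal_sup => _ [s hs <-].
rewrite -integralT_nnsfun; apply: ae_ge0_le_integral => //.
- by move=> x _; rewrite lee_fin; exact: fun_ge0.
- by apply/measurable_EFinP.
- by move=> x _; exact: erestrict_ge0.
- by apply/(measurable_restrictT _ mD).
- move: hae; apply: filterS => x hx _; apply: le_trans (hs x) _.
  rewrite !patchE; case: ifPn => // /set_mem; exact: hx.
Qed.

End LowerIntegral.

(** * Integrals of trigonometric polynomials over [0, T] *)

Section TrigIntegral.
Context {R : realType}.
Local Notation C := (Cplx R).
Local Notation expsum := (seq (C * R)).
Local Notation mu := (@lebesgue_measure R).
Implicit Types (E F : expsum) (t T : R) (p : C * R).

Definition trig_int_term p T : R := if p.2 == 0 then re p.1 * T else
  (re p.1 * sin (T * p.2) + im p.1 * (1 - cos (T * p.2))) / p.2.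
Definition trig_int E T : R := \sum_(p <- E) trig_int_term p T.

Lemma trig_int_cat E F T : trig_int (E ++ F) T = trig_int E T + trig_int F T.
Proof. by rewrite /trig_int big_cat. Qed.
Lemma trig_int_scal (c : R) E T : trig_int (scalE (rc c) E) T = c * trig_int E T.
Proof.
rewrite /trig_int big_map mulr_sumr; apply: eq_bigr => p _; rewrite /trig_int_term /= !reimE !mul0r subr0 addr0.
by case: ifP => _; [ring | rewrite mulrA; congr (_ / _); ring].
Qed.
Lemma trig_int_const (c T : R) : trig_int [:: (rc c, 0)] T = c * T.
Proof. by rewrite /trig_int big_seq1 /trig_int_term eqxx re_rc. Qed.
Lemma trig_int0 E : trig_int E 0 = 0.
Proof.
rewrite /trig_int big1 // => p _; rewrite /trig_int_term mulr0 !mul0r sin0 cos0 subrr !mulr0 addr0 mul0r.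
by case: ifP.
Qed.

(** A nonzero frequency $x$ contributes a bounded quantity of order $1/|x|$, so time averages reach
    [mean E] with error $O(1/T)$. *)
Lemma trig_int_mean E : exists K, forall T, `|trig_int E T - mean E * T| <= K.
Proof.
elim: E => [|p E [K hK]].
  by exists 0 => T; rewrite /trig_int /mean !big_nil mul0r subrr normr0.
exists ((`|re p.1| + 2 * `|im p.1|) / `|p.2| + K) => T.
rewrite /trig_int /mean !big_cons -/(trig_int E T) -/(mean E) mulrDl opprD addrACA.
apply: le_trans (ler_normD _ _) (lerD _ (hK T)).
rewrite /trig_int_term; case: eqP => [->|/eqP h].
  by rewrite mulr1 subrr normr0 divr_ge0 // addr_ge0 // mulr_ge0.
rewrite mulr0 mul0r subr0 normrM normfV; apply: ler_wpM2r; first by rewrite invr_ge0.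
apply: le_trans (ler_normD _ _) (lerD _ _); rewrite normrM.
  by rewrite ler_piMr // sin_max.
rewrite mulrC ler_wpM2r //; have := cos_max (T * p.2); rewrite ler_norml => /andP[c1 c2].
by rewrite ler_norml; apply/andP; split; lra.
Qed.

Lemma re_ev_cons p E t : re_ev (p :: E) t = re p.1 * cos (t * p.2) + im p.1 * sin (t * p.2) + re_ev E t.
Proof.
rewrite /re_ev ev_cons reD cexp_it reM re_mkC im_mkC; congr (_ + _); ring.
Qed.

Lemma is_derive_trig_int_term p t : is_derive t 1 (trig_int_term p) (re p.1 * cos (t * p.2) + im p.1 * sin (t * p.2)).
Proof.
rewrite /trig_int_term; case: eqP => [->|/eqP h].
  rewrite mulr0 cos0 sin0 mulr1 mulr0 addr0.
  have := is_deriveZ (re p.1) (is_derive_id t (1 : R)).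
  by rewrite /= [_ *: _]mulr1; apply.
pose m : R -> R := fun x => x * p.2.
have dm : is_derive t 1 m p.2.
  have := is_deriveM (is_derive_id t (1 : R)) (is_derive_cst (p.2 : R) t (1 : R)).
  by rewrite /= scaler0 add0r [_ *: _]mulr1; apply.
have ds := is_derive1_comp (is_derive_sin (m t)) dm.
have dc := is_derive1_comp (is_derive_cos (m t)) dm.
have := is_deriveZ p.2^-1 (is_deriveD (is_deriveZ (re p.1) ds)
  (is_deriveZ (im p.1) (is_deriveB (is_derive_cst (1 : R) t (1 : R)) dc))).
set f := _ \*: _; set l := p.2^-1 *: _; have -> : f = fun T => (re p.1 * sin (T * p.2) + im p.1 * (1 - cos (T * p.2))) / p.2.
  by apply: funext => T; rewrite [RHS]mulrC.
have -> // : l = re p.1 * cos (t * p.2) + im p.1 * sin (t * p.2).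
by rewrite /l /GRing.scale /= /m; field.
Qed.

Lemma is_derive_trig_int E t : is_derive t 1 (trig_int E) (re_ev E t).
Proof.
elim: E => [|p E IH].
  rewrite /re_ev ev_nil (_ : trig_int [::] = cst 0) ?re0; first exact: is_derive_cst.
  by apply: funext => T; rewrite /trig_int big_nil.
rewrite re_ev_cons (_ : trig_int (p :: E) = trig_int_term p + trig_int E); last first.
  by apply: funext => T; rewrite /trig_int big_cons.
exact: (is_deriveD (is_derive_trig_int_term p t) IH).
Qed.

Lemma continuous_rev E : continuous (re_ev E).
Proof.
elim: E => [|p E IH] t.
  rewrite (_ : re_ev [::] = cst 0); first exact: cvg_cst.
  by apply: funext => u; rewrite /re_ev ev_nil re0.
rewrite (_ : re_ev (p :: E) = fun t => re p.1 * cos (t * p.2) + im p.1 * sin (t * p.2) + re_ev E t); last first.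
  by apply: funext => u; rewrite re_ev_cons.
have cm : (fun t : R => t * p.2) u @[u --> t] --> t * p.2 by apply: cvgM; [exact: cvg_id | exact: cvg_cst].
apply: cvgD; last exact: IH.
apply: cvgD; apply: cvgM; try exact: cvg_cst.
  exact: (continuous_cvg _ (@continuous_cos _ _) cm).
exact: (continuous_cvg _ (@continuous_sin _ _) cm).
Qed.

Lemma integral_rev E T : 0 < T ->
  (\int[mu]_(t in [set` `[0, T]%R]) (re_ev E t)%:E)%E = (trig_int E T)%:E.
Proof.
move=> T0.
have hF t : is_derive t 1 (trig_int E) (re_ev E t) by exact: is_derive_trig_int.
have cF t : trig_int E y @[y --> t] --> trig_int E t.
  by apply/differentiable_continuous; rewrite -derivable1_diffP; have [] := hF t.
rewrite (@continuous_FTC2 _ _ (trig_int E)) ?trig_int0 ?sube0 //.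
- by apply: continuous_subspaceT => t; exact: continuous_rev.
- split => //.
  + by apply: cvg_at_right_filter; exact: cF.
  + by apply: cvg_at_left_filter; exact: cF.
- by move=> x _; rewrite derive1E; exact: derive_val.
Qed.

Lemma measurable_rev E (D : set R) : measurable D -> measurable_fun D (fun t => (re_ev E t)%:E).
Proof.
move=> mD; apply/measurable_EFinP; apply: measurable_funTS.
by apply: continuous_measurable_fun; exact: continuous_rev.
Qed.

Lemma trig_int_ge0 E T : 0 < T -> (forall t, 0 <= t <= T -> 0 <= re_ev E t) -> 0 <= trig_int E T.
Proof.
move=> T0 h; rewrite -lee_fin -integral_rev //; apply: integral_ge0 => t /=.
by rewrite in_itv /= lee_fin; exact: h.
Qed.

Lemma trig_int_le E F T : 0 < T -> (forall t, 0 <= t <= T -> re_ev E t <= re_ev F t) -> trig_int E T <= trig_int F T.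
Proof.
move=> T0 h; rewrite -subr_ge0; have -> : trig_int F T - trig_int E T = trig_int (F ++ scalE (rc (-1)) E) T.
  by rewrite trig_int_cat trig_int_scal mulN1r.
by apply: trig_int_ge0 => // t /h; rewrite re_ev_cat re_ev_scal mulN1r subr_ge0.
Qed.

(** [h] may be nonmeasurable. The two bounds also show that its extended integral is finite, so
    passing to a real number loses nothing. *)
Lemma trig_int_sandwich E F (h : R -> R) T : 0 < T -> (forall t, 0 <= h t) ->
  (forall t, 0 <= re_ev E t) -> (forall t, 0 <= re_ev F t) ->
  {ae mu, forall t, 0 <= t <= T -> re_ev E t <= h t <= re_ev F t} ->
  trig_int E T <= \int[mu]_(t in `[0, T]) h t <= trig_int F T.
Proof.
move=> T0 h0 E0 F0 hae.
have mI : measurable [set` `[0, T]%R] by exact: measurable_itv.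
have i1 : ((trig_int E T)%:E <= \int[mu]_(t in [set` `[0, T]%R]) (h t)%:E)%E.
  rewrite -integral_rev //; apply: ae_integral_ge => //; try by move=> t; rewrite lee_fin.
    exact: measurable_rev.
  move: hae; apply: negligibleS => t /= nt ht; apply: nt; rewrite in_itv /= lee_fin => /ht; by case/andP.
have i2 : (\int[mu]_(t in [set` `[0, T]%R]) (h t)%:E <= (trig_int F T)%:E)%E.
  rewrite -integral_rev //; apply: ae_integral_le => //; try by move=> t; rewrite lee_fin.
    exact: measurable_rev.
  move: hae; apply: negligibleS => t /= nt ht; apply: nt; rewrite in_itv /= lee_fin => /ht; by case/andP.
rewrite /Rintegral; move: i1 i2; set I := integral _ _ _.
by case: I => [r| |] //; rewrite !lee_fin => -> ->.
Qed.

End TrigIntegral.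

(** * Trigonometric polynomials with values in [0, 1] *)

Section Cutoffs.
Context {R : realType}.
Local Notation C := (Cplx R).
Local Notation expsum := (seq (C * R)).
Implicit Types (E F P : expsum) (t T : R).

(** [re_ev] forgets imaginary parts; it is multiplicative on sums that are real on the axis. *)
Definition real_valued E := forall t, ev E (mkC 0 t) = rc (re_ev E t).
Definition cutoff E :=
  [/\ rat_freqs E, real_valued E & forall t, 0 <= re_ev E t <= 1].

Lemma re_ev_mul E F t : real_valued E -> real_valued F -> re_ev (mulE E F) t = re_ev E t * re_ev F t.
Proof. by move=> hE hF; rewrite {1}/re_ev ev_mul hE hF -rcM re_rc. Qed.
Lemma re_ev_const (c t : R) : re_ev [:: (rc c, 0)] t = c.
Proof. by rewrite /re_ev ev_const re_rc. Qed.
Lemma re_ev_cons_rc (c x t : R) E : re_ev ((rc c, x) :: E) t = c * cos (t * x) + re_ev E t.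
Proof. by rewrite re_ev_cons re_rc im_rc mul0r addr0. Qed.
Lemma real_valued_const (c : R) : real_valued [:: (rc c, 0)].
Proof. by move=> t; rewrite re_ev_const ev_const. Qed.
Lemma real_valued_cat E F : real_valued E -> real_valued F -> real_valued (E ++ F).
Proof. by move=> hE hF t; rewrite re_ev_cat ev_cat hE hF rcD. Qed.
Lemma real_valued_scal (c : R) E : real_valued E -> real_valued (scalE (rc c) E).
Proof. by move=> hE t; rewrite re_ev_scal ev_scal hE rcM. Qed.
Lemma real_valued_mul E F : real_valued E -> real_valued F -> real_valued (mulE E F).
Proof. by move=> hE hF t; rewrite re_ev_mul // ev_mul hE hF rcM. Qed.
Lemma re_ev_sqr P t : re_ev (mulE P (conjE P)) t = cabs (ev P (mkC 0 t)) ^+ 2.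
Proof. by rewrite /re_ev ev_mul_conj re_rc. Qed.
Lemma real_valued_sqr P : real_valued (mulE P (conjE P)).
Proof. by move=> t; rewrite re_ev_sqr ev_mul_conj. Qed.

Lemma mean_le E F : (forall t, re_ev E t <= re_ev F t) -> mean E <= mean F.
Proof.
move=> h; rewrite -subr_ge0.
have -> : mean F - mean E = mean (F ++ scalE (rc (-1)) E) by rewrite mean_cat mean_scal mulN1r.
by apply: mean_ge0 => t; rewrite re_ev_cat re_ev_scal mulN1r subr_ge0.
Qed.

Lemma cutoff_mul E F : cutoff E -> cutoff F -> cutoff (mulE E F).
Proof.
move=> [E1 E2 E3] [F1 F2 F3]; split; [exact: rat_freqs_mul | exact: real_valued_mul |].
move=> t; rewrite re_ev_mul //; case/andP: (E3 t) => e0 e1; case/andP: (F3 t) => f0 f1.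
by rewrite mulr_ge0 // mulr_ile1.
Qed.

(** $\ln\frac{N+2}{N+1}\le\frac1{N+1}$. *)
Lemma small_freq (e : R) : 0 < e -> exists lam, [/\ rat_freq lam, 0 < lam & lam <= e].
Proof.
move=> e0; have [N hN] := nat_ge e^-1.
have N1 : (0 : R) < N.+1%:R by rewrite ltr0n.
have N2 : (0 : R) < N.+2%:R by rewrite ltr0n.
exists (ln N.+2%:R - ln N.+1%:R); split; first by exists N.+2, N.+1.
  by rewrite subr_gt0 ltr_ln ?posrE // ltr_nat.
rewrite -ln_div ?posrE //.
have -> : N.+2%:R / N.+1%:R = 1 + N.+1%:R^-1 :> R.
  by rewrite -(natr1 N.+1) mulrDl divff ?gt_eqF // mul1r.
apply: le_trans (le_ln1Dx _) _; first by apply: lt_trans (_ : 0 < _); rewrite ?ltrN10 // invr_gt0.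
by rewrite -[leRHS]invrK lef_pV2 ?posrE ?invr_gt0 // hN.
Qed.

(** A normalised Fejer kernel $|\frac1N\sum_{j<N}e^{-ij\lambda t}|^2$: distinct frequencies give
    mean $1/N$, and for tiny $\lambda$ the central peak is so wide that it covers $[-a,a]$. *)
Lemma peak (a delta eta : R) : 0 < delta -> 0 < eta ->
  exists E, [/\ cutoff E, mean E <= eta & forall t, `|t| <= a -> 1 - delta <= re_ev E t].
Proof.
move=> d0 e0; have [N0 hN0] := nat_ge eta^-1.
pose N := N0.+1; have N1 : (0 : R) < N%:R by rewrite ltr0n.
have a1 : 0 < 1 + `|a| by rewrite ltr_wpDr.
have d1 : 0 < 1 + delta by rewrite ltr_wpDr // ltW.
have [|lam [lr l0 le]] := @small_freq (delta / (1 + delta) / (4 * N%:R * (1 + `|a|))).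
  by rewrite !divr_gt0 // !mulr_gt0.
pose P : expsum := [seq (rc N%:R^-1, j%:R * lam) | j <- iota 0 N].
have evP t : ev P (mkC 0 t) = \sum_(j <- iota 0 N) rc N%:R^-1 * cexp (- (mkC 0 t * rc (j%:R * lam))).
  by rewrite /ev big_map.
have sum1 : \sum_(j <- iota 0 N) (N%:R^-1 : R) = 1.
  have -> : iota 0 N = index_iota 0 N by rewrite /index_iota subn0.
  by rewrite sumr_const_nat subn0 -[_ *+ N]mulr_natr mulVf // gt_eqF.
have n1 t x : cabs (cexp (- (mkC 0 t * rc x))) = 1.
  by rewrite cabs_cexp reN reM re_mkC re_rc im_rc mulr0 mul0r subrr oppr0 expR0.
have P1 t : cabs (ev P (mkC 0 t)) <= 1.
  rewrite evP -[leRHS]sum1; apply: le_trans (cabs_sum _ _ _) _; apply: ler_sum => j _.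
  by rewrite cabsM cabs_rc n1 mulr1 ger0_norm // invr_ge0 ltW.
have P2 t : `|t| <= a -> 1 - delta / 2 <= cabs (ev P (mkC 0 t)).
  move=> ta.
  have hy j : (j <= N)%N -> `|t * (j%:R * lam)| <= delta / (1 + delta) / 4.
    move=> jN; rewrite normrM (ger0_norm (x := j%:R * lam)); last by rewrite mulr_ge0 // ltW.
    apply: le_trans (_ : (1 + `|a|) * (N%:R * lam) <= _); last first.
      by move: le; rewrite ler_pdivlMr; [nra | rewrite !mulr_gt0].
    apply: ler_pM => //; first by rewrite mulr_ge0 // ltW.
      by have := ler_norm a; lra.
    by rewrite ler_wpM2r ?(ltW l0) // ler_nat.
  have dd : delta / (1 + delta) <= delta /\ delta / (1 + delta) <= 1.
    by rewrite !ler_pdivrMr //; split; nra.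
  have h : cabs (ev P (mkC 0 t) - 1) <= delta / 2.
    have -> : ev P (mkC 0 t) - 1 = \sum_(j <- iota 0 N) rc N%:R^-1 * (cexp (- (mkC 0 t * rc (j%:R * lam))) - 1).
      under [RHS]eq_bigr do rewrite mulrBr mulr1.
      by rewrite sumrB evP -rc_sum sum1.
    apply: le_trans (cabs_sum _ _ _) _.
    rewrite -[leRHS]mul1r -[X in _ <= X * _]sum1 mulr_suml big_seq [leRHS]big_seq; apply: ler_sum => j.
    rewrite mem_iota add0n => /andP[_ /ltnW jN]; rewrite cabsM cabs_rc ger0_norm ?invr_ge0 ?(ltW N1) //.
    rewrite ler_wpM2l ?invr_ge0 ?(ltW N1) // cexp_it.
    set y := t * _; have {}hy : `|y| <= delta / (1 + delta) / 4 := hy j jN.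
    apply: le_trans (cabs_le_reim _) _; rewrite reD imD reN imN re1 im1 re_mkC im_mkC subr0 normrN.
    have h1 := cos_sub1_le y; have h2 := sin_le_norm y.
    have : y ^+ 2 <= `|y|.
      rewrite -(real_normK (num_real y)) expr2 ler_piMr //; lra.
    by lra.
  have := cabs_triangle 1 0 (ev P (mkC 0 t)); rewrite !subr0 cabs1 cabs_distC; lra.
exists (mulE P (conjE P)); split.
- split; [|exact: real_valued_sqr|].
    apply: rat_freqs_mul; [|apply: rat_freqs_conj];
      by move=> _ /mapP[j _ ->] /=; exact: rat_freqMn.
  by move=> t; rewrite re_ev_sqr sqr_ge0 /= expr_le1 ?cabs_ge0.
- rewrite mean_mul_conj; last first.
    rewrite -map_comp map_inj_uniq ?iota_uniq // => i j /= /mulIf.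
    by rewrite gt_eqF // => /(_ isT)/eqP; rewrite eqr_nat => /eqP.
  rewrite big_map (eq_bigr (fun=> (N%:R^-1 : R) * N%:R^-1)); last first.
    by move=> j _; rewrite cabs_rc ger0_norm ?expr2 // invr_ge0 ltW.
  rewrite -mulr_suml sum1 mul1r -[leRHS]invrK lef_pV2 ?posrE ?invr_gt0 //.
  by apply: hN0; exact: leqnSn.
- move=> t /P2 h; rewrite re_ev_sqr; set x := cabs _ in h *; have := cabs_ge0 (ev P (mkC 0 t)).
  by rewrite -/x; nra.
Qed.

(** $(1-\cos\lambda t)/2$ with $\lambda$ small. *)
Lemma dip (a delta : R) : 0 < delta ->
  exists E, [/\ cutoff E, mean E = 2^-1 & forall t, `|t| <= a -> re_ev E t <= delta].
Proof.
move=> d0; have a1 : 0 < 1 + `|a| by rewrite ltr_wpDr.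
have d1 : 0 < 1 + delta by rewrite ltr_wpDr // ltW.
have [|lam [lr l0 le]] := @small_freq (delta / (1 + delta) / (1 + `|a|)).
  by rewrite !divr_gt0.
pose E : expsum := [:: (rc 2^-1, 0); (rc (- 4^-1), lam); (rc (- 4^-1), - lam)].
have rE t : re_ev E t = (1 - cos (t * lam)) / 2.
  by rewrite /E !re_ev_cons_rc /re_ev ev_nil re0 mulrN cosN mulr0 cos0; lra.
exists E; split.
- split.
  + by move=> p; rewrite !inE => /or3P[] /eqP -> //=; [exact: rat_freq0 | exact: rat_freqN].
  + move=> t; rewrite rE; apply: C_ext; first by rewrite -rE re_rc.
    rewrite im_rc /E !ev_cons ev_nil !imD im0 !imM !re_rc !im_rc !cexp_it !im_mkC /= mulr0 sin0.
    by rewrite (mulrN t lam) sinN; lra.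
  + move=> t; rewrite rE; have := cos_max (t * lam); rewrite ler_norml => /andP[? ?].
    by apply/andP; split; lra.
- by rewrite /mean /E !big_cons big_nil /= eqxx oppr_eq0 (gt_eqF l0) /=; lra.
- move=> t ta; rewrite rE.
  have dd : delta / (1 + delta) <= delta /\ delta / (1 + delta) <= 1.
    by rewrite !ler_pdivrMr //; split; nra.
  have hy : `|t * lam| <= delta / (1 + delta).
    rewrite normrM (ger0_norm (ltW l0)); move: le; rewrite ler_pdivlMr //.
    by have := ler_norm a; nra.
  have := cos_sub1_le (t * lam); rewrite ler_norml => /andP[h _].
  have : (t * lam) ^+ 2 <= `|t * lam|.
    by rewrite -(real_normK (num_real (t * lam))) expr2 ler_piMr //; lra.
  by lra.
Qed.

(** The product of a dip, small on $[-a,a]$ but of mean $1/2$, and a peak, at least $1/2$ on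
    $[-B,B]$ but of tiny mean. The dip supplies the mass on $[0,B]$; the peak makes the long-run
    average negligible. *)
Lemma hump (a delta : R) : 0 <= a -> 0 < delta -> exists (E : expsum) (B A : R),
  [/\ cutoff E, forall t, `|t| <= a -> re_ev E t <= delta,
      a <= B <= A, B / 8 <= trig_int E B &
      forall T, A <= T -> trig_int E T <= 2 * delta * T].
Proof.
move=> a0 d0; have [S [hS mS sS]] := dip a d0.
have [K hK] := trig_int_mean S.
have K0 : 0 <= K by apply: le_trans (hK 0).
(* Then $\frac12(B/2-K)\ge B/8$, which is the mass of half the dip over $[0,B]$. *)
pose B := a + 4 * K + 1.
have B0 : 0 < B by rewrite /B; lra.
have [//|P [hP mP sP]] := @peak B 2^-1 delta _ d0.
have [S1 S2 S3] := hS; have [P1 P2 P3] := hP.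
have [K' hK'] := trig_int_mean (mulE P S).
exists (mulE P S), B, (B + K' / delta); split.
- exact: cutoff_mul.
- move=> t /sS h; rewrite re_ev_mul //; apply: le_trans h.
  by rewrite ler_piMl //; [case/andP: (S3 t) | case/andP: (P3 t)].
- have : 0 <= K' by apply: le_trans (hK' 0).
  by move=> K'0; rewrite lerDl divr_ge0 ?(ltW d0) // /B; apply/andP; split => //; lra.
- apply: le_trans (_ : trig_int (scalE (rc 2^-1) S) B <= _).
    rewrite trig_int_scal; have := hK B; rewrite mS ler_norml => /andP[h _].
    by move: h; rewrite /B; lra.
  apply: trig_int_le => // t /andP[t0 tB]; rewrite re_ev_scal re_ev_mul //.
  have /sP : `|t| <= B by rewrite ger0_norm.
  by case/andP: (S3 t) => s0 _ h; apply: ler_wpM2r => //; lra.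
- move=> T hT; have := hK' T; rewrite ler_norml => /andP[_ h].
  have K'0 : 0 <= K' by apply: le_trans (hK' 0).
  have K'd : 0 <= K' / delta by rewrite divr_ge0 // ltW.
  have T0 : 0 < T by lra.
  have : mean (mulE P S) <= delta.
    apply: le_trans mP; apply: mean_le => t; rewrite re_ev_mul //.
    by rewrite ler_piMr //; [case/andP: (P3 t) | case/andP: (S3 t)].
  move=> m1; have : K' <= delta * T by rewrite mulrC -ler_pdivrMr //; lra.
  have : mean (mulE P S) * T <= delta * T by rewrite ler_wpM2r // ltW.
  lra.
Qed.

End Cutoffs.

(** * The two examples *)

Section ProductConstruction.
Context {R : realType}.
Local Notation C := (Cplx R).
Local Notation expsum := (seq (C * R)).
Local Notation mu := (@lebesgue_measure R).

Variable e : nat -> expsum.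
Hypothesis e_cutoff : forall k, cutoff (e k).
Implicit Types (t : R) (n k K : nat).

Fixpoint compl_list n : expsum := if n is n'.+1 then
  mulE (compl_list n') ([:: (rc 1, 0)] ++ scalE (rc (-1)) (e n')) else [:: (rc 1, 0)].
Definition compl_prod t n : R := \prod_(j < n) (1 - re_ev (e j) t).

Lemma cutoff_bounds k t : 0 <= re_ev (e k) t /\ re_ev (e k) t <= 1.
Proof. by have [_ _ h] := e_cutoff k; apply/andP. Qed.

Lemma compl_prodS t n : compl_prod t n.+1 = compl_prod t n * (1 - re_ev (e n) t).
Proof. by rewrite /compl_prod big_ord_recr. Qed.
Lemma compl_prod0 t : compl_prod t 0 = 1. Proof. by rewrite /compl_prod big_ord0. Qed.

Lemma compl_prod_ge0 t n : 0 <= compl_prod t n.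
Proof. by apply: prodr_ge0 => j _; have [_ ?] := cutoff_bounds j t; rewrite subr_ge0. Qed.

Lemma compl_prod_nonincr t n m : (n <= m)%N -> compl_prod t m <= compl_prod t n.
Proof.
move=> /subnKC <-; elim: (m - n)%N => [|d IH]; first by rewrite addn0.
rewrite addnS compl_prodS; apply: le_trans IH.
by rewrite ler_piMr ?compl_prod_ge0 //; have [? _] := cutoff_bounds (n + d) t; lra.
Qed.

Lemma compl_prod_le1 t n : compl_prod t n <= 1.
Proof. by rewrite -(compl_prod0 t); exact: compl_prod_nonincr. Qed.

Lemma compl_prod_le t n k : (k < n)%N -> compl_prod t n <= 1 - re_ev (e k) t.
Proof.
move=> kn; apply: le_trans (compl_prod_nonincr t kn) _; rewrite compl_prodS.
by rewrite ler_piMl ?compl_prod_le1 // subr_ge0; have [] := cutoff_bounds k t.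
Qed.

(** Weierstrass' product inequality; it turns small cutoffs into an upper bound for the boundary
    exponent. *)
Lemma compl_prod_ge t n : 1 - \sum_(j < n) re_ev (e j) t <= compl_prod t n.
Proof.
elim: n => [|n IH]; first by rewrite big_ord0 compl_prod0 subr0.
rewrite big_ord_recr compl_prodS /=; have [? _] := cutoff_bounds n t.
have : compl_prod t n * re_ev (e n) t <= re_ev (e n) t by rewrite ler_piMl ?compl_prod_le1.
lra.
Qed.

Lemma compl_listP n : [/\ rat_freqs (compl_list n), real_valued (compl_list n) &
  forall t, re_ev (compl_list n) t = compl_prod t n].
Proof.
elim: n => [|n [h1 h2 h3]].
  split; [exact: rat_freqs_const | exact: real_valued_const |].
  by move=> t; rewrite re_ev_const compl_prod0.
have [k1 k2 _] := e_cutoff n.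
have r2 : real_valued ([:: (rc 1, 0)] ++ scalE (rc (-1)) (e n)).
  by apply: real_valued_cat; [exact: real_valued_const | exact: real_valued_scal].
split.
- apply: rat_freqs_mul => //.
  by apply: rat_freqs_cat; [exact: rat_freqs_const | exact: rat_freqs_scal].
- exact: real_valued_mul.
- by move=> t; rewrite re_ev_mul // h3 compl_prodS re_ev_cat re_ev_const re_ev_scal mulN1r.
Qed.

(** Here $\phi_k$ is $c\,e_k$ times the preceding factors; these sums telescope, and the mean of
    $\phi_k$ is at most $c$ times that of $e_k$, which cancels the division by $c$ in the norm
    bound. *)
Theorem product_construction (c A : R) : 0 < c ->
  (forall k t, `|t| <= k%:R -> c * (re_ev (e k) t * compl_prod t k) <= A * 8^-1 ^+ k) ->
  exists (g : C -> C) (a : nat -> C),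
  [/\ Hinfty g, represented_by g a,
      forall s, right_half_plane s -> g s != 0,
      forall s, right_half_plane s -> cabs (g s) <= 1 &
      (forall delta, (forall K, \sum_(k < K) mean (e k) <= delta) ->
         forall N, \sum_(1 <= n < N.+1) cabs (a n) ^+ 2 <= expR (- (2 * c)) + delta) /\
      {ae mu, forall t, exists psi,
         [/\ cabs (boundary_value g t) = expR (psi - c),
             forall K, c * (1 - compl_prod t K) <= psi &
             forall (K : nat) (r : R),
               (forall n, (K <= n)%N -> c * (1 - compl_prod t n) <= r) -> psi <= r]}].
Proof.
move=> c0 hA.
pose E k := scalE (rc c) (mulE (e k) (compl_list k)).
have rE k t : re_ev (E k) t = c * (re_ev (e k) t * compl_prod t k).
  by have [_ h2 h3] := compl_listP k; have [_ k2 _] := e_cutoff k; rewrite re_ev_scal re_ev_mul // h3.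
have hE k : rat_freqs (E k).
  have [h1 _ _] := compl_listP k; have [k1 _ _] := e_cutoff k.
  by apply: rat_freqs_scal; exact: rat_freqs_mul.
have evE k t : ev (E k) (mkC 0 t) = rc (c * (re_ev (e k) t * compl_prod t k)).
  rewrite -rE; have [_ h2 _] := compl_listP k; have [_ k2 _] := e_cutoff k.
  by move: t; apply: real_valued_scal; exact: real_valued_mul.
have sumE K t : \sum_(k < K) c * (re_ev (e k) t * compl_prod t k) = c * (1 - compl_prod t K).
  elim: K => [|K IH]; first by rewrite big_ord0 compl_prod0 subrr mulr0.
  by rewrite big_ord_recr IH compl_prodS /=; ring.
have [|||g [a [h1 h2 h3 h4 [h5 h6]]]] := @singular_type_construction R E _ c A c0 hE evE.
- move=> k t; apply: mulr_ge0; first exact: ltW.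
  by apply: mulr_ge0 (compl_prod_ge0 t k); have [] := cutoff_bounds k t.
- move=> K t; rewrite sumE ler_piMr ?(ltW c0) //; have := compl_prod_ge0 t K; lra.
- exact: hA.
exists g, a; split => //.
- split => //; last by exists a.
  by exists 1 => s s0; exact: h4.
split.
- move=> delta hd N; have -> : delta = c * delta / c by rewrite mulrAC divff ?mul1r // gt_eqF.
  apply: h5 => K; apply: le_trans (_ : c * \sum_(k < K) mean (e k) <= _); last first.
    by rewrite ler_wpM2l // ltW.
  rewrite mulr_sumr; apply: ler_sum => k _; rewrite -mean_scal; apply: mean_le => t.
  rewrite rE re_ev_scal ler_wpM2l ?(ltW c0) // ler_piMr ?compl_prod_le1 //; by have [] := cutoff_bounds k t.
- apply: negligibleS h6 => t /= nt [psi [p1 p2 p3]]; apply: nt; exists psi; split => //.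
  + by move=> K; move: (p2 K); rewrite sumE.
  + by move=> K r hr; apply: (p3 K) => n /hr; have := sumE n t => ->.
Qed.

End ProductConstruction.

(** * An inner function of small norm and an oscillating mean *)

Section Oscillation.
Context {R : realType}.
Local Notation C := (Cplx R).
Local Notation expsum := (seq (C * R)).
Local Notation mu := (@lebesgue_measure R).

Lemma sum_pow8 (d : R) n : 0 <= d -> \sum_(k < n) d * 8^-1 ^+ k <= 2 * d.
Proof.
move=> d0; have p0 m : 0 <= d * 8^-1 ^+ m by rewrite mulr_ge0 // exprn_ge0.
suff : \sum_(k < n) d * 8^-1 ^+ k <= 2 * d - 2 * (d * 8^-1 ^+ n) by have := p0 n; lra.
elim: n => [|n IH]; first by rewrite big_ord0 expr0; lra.
by rewrite big_ord_recr /= exprS; have := p0 n; move: IH; lra.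
Qed.

Lemma re_ev_bigcat (e : nat -> expsum) n (t : R) :
  re_ev (\big[cat/[::]]_(j < n) e j) t = \sum_(j < n) re_ev (e j) t.
Proof.
apply: (big_morph (fun E => re_ev E t)) => [E F|]; first exact: re_ev_cat.
by rewrite /re_ev ev_nil re0.
Qed.

Lemma trig_int_bigcat (e : nat -> expsum) n (T : R) :
  trig_int (\big[cat/[::]]_(j < n) e j) T = \sum_(j < n) trig_int (e j) T.
Proof.
apply: (big_morph (fun E => trig_int E T)) => [E F|]; first exact: trig_int_cat.
by rewrite /trig_int big_nil.
Qed.

Lemma singular_inner_small_norm (eps : R) : 0 < eps ->
  exists (g : C -> C) (a : nat -> C),
    [/\ Hinfty g, singular_inner g, represented_by g a & (norm2 a <= eps%:E)%E].
Proof.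
(* This gives $e^{-2c}\le\varepsilon^2/2$; the means of the cutoffs below add at most another
   $\varepsilon^2/2$. *)
move=> eps0; pose c := (eps ^+ 2)^-1.
have e20 : 0 < eps ^+ 2 by rewrite exprn_gt0.
have c0 : 0 < c by rewrite invr_gt0.
(* The shift to [k.+1] matters: for $|t|\le k$ with $k\ge1$, the factor of index $k-1$ already makes
   the product of the first $k$ factors at most $8^{-k}$. *)
have he (k : nat) : exists E : expsum, [/\ cutoff E, mean E <= eps ^+ 2 / 4 * 8^-1 ^+ k &
    forall t, `|t| <= k.+1%:R -> 1 - 8^-1 ^+ k.+1 <= re_ev E t].
  by apply: peak; rewrite ?exprn_gt0 // mulr_gt0 ?divr_gt0 ?exprn_gt0.
have [e he'] := choice he.
have e_cutoff k : cutoff (e k) by have [] := he' k.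
have small t k : `|t| <= k%:R -> compl_prod e t k <= 8^-1 ^+ k.
  case: k => [|k] tk; first by rewrite compl_prod0 expr0.
  have [_ _ /(_ t tk) h] := he' k.
  by have := compl_prod_le e_cutoff t (ltnSn k); lra.
have [|g [a [h1 h2 h3 h4 [h5 h6]]]] := @product_construction _ e e_cutoff c c c0.
  move=> k t tk; rewrite ler_wpM2l ?(ltW c0) //; apply: le_trans (small t k tk).
  by have [_ ?] := cutoff_bounds e_cutoff k t; rewrite ler_piMl // compl_prod_ge0.
exists g, a; split => //.
- split => //; first by have [] := h1.
  apply: negligibleS h6 => t /= nt [psi [p1 p2 p3]]; apply: nt; rewrite p1.
  suff -> : psi = c by rewrite subrr expR0.
  apply/eqP; rewrite eq_le; apply/andP; split.
    by apply: (p3 0) => n _; rewrite ler_piMr ?(ltW c0) //; have := compl_prod_ge0 e_cutoff t n; lra.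
  apply: le_eps => r r0; have [N hN] := nat_ge `|t|.
  have [M hM] := @pow2_small _ c r r0.
  have tK : `|t| <= (maxn N M)%:R by apply: hN; exact: leq_maxl.
  have h7 : c * 8^-1 ^+ maxn N M <= r.
    apply: le_trans (hM _ (leq_maxr N M)); apply: ler_wpM2l; first exact: ltW.
    by apply: lerXn2r; rewrite ?nnegrE //; lra.
  have h8 : c * compl_prod e t (maxn N M) <= c * 8^-1 ^+ maxn N M.
    by apply: ler_wpM2l; [exact: ltW | exact: small].
  by have := p2 (maxn N M); lra.
- apply: norm2_le; first exact: ltW.
  move=> N; apply: le_trans (h5 (eps ^+ 2 / 2) _ N) _.
    move=> K; apply: le_trans (_ : \sum_(k < K) eps ^+ 2 / 4 * 8^-1 ^+ k <= _).
      by apply: ler_sum => k _; have [] := he' k.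
    apply: le_trans (sum_pow8 _ _) _; last by lra.
    by rewrite divr_ge0 // ltW.
  have : expR (- (2 * c)) <= eps ^+ 2 / 2.
    rewrite expRN -[leRHS]invrK lef_pV2 ?posrE ?expR_gt0 ?invr_gt0 ?divr_gt0 //.
    rewrite invf_div -/c; have := expR_ge1Dx (2 * c); rewrite /c; lra.
  by lra.
Qed.

Lemma boundary_mean_oscillates : exists f : C -> C,
  Hinfty f /\ ~ cvg (boundary_mean f T @[T --> +oo%R]).
Proof.
pose M : R := expR 2; have M0 : 0 < M by exact: expR_gt0.
(* With $96Md=1$ the low means are at most $M^{-1}(1+12Md)=\frac98M^{-1}$, while the high ones are
   at least $M^{-1}(1+\frac28)=\frac54M^{-1}$. *)
pose d := (96 * M)^-1; have d0 : 0 < d by rewrite invr_gt0 mulr_gt0.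
pose dl k := d * 8^-1 ^+ k; have dl0 k : 0 < dl k by rewrite mulr_gt0 // exprn_gt0.
(* The state is the pair $(k,A_k)$. The maximum with $k+1$ drives $A_k$ to infinity and keeps the
   $k$-th cutoff small on $[-k,k]$, as [product_construction] requires. *)
have hstep (x : nat * R) : exists y : expsum * R * R,
  [/\ cutoff y.1.1, forall t, `|t| <= Num.max x.2 x.1.+1%:R -> re_ev y.1.1 t <= dl x.1,
      Num.max x.2 x.1.+1%:R <= y.1.2 <= y.2, y.1.2 / 8 <= trig_int y.1.1 y.1.2 &
      forall T, y.2 <= T -> trig_int y.1.1 T <= 2 * dl x.1 * T].
  have [|E [B [A h]]] := @hump R (Num.max x.2 x.1.+1%:R) (dl x.1) _ (dl0 _).
    by rewrite le_max ler0n orbT.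
  by exists (E, B, A).
have [D hD] := choice hstep.
pose fix A (k : nat) : R := if k is k'.+1 then (D (k', A k')).2 else 0.
pose e k := (D (k, A k)).1.1; pose B k := (D (k, A k)).1.2.
have e_cutoff k : cutoff (e k) by have [] := hD (k, A k).
have small_A k t : `|t| <= A k -> re_ev (e k) t <= dl k.
  by move=> tk; have [_ + _ _ _] := hD (k, A k); apply => /=; rewrite le_max tk.
have small_k k t : `|t| <= k%:R -> re_ev (e k) t <= dl k.
  move=> tk; have [_ + _ _ _] := hD (k, A k); apply => /=.
  have h : (k%:R : R) <= k.+1%:R by rewrite ler_nat.
  by rewrite le_max (le_trans tk h) orbT.
have AB k : [/\ A k <= B k, k.+1%:R <= B k & B k <= A k.+1].
  by have [_ _ /andP[+ +] _ _] := hD (k, A k); rewrite ge_max => /andP[].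
have tintB k : B k / 8 <= trig_int (e k) (B k) by have [] := hD (k, A k).
have tintA k T : A k.+1 <= T -> trig_int (e k) T <= 2 * dl k * T by have [_ _ _ _ h] := hD (k, A k); exact: h.
have Amono k n : (k <= n)%N -> A k <= A n.
  move=> /subnKC <-; elim: (n - k)%N => [|m IH]; first by rewrite addn0.
  rewrite addnS; have [h1 _ h2] := AB (k + m)%N; exact: le_trans IH (le_trans h1 h2).
have [|g [a [h1 h2 h3 h4 [_ h6]]]] := @product_construction _ e e_cutoff 1 d ltr01.
  move=> k t tk; rewrite mul1r; apply: le_trans (small_k k t tk).
  by have [? _] := cutoff_bounds e_cutoff k t; rewrite ler_piMr // compl_prod_le1.
exists g; split => //.
pose h t := cabs (boundary_value g t) ^+ 2.
have h0 t : 0 <= h t by exact: sqr_ge0.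
(* Since $0\le\psi\le1$, one has $1+2\psi\le e^{2\psi}\le1+2M\psi$. Below, $\psi\ge e_k$; above, on
   $[0,A_k]$ the cutoffs of index at least $k$ add at most $2d$. *)
have hae : {ae mu, forall t, [/\ h t <= 1, forall k, M^-1 * (1 + 2 * re_ev (e k) t) <= h t &
    forall k, 0 <= t <= A k -> h t <= M^-1 * (1 + 2 * M * (\sum_(j < k) re_ev (e j) t + 2 * d))]}.
  apply: negligibleS h6 => t /= nt [psi [p1 p2 p3]]; apply: nt.
  have hpsi : h t = M^-1 * expR (2 * psi).
    rewrite /h p1 expr2 -expRD /M -expRN -expRD; congr expR; ring.
  have psi1 : psi <= 1.
    by apply: (p3 0%N) => n _; have := compl_prod_ge0 e_cutoff t n; lra.
  have psi0 : 0 <= psi by have := p2 0%N; rewrite compl_prod0 subrr mulr0.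
  have iM : 0 <= M^-1 by rewrite invr_ge0 ltW.
  have le2 : expR (2 * psi) <= M by rewrite /M ler_expR; lra.
  split.
  - by rewrite hpsi mulrC ler_pdivrMr // mul1r.
  - move=> k; rewrite hpsi; apply: ler_wpM2l => //.
    have := expR_ge1Dx (2 * psi); have := p2 k.+1; have := compl_prod_le e_cutoff t (ltnSn k); lra.
  - move=> k /andP[t0 tA]; rewrite hpsi; apply: ler_wpM2l => //.
    have psi_le : psi <= \sum_(j < k) re_ev (e j) t + 2 * d.
      apply: (p3 k) => n kn; have := compl_prod_ge e_cutoff t n.
      have : \sum_(j < n) re_ev (e j) t <= \sum_(j < k) re_ev (e j) t + 2 * d.
        rewrite -(subnKC kn) big_split_ord /= lerD2l.
        apply: le_trans (sum_pow8 (n - k) (ltW d0)); apply: ler_sum => j _.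
        apply: le_trans (small_A _ _ _) _.
          by rewrite ger0_norm //; apply: le_trans tA (Amono _ _ (leq_addr _ _)).
        rewrite /dl ler_pM2l // exprD ler_piMl ?exprn_ge0 // exprn_ile1 //; lra.
      by lra.
    have h8 := expR_ge1Dx (- (2 * psi)).
    have h9 : expR (2 * psi) * expR (- (2 * psi)) = 1 by rewrite -expRD subrr expR0.
    have h10 := expR_gt0 (2 * psi).
    have h11 : expR (2 * psi) * (1 + - (2 * psi)) <= 1 by rewrite -[leRHS]h9 ler_pM2l.
    have h12 : 2 * psi * expR (2 * psi) <= 2 * psi * M by rewrite ler_wpM2l //; lra.
    have h13 : 2 * M * psi <= 2 * M * (\sum_(j < k) re_ev (e j) t + 2 * d).
      by rewrite ler_wpM2l //; lra.
    lra.
have meanE T : 0 < T -> boundary_mean g T * T = \int[mu]_(t in `[0, T]) h t.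
  by move=> T0; rewrite /boundary_mean mulrAC mulVf ?mul1r // gt_eqF.
have iM0 : 0 < M^-1 by rewrite invr_gt0.
have high k : M^-1 * (5 / 4) <= boundary_mean g (B k).
  have B0 : 0 < B k by have [_ + _] := AB k; apply: lt_le_trans; rewrite ltr0n.
  rewrite -(ler_pM2r B0) meanE //.
  pose E := scalE (rc M^-1) ([:: (rc 1, 0)] ++ scalE (rc 2) (e k)).
  have rE t : re_ev E t = M^-1 * (1 + 2 * re_ev (e k) t).
    by rewrite re_ev_scal re_ev_cat re_ev_const re_ev_scal.
  have [] := andP (@trig_int_sandwich R E [:: (rc 1, 0)] h (B k) B0 h0 _ _ _).
  - by move=> t; rewrite rE mulr_ge0 ?(ltW iM0) //; have [? _] := cutoff_bounds e_cutoff k t; lra.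
  - by move=> t; rewrite re_ev_const.
  - by apply: negligibleS hae => t /= nt [k1 k2 _]; apply: nt => _; rewrite rE re_ev_const k1 k2.
  move=> lo _; apply: le_trans lo; rewrite trig_int_scal trig_int_cat trig_int_const trig_int_scal -mulrA.
  by rewrite ler_wpM2l ?(ltW iM0) //; have := tintB k; lra.
have low k : boundary_mean g (A k.+1) <= M^-1 * (9 / 8).
  have A0 : 0 < A k.+1.
    by have [_ q1 q2] := AB k; apply: lt_le_trans (le_trans q1 q2); rewrite ltr0n.
  rewrite -(ler_pM2r A0) meanE //.
  pose E := scalE (rc M^-1) ([:: (rc 1, 0)] ++
     scalE (rc (2 * M)) (\big[cat/[::]]_(j < k.+1) e j ++ [:: (rc (2 * d), 0)])).
  have rE t : re_ev E t = M^-1 * (1 + 2 * M * (\sum_(j < k.+1) re_ev (e j) t + 2 * d)).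
    by rewrite re_ev_scal re_ev_cat re_ev_const re_ev_scal re_ev_cat re_ev_bigcat re_ev_const.
  have [] := andP (@trig_int_sandwich R [::] E h (A k.+1) A0 h0 _ _ _).
  - by move=> t; rewrite /re_ev ev_nil re0.
  - move=> t; rewrite rE mulr_ge0 ?(ltW iM0) // addr_ge0 // mulr_ge0 ?mulr_ge0 ?(ltW M0) //.
    by rewrite addr_ge0 ?mulr_ge0 ?(ltW d0) // sumr_ge0 // => j _; have [] := cutoff_bounds e_cutoff j t.
  - apply: negligibleS hae => t /= nt [_ _ k3]; apply: nt => tA.
    by rewrite rE k3 // andbT /re_ev ev_nil re0.
  move=> _ up; apply: le_trans up _; rewrite trig_int_scal trig_int_cat trig_int_const trig_int_scal trig_int_cat trig_int_const trig_int_bigcat -(mulrA M^-1).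
  rewrite ler_wpM2l ?(ltW iM0) //.
  have s1 : \sum_(j < k.+1) trig_int (e j) (A k.+1) <= 4 * d * A k.+1.
    apply: le_trans (_ : \sum_(j < k.+1) 2 * dl j * A k.+1 <= _).
      by apply: ler_sum => j _; apply: tintA; apply: Amono.
    rewrite -mulr_suml -mulr_sumr ler_wpM2r ?(ltW A0) //.
    by have := sum_pow8 k.+1 (ltW d0); rewrite -/dl; lra.
  have s2 : 2 * M * (\sum_(j < k.+1) trig_int (e j) (A k.+1) + 2 * d * A k.+1) <= 2 * M * (6 * d * A k.+1).
    by rewrite ler_wpM2l ?mulr_ge0 ?(ltW M0) //; lra.
  have s3 : 2 * M * (6 * d * A k.+1) = A k.+1 / 8.
    by rewrite /d; field; rewrite gt_eqF.
  lra.
(* Two means within $M^{-1}/20$ of a limit differ by less than $M^{-1}/10$, which is below the gap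
   $M^{-1}/8$. *)
move=> /cvgrPdist_lt /(_ (M^-1 / 20)) []; first by rewrite divr_gt0.
move=> x [_ hx]; have [N hN] := nat_ge (x + 1).
have xN : x + 1 <= N.+1%:R by apply: hN.
have [_ b1 b2] := AB N.
have := hx (B N) _; have := hx (A N.+1) _.
move=> /(_ ltac:(lra)) + /(_ ltac:(lra)); rewrite /= !ltr_norml => /andP[? ?] /andP[? ?].
have := high N; have := low N; lra.
Qed.

End Oscillation.

Theorem theorem1 (R : realType) :
  (exists f : Cplx R -> Cplx R,
     Hinfty f /\ ~ cvg (boundary_mean f T @[T --> +oo%R])) /\
  (forall eps : R, 0 < eps ->
     exists (g : Cplx R -> Cplx R) (a : nat -> Cplx R),
       [/\ Hinfty g, singular_inner g, represented_by g a &
           (norm2 a <= eps%:E)%E]).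
Proof.
split; first exact: boundary_mean_oscillates.
by move=> eps; exact: singular_inner_small_norm.
Qed.
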